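(* Let $N\ge 2$, let $\tau$ be a partition of $N$, let $S\in\mathcal{Y}(\tau)$, let $m\ge1$ be an integer, and let $\alpha=(m,0,\ldots,0)\in\mathbb{N}_0^N$. Let $\widehat\tau$ be obtained from $\tau$ by removing the box of $S$ containing $1$, and let $\mathcal{Z}(\widehat\tau)$ be the associated set of contents. Suppose $z\in\mathcal{Z}(\widehat\tau)$ and $n:=c(1,S)-z\ne0$. Let $g=\gcd(m,n)$, let $u\in\mathbb{C}\setminus\{0\}$ be not a root of unity, let $\omega=\exp\left(\frac{2\pi \mathrm{i}k}{m}\right)$ with $k\in\mathbb{Z}$, $\gcd(k,g)=1$, and let $\varpi=(\omega u^{-n/g},u^{m/g})$. Then the nonsymmetric vector-valued Macdonald polynomial $M_{\alpha,S}$ is a singular polynomial for $(q,t)=\varpi$; that is, $M_{\alpha,S}$ has no pole at $(q,t)=\varpi$, and when evaluated at $(q,t)=\varpi$ it satisfies $M_{\alpha,S}\mathcal{D}_i=0$ for all $1\le i\le N$.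
   Context: Tableaux. For a partition $\tau$ of $N$ with $\ell(\tau)$ nonzero parts, the Ferrers diagram has boxes $(i,j)$, $1\le i\le \ell(\tau)$, $1\le j\le\tau_i$. $\mathcal{Y}(\tau)$ is the set of reverse standard Young tableaux (RSYT) of shape $\tau$: fillings of the boxes by $1,\ldots,N$, each used once, with entries decreasing along each row and each column. For $S\in\mathcal{Y}(\tau)$ the entry $i$ is in box $(\mathrm{row}(i,S),\mathrm{col}(i,S))$ and its content is $c(i,S)=\mathrm{col}(i,S)-\mathrm{row}(i,S)$. Hecke algebra and representation. $\mathcal{H}_N(t)$ ($t\neq0$ not a root of unity) is generated by $T_1,\ldots,T_{N-1}$ with $(T_i+1)(T_i-t)=0$ and the braid relations $T_iT_{i+1}T_i=T_{i+1}T_iT_{i+1}$, $T_iT_j=T_jT_i$ for $|i-j|\ge2$. All actions are on the right. $V_\tau$ has basis $\mathcal{Y}(\tau)$; with $b=c(i,S)-c(i+1,S)$ and $S^{(i)}$ denoting $S$ with $i,i+1$ exchanged: $S\tau(T_i)=tS$ if $b=1$; $S\tau(T_i)=-S$ if $b=-1$; $S\tau(T_i)=S^{(i)}+\frac{t-1}{1-t^{-b}}S$ if $b\ge2$; $S\tau(T_i)=\frac{t(t^{b+1}-1)(t^{b-1}-1)}{(t^b-1)^2}S^{(i)}+\frac{t^b(t-1)}{t^b-1}S$ if $b\le-2$. Operators on $\mathcal{P}_\tau=\mathcal{P}\otimes V_\tau$ ($\mathcal{P}$ = polynomials in $x_1,\ldots,x_N$; $xs_i$ is $x$ with $x_i,x_{i+1}$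 exchanged): $(p(x)\otimes S)T_i=(1-t)x_{i+1}\frac{p(x)-p(xs_i)}{x_i-x_{i+1}}\otimes S+p(xs_i)\otimes S\tau(T_i)$; $(p(x)\otimes S)w=p(qx_N,x_1,\ldots,x_{N-1})\otimes S\tau(T_1T_2\cdots T_{N-1})$; Cherednik operators $\xi_i=t^{i-N}T_{i-1}^{-1}\cdots T_1^{-1}wT_{N-1}\cdots T_i$ (products applied from left to right); Dunkl operators $p\mathcal{D}_N=(p-p\xi_N)/x_N$ and $\mathcal{D}_i=\frac1tT_i\mathcal{D}_{i+1}T_i$ for $1\le i<N$. Orders and ranks. For $\alpha\in\mathbb{N}_0^N$, $\alpha^+$ is its nonincreasing rearrangement and $|\alpha|=\sum_i\alpha_i$. $\alpha\succ\beta$ means $\alpha\neq\beta$ and $\sum_{i\le j}\alpha_i\ge\sum_{i\le j}\beta_i$ for all $1\le j\le N$; $\alpha\vartriangleright\beta$ means $|\alpha|=|\beta|$ and either $\alpha^+\succ\beta^+$, or $\alpha^+=\beta^+$ and $\alpha\succ\beta$. The rank function is $r_\alpha(i)=\#\{j\le i:\alpha_j\ge\alpha_i\}+\#\{j>i:\alpha_j>\alpha_i\}$. Macdonald polynomials. For $(\alpha,S)\in\mathbb{N}_0^N\times\mathcal{Y}(\tau)$ and generic $(q,t)$, $M_{\alpha,S}\in\mathcal{P}_\tau$ is the simultaneous eigenfunction $M_{\alpha,S}\xi_i=\widetilde\zeta_{\alpha,S}(i)M_{\alpha,S}$, $\widetilde\zeta_{\alpha,S}(i)=q^{\alpha_i}t^{c(r_\alpha(i),S)}$,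 $1\le i\le N$, of the form $M_{\alpha,S}=q^at^bx^\alpha\otimes S\tau(R_\alpha)+\sum_{\beta\vartriangleleft\alpha}x^\beta\otimes v_{\alpha,\beta,S}(q,t)$, with $v_{\alpha,\beta,S}(q,t)\in V_\tau$ having coefficients rational in $q,t$, certain integers $a,b$ depending on $(\alpha,S)$ (their values are immaterial here), and $R_\alpha=(T_{i_1}\cdots T_{i_l})^{-1}$ where $\alpha s_{i_1}\cdots s_{i_l}=\alpha^+$ with $l$ minimal (each $s_i$ exchanging entries $i$ and $i+1$). Existence and uniqueness are known. The set $\mathcal{Z}(\widehat\tau)$. $\widehat\tau_i=\tau_i-1$ if $i=\mathrm{row}(1,S)$ and $\widehat\tau_i=\tau_i$ otherwise, $1\le i\le\ell(\tau)$. Let $1=i_1<i_2<\cdots<i_{k-1}$ be the indices in $\{1,\ldots,\ell(\tau)\}$ at which a maximal block of equal values of $(\widehat\tau_1,\ldots,\widehat\tau_{\ell(\tau)})$ starts (so $\widehat\tau_j=\widehat\tau_{i_s}$ for $i_s\le j<i_{s+1}$ and $\widehat\tau_{i_{s}}<\widehat\tau_{i_{s-1}}$), and $i_k=\ell(\tau)+1$. Then $\mathcal{Z}(\widehat\tau)=\{\widehat\tau_{i_s}+1-i_s:1\le s\le k-1\}$, together with the additional element $-\ell(\tau)$ if $\widehat\tau_{\ell(\tau)}\ge1$. *)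

(* Defs.v *)
From HB Require Import structures.
From mathcomp Require Import all_boot all_order all_algebra.
From mathcomp Require Import perm fraction mpoly.
From mathcomp Require Import boolp classical_sets reals trigo.
From mathcomp Require Import complex.

Set Implicit Arguments.
Unset Strict Implicit.
Unset Printing Implicit Defensive.

Import Order.TTheory GRing.Theory Num.Theory.

Local Open Scope ring_scope.

(** Conventions.  Everything is indexed from 0: the entry, variable or
    generator written [i] below is number [i + 1] in one-based notation, and
    rows and columns are also counted from 0, which does not affect contents.
    For [i : 'I_N], [ordS i] and [ord_pred i] are the cyclic successor and
    predecessor.  A generator [T_i] is meaningful only when [i.+1 < N], and
    then [ordS i] is the genuine successor of [i].  All operators act on the
    right: a word [[:: i1; ...; il]] applies [i1] first. *)

Definition is_partition (N : nat) (tau : seq nat) : bool :=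
  [&& sorted geq tau, 0%N \notin tau & sumn tau == N].

Definition ferrers (N : nat) (tau : seq nat) : {set 'I_N * 'I_N} :=
  [set b : 'I_N * 'I_N | (b.2 < nth 0 tau b.1)%N].

(** A filling is stored as the function sending an entry to its box
    (row, column). *)
Definition is_rsyt (N : nat) (tau : seq nat) (p : {ffun 'I_N -> 'I_N * 'I_N}) :
    bool :=
  [&& injectiveb p,
      [set p i | i : 'I_N] == ferrers N tau,
      [forall i, forall j,
         ((p i).1 == (p j).1) && ((p i).2 < (p j).2)%N ==> (j < i)%N]
    & [forall i, forall j,
         ((p i).2 == (p j).2) && ((p i).1 < (p j).1)%N ==> (j < i)%N]].

Record rsyt (N : nat) (tau : seq nat) := RSYT {
  rsyt_box :> {ffun 'I_N -> 'I_N * 'I_N};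
  _ : is_rsyt tau rsyt_box }.

HB.instance Definition _ N tau := [isSub for @rsyt_box N tau].
HB.instance Definition _ N tau := [Finite of rsyt N tau by <:].

Section Tableaux.
Variables (N : nat) (tau : seq nat).
Implicit Types (S : rsyt N tau) (i : 'I_N).

Definition row S i : nat := (S i).1.
Definition col S i : nat := (S i).2.

Definition content S i : int := (col S i)%:Z - (row S i)%:Z.

(** Exchange of the entries [i] and [i + 1].  The default value [S] is returned
    only if the result is not a reverse standard tableau, which does not happen
    when the contents of [i] and [i + 1] differ by at least 2. *)
Definition rsyt_swap S i : rsyt N tau :=
  insubd S [ffun j => S (tperm i (ordS i) j)].

(** [hat_shape S i] removes from the shape the box of the entry [i]; a last row
    emptied in this way is kept as a part 0. *)
Definition hat_shape S i : seq nat :=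
  [seq (nth 0 tau r - (r == row S i))%N | r <- iota 0 (size tau)].

Definition hat_contents S i : seq int :=
  let th := hat_shape S i in
  [seq (nth 0%N th s)%:Z - s%:Z
     | s <- iota 0 (size tau)
     & (s == 0%N) || (nth 0 th s < nth 0 th s.-1)%N]
  ++ (if (0 < last 0 th)%N then [:: - (size tau)%:Z] else [::]).

End Tableaux.

Section Compositions.
Variable N : nat.
Implicit Types (a b : 'X_{1..N}) (i : 'I_N).

Definition mnm_swap a i : 'X_{1..N} := [multinom a (tperm i (ordS i) j) | j < N].

Definition mnm_plus a : 'X_{1..N} := [multinom nth 0%N (sort geq a) j | j < N].

(** [dominates a b] is [a \succ b] and [triangle a b] is [a \vartriangleright b]. *)
Definition dominates a b : bool :=
  (a != b) &&
  [forall j : 'I_N,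
     (\sum_(i < N | (i <= j)%N) b i <= \sum_(i < N | (i <= j)%N) a i)%N].

Definition triangle a b : bool :=
  (mdeg a == mdeg b) &&
  (dominates (mnm_plus a) (mnm_plus b)
   || (mnm_plus a == mnm_plus b) && dominates a b).

Definition rank a i : nat :=
  (#|[set j : 'I_N | (j <= i)%N && (a i <= a j)%N]|
   + #|[set j : 'I_N | (i < j)%N && (a i < a j)%N]|)%N.

Lemma rank_subproof a i : ((rank a i).-1 < N)%N.
Proof.
have N0 : (0 < N)%N := leq_ltn_trans (leq0n i) (ltn_ord i).
suff : (rank a i <= N)%N by case: (rank a i) => // r; rewrite leq_eqVlt; case: N N0.
rewrite /rank -cardsUI.
have -> : [set j : 'I_N | (j <= i)%N && (a i <= a j)%N]
    :&: [set j : 'I_N | (i < j)%N && (a i < a j)%N] = finset.set0.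
  apply/setP => j; rewrite !inE; case: leqP => //= _; exact: andbF.
by rewrite cards0 addn0 -[X in (_ <= X)%N]card_ord max_card.
Qed.

Definition rank_ord a i : 'I_N := Ordinal (rank_subproof a i).

Definition is_word (w : seq 'I_N) : bool := all (fun i => i.+1 < N)%N w.

Definition sorts a (w : seq 'I_N) : bool :=
  is_word w && (foldl mnm_swap a w == mnm_plus a).

Definition reduced_sorting_word a (w : seq 'I_N) : Prop :=
  sorts a w /\ forall w', sorts a w' -> (size w <= size w')%N.

End Compositions.

(** The preimage of [y] under [f], i.e. the value at [y] of the inverse operator
    when [f] is bijective. *)
Definition op_inv (V : nmodType) (f : V -> V) (y : V) : V :=
  xget 0 [set x | f x = y]%classic.

(** Exact quotient of [p] by [d]; used only where [d] divides [p]. *)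
Definition mquot (K : fieldType) (N : nat) (p d : {mpoly K[N]}) : {mpoly K[N]} :=
  xget 0 [set r | r * d = p]%classic.

(** [V_tau], with basis the reverse standard tableaux, and
    [P_tau] = polynomials (x) [V_tau], as the free module over the polynomials
    on the same basis. *)
Notation tabspace K N tau := {ffun rsyt N tau -> K^o}.
Notation polytab K N tau := {ffun rsyt N tau -> {mpoly K[N]}}.

Section Operators.
Variables (K : fieldType) (N : nat) (tau : seq nat) (q t : K).
Local Notation V := (tabspace K N tau).
Local Notation P := (polytab K N tau).
Implicit Types (i : 'I_N) (S : rsyt N tau) (v : V) (p : {mpoly K[N]}) (F : P).

Definition tab S : V := [ffun S' => (S' == S)%:R].

Definition tens p v : P := [ffun S => v S *: p].

Definition tauT_tab i S : V :=
  let b : int := content S i - content S (ordS i) in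
  if b == 1 then t *: tab S
  else if b == -1 then - tab S
  else if 0 < b then
    tab (rsyt_swap S i) + ((t - 1) / (1 - t ^ (- b))) *: tab S
  else
    (t * (t ^ (b + 1) - 1) * (t ^ (b - 1) - 1) / (t ^ b - 1) ^+ 2)
      *: tab (rsyt_swap S i)
    + (t ^ b * (t - 1) / (t ^ b - 1)) *: tab S.

Definition tauT v i : V := \sum_S v S *: tauT_tab i S.

Definition tau_word (w : seq 'I_N) v : V := foldl tauT v w.

Definition psubst_s i p : {mpoly K[N]} := msym (tperm i (ordS i)) p.

(** [p(q x_N, x_1, ..., x_{N-1})]; [ord_pred] of the first index is the last. *)
Definition psubst_w p : {mpoly K[N]} :=
  p \mPo [tuple if j == 0%N :> nat then q *: 'X_(ord_pred j) else 'X_(ord_pred j)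
         | j < N].

Definition heckeT F i : P :=
  \sum_S
    (tens ((1 - t) *: ('X_(ordS i) * mquot (F S - psubst_s i (F S))
                                           ('X_i - 'X_(ordS i)))) (tab S)
     + tens (psubst_s i (F S)) (tauT (tab S) i)).

Definition heckeTinv F i : P := op_inv (heckeT^~ i) F.

Definition heckeW F : P :=
  \sum_S tens (psubst_w (F S))
              (tau_word [seq j : 'I_N <- enum 'I_N | (j.+1 < N)%N] (tab S)).

(** In one-based notation the exponent of [t] is [i - N]. *)
Definition cherednik i F : P :=
  t ^ (i.+1%:Z - N%:Z) *:
    foldl heckeT
      (heckeW (foldl heckeTinv F (rev [seq j : 'I_N <- enum 'I_N | (j < i)%N])))
      (rev [seq j : 'I_N <- enum 'I_N | (i <= j)%N && (j.+1 < N)%N]).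

Definition dunkl_last i F : P :=
  [ffun S => mquot ((F - cherednik i F) S) 'X_i].

(** Descending recursion from the last index: [k] is the distance to it. *)
Fixpoint dunkl_rec (k : nat) (i : 'I_N) (F : P) : P :=
  if k is k'.+1 then
    t^-1 *: heckeT (dunkl_rec k' (ordS i) (heckeT F i)) i
  else dunkl_last i F.

Definition dunkl i F : P := dunkl_rec (N.-1 - i) i F.

Definition spectral (alpha : 'X_{1..N}) S i : K :=
  q ^+ alpha i * t ^ content S (rank_ord alpha i).

(** [R_alpha] is the inverse of the product along a reduced sorting word.  The
    integers [a] and [b] are left free, so [F] is determined up to a factor
    [q ^ a * t ^ b].  The bound on [beta] only makes the index type finite:
    [triangle alpha beta] already forces equal degrees. *)
Definition is_macdonald (alpha : 'X_{1..N}) S F : Prop :=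
  (exists (a b : int) (w : seq 'I_N) (v : 'X_{1..N} -> V),
     reduced_sorting_word alpha w /\
     F = (q ^ a * t ^ b) *: tens 'X_[alpha] (op_inv (tau_word w) (tab S))
         + \sum_(beta : 'X_{1..N < (mdeg alpha).+1} | triangle alpha beta)
             tens 'X_[beta] (v beta))
  /\ forall i, cherednik i F = spectral alpha S i *: F.

End Operators.

Section Specialization.
Variables (C : fieldType) (q0 t0 : C).
Implicit Types f : {fraction {mpoly C[2]}}.

Definition qvar : {fraction {mpoly C[2]}} := FracField.tofrac 'X_(ord0 : 'I_2).
Definition tvar : {fraction {mpoly C[2]}} := FracField.tofrac 'X_(ord_max : 'I_2).

Definition frac_repr_at f (a b : {mpoly C[2]}) : Prop :=
  b.@[tnth [tuple q0; t0]] != 0 /\ f = FracField.tofrac a / FracField.tofrac b.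

Definition regular_at f : Prop := exists a b, frac_repr_at f a b.

(** Independent of the chosen representation; junk value 0 at a pole. *)
Definition frac_eval f : C :=
  xget 0 [set c | exists a b, frac_repr_at f a b /\
    c = a.@[tnth [tuple q0; t0]] / b.@[tnth [tuple q0; t0]]]%classic.

Variables (N : nat) (tau : seq nat).
Implicit Types (F : polytab {fraction {mpoly C[2]}} N tau).

Definition no_pole_at F : Prop :=
  forall (S : rsyt N tau) (beta : 'X_{1..N}), regular_at (F S)@_beta.

Definition specialize F : polytab C N tau :=
  [ffun S => map_mpoly frac_eval (F S)].

End Specialization.

Arguments qvar {C}.
Arguments tvar {C}.

(** [F] is the Macdonald polynomial for generic parameters: its coefficients lie
    in [C(q, t)]. *)
Definition is_generic_macdonald (C : fieldType) (N : nat) (tau : seq nat)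
    (alpha : 'X_{1..N}) (S : rsyt N tau)
    (F : polytab {fraction {mpoly C[2]}} N tau) : Prop :=
  is_macdonald qvar tvar alpha S F.

Definition is_singular_at (C : fieldType) (N : nat) (tau : seq nat)
    (q0 t0 : C) (F : polytab {fraction {mpoly C[2]}} N tau) : Prop :=
  no_pole_at q0 t0 F /\ forall i, dunkl q0 t0 i (specialize q0 t0 F) = 0.

(** [exp(i theta)] *)
Definition cexpi (R : realType) (theta : R) : R[i] :=
  Complex (cos theta) (sin theta).

(* Main.v *)
Require Import Defs.
From HB Require Import structures.
From mathcomp Require Import all_boot all_order all_algebra.
From mathcomp Require Import perm fraction ssrcomplements mpoly.
From mathcomp Require Import boolp classical_sets reals trigo.
From mathcomp Require Import complex.
From mathcomp Require Import ring lra zify.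

(** Let [Phi F = x_N (F w)].  Up to a unit, the Macdonald polynomial [M_m] of
    [(m, 0, ..., 0)] and [S] is obtained from [1 (x) S] by repeating [m] times:
    apply [Phi], which creates the entry in the last place, then move it to the
    first place by the intertwiners [T_i + b_i] of the Cherednik operators.
    Joint eigenvectors are determined by their spectral vectors, and this forces
    [M_m D_i = 0] for [i > 1], while [M_m D_1] is, up to a unit, the multiple of
    [M_(m-1)] by
      [(1 - X) \prod_(k > 1) (t X - t^c_k) (X - t^(c_k + 1)) / (X - t^c_k)^2],
    where [X = q^m t^c(1,S)] and [c_k = c(k,S)].  At the special point [X = t^z].
    Since [z] is the content of an addable box of the diagram without the box
    of 1, the zeros of this product outnumber its poles by exactly one.

    The intertwiners do have poles at the special point when some [c_k = z].
    However [M_m] is also the image of [Phi M_(m-1) T_(N-1) ... T_1] under a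
    projector polynomial in [xi_1], with denominators [X - t^e] only for the
    contents [e = c(2,S')] of tableaux [S'] such that [c(1,S') = c(1,S)]; such an
    [e] is the content of a removable box of the diagram without the box of 1,
    hence is not [z]. *)

(** Since gcd(k,g) = 1, no product q^a t^b with 0 < a < m equals 1 at the special point. The
    intertwiners that build M_1, ..., M_(m-1) thus have no pole there, and only the last of the m
    rounds is delicate.

    The vanishing for i > 1 comes from the entry N, which always sits in the corner box of content
    0: xi_N fixes every joint eigenvector whose nonzero entry is not in the last place, and D_N is 1
    - xi_N followed by division by x_N. For i > 1 the word T_i ... T_(N-1) in D_i never touches the
    first place; for i = 1 a single component ends with its nonzero entry in the last place, and its
    coefficient gives the product.

    The spectral vector fixes M_m only up to a scalar in C(q,t), which could have a zero or a pole
    at the point; so the leading coefficient of the constructed polynomial is computed and found to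
    be a monomial in q and t.

    Evaluation is only partially defined on C(q,t). Operators are therefore shown to preserve a
    relation between vectors over C(q,t) and their values, and identities reach the point because
    values are unique. *)

Set Implicit Arguments.
Unset Strict Implicit.
Unset Printing Implicit Defensive.

Import Order.TTheory GRing.Theory Num.Theory.

Local Open Scope ring_scope.

(* [linearD] and [linearZ] also match the scaling operators themselves. *)
Lemma linD (K : fieldType) (U V : lmodType K) (f : {linear U -> V}) u v :
  f (u + v) = f u + f v.
Proof. exact: linearD. Qed.
Lemma linZ (K : fieldType) (U V : lmodType K) (f : {linear U -> V}) a u :
  f (a *: u) = a *: f u.
Proof. exact: linearZ. Qed.

(** * Hecke words and Cherednik operators *)

Section HeckeWords.
Variables (K : fieldType) (V : lmodType K) (n : nat) (t : K).
Variable T : nat -> {linear V -> V}.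
Implicit Types F : V.

Record hecke_rels : Prop := HeckeRels {
  hecke_quad : forall k F, (k < n)%N -> T k (T k F) = (t - 1) *: T k F + t *: F;
  hecke_braid : forall k F, (k.+1 < n)%N ->
    T k (T k.+1 (T k F)) = T k.+1 (T k (T k.+1 F));
  hecke_comm : forall i j F, (i.+1 < j)%N -> (j < n)%N -> T i (T j F) = T j (T i F)
}.

Definition Tinv k F : V := t^-1 *: (T k F + (1 - t) *: F).

(** With n = N - 1 and composition read as a right action, [Tup d] is the word T_(n-d) ... T_(n-1),
    [Tdn d] is the same word reversed, and [Tidn k] is T_(k-1)^-1 ... T_0^-1. These are the words of
    the Cherednik and Dunkl operators. *)
Fixpoint Tdn d F : V := if d is d'.+1 then T (n - d) (Tdn d' F) else F.
Fixpoint Tup d F : V := if d is d'.+1 then Tup d' (T (n - d) F) else F.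
Fixpoint Tidn k F : V := if k is k'.+1 then Tidn k' (Tinv k' F) else F.

Fact Tinv_linear k : linear (Tinv k).
Proof.
by move=> a x y; rewrite /Tinv linearP !scalerDr !scalerA; rewrite addrACA;
  congr (_ + _ + _); rewrite ?scalerA //; congr (_ *: _); ring.
Qed.
HB.instance Definition _ k :=
  GRing.isLinear.Build K V V *:%R (Tinv k) (Tinv_linear k).

Fact Tdn_linear d : linear (Tdn d).
Proof. by elim: d => //= d IH a x y; rewrite IH linearP. Qed.
HB.instance Definition _ d := GRing.isLinear.Build K V V *:%R (Tdn d) (Tdn_linear d).

Fact Tup_linear d : linear (Tup d).
Proof. by elim: d => //= d IH a x y; rewrite linearP IH. Qed.
HB.instance Definition _ d := GRing.isLinear.Build K V V *:%R (Tup d) (Tup_linear d).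

Fact Tidn_linear d : linear (Tidn d).
Proof. by elim: d => //= d IH a x y; rewrite linearP IH. Qed.
HB.instance Definition _ d :=
  GRing.isLinear.Build K V V *:%R (Tidn d) (Tidn_linear d).

Hypotheses (t0 : t != 0) (TH : hecke_rels).

Lemma TinvK k F : (k < n)%N -> Tinv k (T k F) = F.
Proof.
move=> kn; rewrite /Tinv hecke_quad // addrAC -scalerDl.
by rewrite (_ : t - 1 + (1 - t) = 0) ?scale0r ?add0r ?scalerA ?mulVf ?scale1r //; ring.
Qed.

Lemma TKinv k F : (k < n)%N -> T k (Tinv k F) = F.
Proof. by move=> kn; rewrite -[RHS](TinvK _ kn) /Tinv linearZ linearD linearZ. Qed.

(** Conjugation by the Coxeter element T_0 ... T_(n-1) shifts the generators: T_(k+1) commutes with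
    the letters before T_k, one braid move turns it into a T_k behind T_(k+1), and this T_k commutes
    with the remaining letters. *)
Lemma Tup_braid k F : (k.+1 < n)%N -> Tup n (T k.+1 F) = T k (Tup n F).
Proof.
have far d i G : (i.+1 < n - d)%N -> (d <= n)%N -> Tup d (T i G) = T i (Tup d G).
  elim: d G => //= d IH G dn ilt; rewrite -(hecke_comm TH) ?IH //; lia.
move=> kn.
suff H d : (n - k <= d <= n)%N -> Tup d (T k.+1 F) = T k (Tup d F).
  by apply: H; rewrite leqnn andbT leq_subr.
elim: d F => [|d IH] F; first by lia.
have [->|dk] := eqVneq d.+1 (n - k)%N.
  move=> _.
  have -> : (n - k = (n - k.+2).+2)%N by lia.
  move=> /=.
  have -> : (n - (n - k.+2).+2 = k)%N by lia.
  have -> : (n - (n - k.+2).+1 = k.+1)%N by lia.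
  by rewrite -(hecke_braid TH) // far //; lia.
move=> dn /=; rewrite (hecke_comm TH) ?IH //; lia.
Qed.

(** The same words peeled from the last letter, while [Tup] peels the first; cancelling against
    [Tidn] starts at this end. *)
Let Fixpoint pre s j F : V := if j is j'.+1 then T (s + j') (pre s j' F) else F.

Let Tup_pre d F : (d <= n)%N -> Tup d F = pre (n - d) d F.
Proof.
have preS s j G : pre s j.+1 G = pre s.+1 j (T s G).
  by elim: j => [|j IH] /=; rewrite ?addn0 // -IH addSnnS.
elim: d F => //= d IH F dn; rewrite IH; last by lia.
rewrite -[T _ (pre _ _ _)]/(pre (n - d.+1) d.+1 F) preS.
by congr (pre _ _ _); lia.
Qed.

Lemma TupK F : Tidn n (Tup n F) = F.
Proof.
suff H k : (k <= n)%N -> Tidn k (pre 0 k F) = F by rewrite Tup_pre // subnn H.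
by elim: k => //= k IH kn; rewrite add0n TinvK // IH // ltnW.
Qed.

Lemma TidnK F : Tup n (Tidn n F) = F.
Proof.
suff H k G : (k <= n)%N -> pre 0 k (Tidn k G) = G by rewrite Tup_pre // subnn H.
by elim: k G => //= k IH G kn; rewrite add0n IH ?TKinv // ltnW.
Qed.

(** On [V_tau] the operator w acts by the Coxeter element c = T_0 ... T_(n-1), so this is the
    tableau half of the relation [W_T0]. The shift relation rewrites c T_0 ... T_(n-2) as T_1 ...
    T_(n-1) c, hence c c = T_1 ... T_(n-1) c T_(n-1) as right actions. *)
Lemma Tup_square F : (0 < n)%N -> T n.-1 (Tup n (Tup n F)) = Tup n (Tup n (T 0 F)).
Proof.
move=> n0.
have preE j G : (j < n)%N -> pre 0 j (Tup n G) = Tup n (pre 1 j G).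
  by elim: j => //= j IH jn; rewrite IH; [rewrite add0n add1n Tup_braid | lia].
have sq G : Tup n (Tup n G) = T n.-1 (Tup n (Tup n.-1 G)).
  have -> : Tup n (Tup n G) = pre 0 n.-1.+1 (Tup n G).
    by rewrite prednK // Tup_pre // subnn.
  rewrite /= add0n preE; last by lia.
  rewrite (@Tup_pre n.-1) ?leq_pred //.
  by have -> : (n - n.-1 = 1)%N by lia.
have -> : Tup n F = Tup n.-1 (T 0 F) by rewrite -(subnn n) -[in LHS](prednK n0) /= (prednK n0).
exact: esym (sq _).
Qed.

End HeckeWords.

Section Cherednik.
Variables (K : fieldType) (V : lmodType K) (n : nat) (q t : K).
Variables (T : nat -> {linear V -> V}) (W : {linear V -> V}).
Variable X : nat -> {linear V -> V}.
Implicit Types F : V.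

(** Relations of the double affine Hecke algebra in the generators T_k, the rotation w and the
    multiplications by variables. Places are numbered 0 to n, and maps compose from the inside
    out. *)
Record daha_rels : Prop := DahaRels {
  daha_hecke : hecke_rels n t T;
  W_T : forall k F, (k.+1 < n)%N -> W (T k.+1 F) = T k (W F);
  W_T0 : forall F, T n.-1 (W (W F)) = W (W (T 0 F));
  T_X : forall k F, (k < n)%N ->
    T k (X k.+1 F) + (1 - t) *: X k.+1 F = X k (T k F);
  T_X_far : forall k j F, (k < n)%N -> (j <= n)%N -> j != k -> j != k.+1 ->
    T k (X j F) = X j (T k F);
  W_X : forall k F, (k < n)%N -> W (X k.+1 F) = X k (W F);
  W_X0 : forall F, W (X 0 F) = q *: X n (W F)
}.

Definition xi k F : V :=
  t ^ (k%:Z - n%:Z) *: Tdn n T (n - k) (W (Tidn t T k F)).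

Definition Phi F : V := X n (W F).

Fact xi_linear k : linear (xi k).
Proof.
by move=> a x y; rewrite /xi !linearP.
Qed.
HB.instance Definition _ k := GRing.isLinear.Build K V V *:%R (xi k) (xi_linear k).

Fact Phi_linear : linear Phi.
Proof. by move=> a x y; rewrite /Phi !linearP. Qed.
HB.instance Definition _ := GRing.isLinear.Build K V V *:%R Phi Phi_linear.

Lemma xiD k F G : xi k (F + G) = xi k F + xi k G. Proof. exact: linearD. Qed.
Lemma xiZ k a F : xi k (a *: F) = a *: xi k F. Proof. exact: linearZ. Qed.

Hypotheses (n0 : (0 < n)%N) (t0 : t != 0) (R : daha_rels).
Let TH := daha_hecke R.

Let TdnS k F : (k < n)%N -> Tdn n T (n - k) F = T k (Tdn n T (n - k.+1) F).
Proof.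
move=> kn; have -> : (n - k = (n - k.+1).+1)%N by lia.
by rewrite /=; congr (T _ _); lia.
Qed.

Lemma xi_step k F : (k < n)%N -> T k (xi k.+1 (T k F)) = t *: xi k F.
Proof.
move=> kn; rewrite /xi /= (TinvK t0 TH) // linearZ -TdnS // scalerA; congr (_ *: _).
rewrite (_ : k.+1%:Z - n%:Z = 1 + (k%:Z - n%:Z)); last by lia.
by rewrite (expfzDr 1) // expr1z.
Qed.

Lemma xi_T1 k F : (k < n)%N -> xi k.+1 (T k F) = T k (xi k F) + (1 - t) *: xi k F.
Proof.
move=> kn; rewrite -[LHS](TinvK t0 TH _ kn) xi_step // linearZ /= /Tinv.
by rewrite scalerA mulfV // scale1r.
Qed.

Lemma xi_T0 k F : (k < n)%N -> xi k (T k F) = T k (xi k.+1 F) + (t - 1) *: xi k F.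
Proof.
move=> kn; apply: (scalerI t0); rewrite -xi_step // (hecke_quad TH) //.
rewrite xiD !xiZ (linD (T k)) 2!(linZ (T k)) xi_step // addrC scalerDr !scalerA.
by rewrite [_ * t]mulrC.
Qed.

(** For i > j the letter T_i passes the inverses, w lowers its index and the tail T_(n-1) ... T_j
    raises it again. For i + 1 < j the inverses raise the index, w lowers it and the tail lets it
    pass. *)
Lemma xi_T_far j i F : (j <= n)%N -> (i < n)%N -> j != i -> j != i.+1 ->
  xi j (T i F) = T i (xi j F).
Proof.
have TinvC a b G : (a.+1 < b)%N \/ (b.+1 < a)%N -> (a < n)%N -> (b < n)%N ->
    Tinv t T a (T b G) = T b (Tinv t T a G).
  move=> ab an bn; rewrite /Tinv (linZ (T b)) (linD (T b)) (linZ (T b)).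
  by case: ab => ab; [rewrite (hecke_comm TH) | rewrite -(hecke_comm TH)].
have Tid_lo b G : (j < b)%N -> (b < n)%N -> Tidn t T j (T b G) = T b (Tidn t T j G).
  move=> jb bn; elim: j jb G => //= a IH ab G; rewrite TinvC ?IH //; lia.
have Tdn_lo d b G : (b.+1 < n - d)%N -> (d <= n)%N ->
    Tdn n T d (T b G) = T b (Tdn n T d G).
  elim: d => //= d IH bd dn; rewrite IH; [|lia..].
  by rewrite (hecke_comm TH (i := b)) //; lia.
have Tid_hi b G : (b.+1 < j <= n)%N -> Tidn t T j (T b G) = T b.+1 (Tidn t T j G).
  elim: j G {Tid_lo} => //= a IH G /andP[ab an].
  have [ba|ba] := eqVneq a b.+1; last by rewrite TinvC ?IH //; lia.
  have lo c H : (c <= b)%N -> Tidn t T c (T b.+1 H) = T b.+1 (Tidn t T c H).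
    elim: c H => //= c IHc H cb; rewrite TinvC ?IHc //; lia.
  rewrite ba /= -lo //; congr (Tidn _ _ _ _).
  have bn : (b.+1 < n)%N by rewrite -ba.
  have -> : T b G = T b (T b.+1 (Tinv t T b.+1 G)) by rewrite (TKinv t0 TH).
  have -> : G = T b.+1 (Tinv t T b.+1 G) by rewrite (TKinv t0 TH).
  set H := Tinv t T b.+1 G.
  rewrite !(TinvK t0 TH) //.
  have -> : H = T b (Tinv t T b H) by rewrite (TKinv t0 TH) // ltnW.
  set H' := Tinv t T b H.
  by rewrite (hecke_braid TH) // !(TinvK t0 TH) // ltnW.
have Tdn_hi d b G : (n - d <= b)%N -> (b.+1 < n)%N -> (d <= n)%N ->
    Tdn n T d (T b G) = T b.+1 (Tdn n T d G).
  elim: d => [|d IH] bd bn dn; first by lia.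
  rewrite /=; have [db|db] := eqVneq (n - d.+1)%N b; last first.
    by rewrite IH; [rewrite (hecke_comm TH) //; lia | lia..].
  case: d bd dn db {IH} => [|d] bd dn db; first by lia.
  rewrite /= db (_ : n - d.+1 = b.+1)%N; last by lia.
  rewrite Tdn_lo ?(hecke_braid TH) //; lia.
move=> jn iN ji ji1; rewrite /xi (linZ (T i)); congr (_ *: _).
have [ij|ij] := ltnP j i.
  rewrite Tid_lo //.
  have -> : i = i.-1.+1 by lia.
  rewrite (W_T R); last by lia.
  rewrite Tdn_hi //; lia.
rewrite Tid_hi; last by lia.
rewrite (W_T R) ?Tdn_lo //; lia.
Qed.

(** As maps, T_k^-1 x_(k+1) = t^-1 x_k T_k by [T_X]. Pulling x_n through the n inverses turns them
    into T_(n-1), ..., T_0 and leaves t^-n and x_0; then w turns x_0 into q x_n. *)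
Lemma xi_Phi_last F : xi n (Phi F) = q *: Phi (xi 0 F).
Proof.
have H d G : (d <= n)%N ->
    Tidn t T n (X n G) = t ^- d *: Tidn t T (n - d) (X (n - d) (Tdn n T d G)).
  elim: d => [|d IH] dn; first by rewrite subn0 invr1 scale1r.
  rewrite IH; last exact: ltnW.
  have -> : (n - d = (n - d.+1).+1)%N by lia.
  rewrite /= /Tinv (T_X R); last by lia.
  by rewrite (linZ (Tidn t T _)) scalerA exprS invfM mulrC.
rewrite /xi /Phi subnn subn0 /= (H n) // subnn /= subrr expr0z scale1r.
by rewrite 2!(linZ W) (W_X0 R) (linZ (X n)) sub0r !scalerA mulrC exprnN.
Qed.

Lemma T_X_same k F : (k < n)%N -> T k (X k F) = t *: X k.+1 (Tinv t T k F).
Proof.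
move=> kn; rewrite -{1}(TKinv t0 TH F kn) -(T_X R) // (linD (T k)) (linZ (T k)) (hecke_quad TH) //.
by rewrite addrAC -scalerDl (_ : t - 1 + (1 - t) = 0) ?scale0r ?add0r //; ring.
Qed.

Lemma xi_Phi k F : (k < n)%N -> xi k (Phi F) = Phi (xi k.+1 F).
Proof.
move=> kn.
(* G is F T_k^-1 ... T_1^-1, that is [Tidn k.+1 F] without its last letter; w lowers every index by
   one and turns this word into that of [Tidn k]. *)
have [G GW G0] : exists2 G, Tidn t T k (W F) = W G & Tidn t T k.+1 F = Tinv t T 0 G.
  elim: k F kn => [|k IH] F kn; first by exists F.
  have [G GW G0] := IH (Tinv t T k.+1 F) (ltnW kn).
  exists G => //=; rewrite -GW; congr Tidn.
  by rewrite /Tinv (linZ W) (linD W) (linZ W) (W_T R).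
have TX j H : (j <= k)%N -> Tidn t T j (X n H) = X n (Tidn t T j H).
  elim: j H => //= j IH H jk.
  rewrite -IH ?(ltnW jk) // /Tinv; congr Tidn; rewrite (linZ (X n)) (linD (X n)) (linZ (X n)).
  congr (_ *: (_ + _)); rewrite (T_X_far R) //; lia.
have key d Y H : T n.-1 Y = t *: X n (W H) -> (d < n)%N ->
    Tdn n T d.+1 Y = t *: X n (W (Tdn n T d H)).
  move=> YH; elim: d => [|d IH] dn; first by rewrite /= subn1.
  rewrite -[LHS]/(T (n - d.+2) (Tdn n T d.+1 Y)) IH; last exact: ltnW.
  rewrite (linZ (T _)) (T_X_far R); try lia.
  rewrite -(W_T R); last by lia.
  by rewrite /= (_ : (n - d.+2).+1 = n - d.+1)%N; last by lia.
rewrite /xi /Phi TX // GW -{4}(prednK n0) (W_X R); last by lia.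
have -> : (n - k = (n - k.+1).+1)%N by lia.
rewrite (@key _ _ (W (Tinv t T 0 G))); last by lia.
  rewrite -G0 (linZ W) (linZ (X n)) scalerA; congr (_ *: _).
  rewrite (_ : k.+1%:Z - n%:Z = (k%:Z - n%:Z) + 1); last by lia.
  by rewrite (expfzDr _ 1) // expr1z.
(* Passing T_(n-1) through x_(n-1) leaves the inverse T_(n-1)^-1, which [W_T0] carries through w w
   to the missing T_0^-1. *)
rewrite T_X_same ?prednK //.
by rewrite /Tinv !((linZ W), (linD W)) (W_T0 R).
Qed.

End Cherednik.

(** * Intertwiners and eigenvectors *)

Section Eigenvectors.
Variables (K : fieldType) (V : lmodType K) (n : nat) (q t : K).
Variables (T : nat -> {linear V -> V}) (W : {linear V -> V}).
Variable X : nat -> {linear V -> V}.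
Variables (I : Type) (ct : I -> nat -> int) (vac : I -> V) (deg : nat -> V -> Prop).
Implicit Types (F : V) (c : nat -> int).

Local Notation xi := (xi n t T W).
Local Notation Phi := (Phi n W X).

Definition eig (z : nat -> K) F := forall k, (k <= n)%N -> xi k F = z k *: F.

(* The spectral vector of the composition with a single nonzero entry [m] at
   position [j] and the labels' contents [c]: the label 0 goes with position [j]
   and the other labels keep their order. *)
Definition spv m j c : nat -> K := fun i =>
  if (i < j)%N then t ^ c i.+1 else if i == j then q ^+ m * t ^ c 0 else t ^ c i.

Definition swz (A : Type) k (z : nat -> A) : nat -> A := fun i =>
  if i == k then z k.+1 else if i == k.+1 then z k else z i.

(* What is used of the polynomial module; [vac S] stands for [1 (x) S]. *)
Record macdonald_model : Prop := MacdonaldModel {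
  mm_n0 : (0 < n)%N;
  mm_t0 : t != 0;
  mm_q0 : q != 0;
  mm_generic : forall (a : nat) (b : int), q ^+ a * t ^ b = 1 -> a = 0%N /\ b = 0;
  mm_daha : daha_rels n q t T W X;
  mm_Winj : forall F, W F = 0 -> F = 0;
  mm_Wsurj : forall m F, deg m F -> exists2 G, deg m G & W G = F;
  mm_Xinj : forall F, X n F = 0 -> F = 0;
  mm_div : forall F, exists G, F - xi n F = X n G;
  mm_deg_lin : forall m a F G, deg m F -> deg m G -> deg m (a *: F + G);
  mm_deg0 : forall m, deg m 0;
  mm_degT : forall m k F, (k < n)%N -> deg m F -> deg m (T k F);
  mm_degW : forall m F, deg m F -> deg m (W F);
  mm_degX : forall m F, deg m.+1 (X n F) <-> deg m F;
  mm_ctlast : forall S, ct S n = 0;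
  mm_ctneq : forall S k, (k < n)%N -> ct S k != ct S k.+1;
  mm_vac : forall S k, (k <= n)%N -> xi k (vac S) = t ^ ct S k *: vac S;
  mm_degvac : forall S, deg 0 (vac S);
  mm_deg0_eig : forall c F, deg 0 F -> eig (fun k => t ^ c k) F -> F != 0 ->
    exists S, (forall k, (k <= n)%N -> c k = ct S k) /\ exists a, F = a *: vac S
}.

Hypothesis MM : macdonald_model.
Let n0 := mm_n0 MM.
Let t0 := mm_t0 MM.
Let q0 := mm_q0 MM.
Let R := mm_daha MM.
Let TH := daha_hecke R.

(** [ac a b] is the constant that makes T_k + [ac a b] exchange the eigenvalues a of xi_k and b of
    xi_(k+1). [kap a b] is the scalar by which two opposite exchanges compose; its zeros and poles
    are those of the final product. *)
Definition ac (a b : K) := (1 - t) * a / (a - b).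
Definition kap (a b : K) := (t * a - b) * (a - t * b) / (a - b) ^+ 2.
Definition inter (a b : K) k F := T k F + ac a b *: F.

Fact inter_linear a b k : linear (inter a b k).
Proof.
move=> x u v; rewrite /inter (linD (T k)) (linZ (T k)) !scalerDr addrACA.
by rewrite !scalerA [ac _ _ * x]mulrC.
Qed.
HB.instance Definition _ a b k :=
  GRing.isLinear.Build K V V *:%R (inter a b k) (inter_linear a b k).

Lemma PhiZ a F : Phi (a *: F) = a *: Phi F.
Proof. by rewrite /Phi (linZ W) (linZ (X n)). Qed.

Lemma PhiB F G : Phi (F - G) = Phi F - Phi G.
Proof. exact: linearB. Qed.

Lemma inter_eig k z F : (k < n)%N -> z k != z k.+1 -> eig z F ->
  eig (swz k z) (inter (z k) (z k.+1) k F).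
Proof.
move=> kn zz zF j jn; rewrite /swz /inter xiD xiZ.
have zz0 : z k - z k.+1 != 0 by rewrite subr_eq0.
have zk := zF _ (ltnW kn); have zk1 := zF _ kn.
case: eqVneq => [->|jk]; [|case: eqVneq => [->|jk1]].
- rewrite (xi_T0 n0 t0 R) // zk zk1 (linZ (T k)) -addrA !scalerA -scalerDl scalerDr.
  rewrite scalerA; congr (_ + _ *: _); rewrite /ac; field.
  exact: zz0.
- rewrite (xi_T1 n0 t0 R) // zk zk1 (linZ (T k)) -addrA !scalerA -scalerDl scalerDr.
  rewrite scalerA; congr (_ + _ *: _); rewrite /ac; field.
  exact: zz0.
by rewrite (xi_T_far n0 t0 R) // zF // (linZ (T k)) scalerDr !scalerA [ac _ _ * _]mulrC.
Qed.

Lemma interK a b k F : a != b -> (k < n)%N ->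
  inter b a k (inter a b k F) = kap a b *: F.
Proof.
move=> ab kn; rewrite /inter (linD (T k)) (linZ (T k)) (hecke_quad TH) //.
have ab0 : a - b != 0 by rewrite subr_eq0.
have ba0 : b - a != 0 by rewrite subr_eq0 eq_sym.
transitivity ((t - 1 + ac a b + ac b a) *: T k F + (t + ac b a * ac a b) *: F).
  rewrite !scalerDl scalerDr !scalerA -!addrA; do 2 congr (_ + _).
  by rewrite addrCA; congr (_ + _); rewrite addrCA.
rewrite (_ : t - 1 + ac a b + ac b a = 0); last by rewrite /ac; field; apply/andP.
rewrite scale0r add0r; congr (_ *: _); rewrite /ac /kap; field; exact/andP.
Qed.

Lemma kapC a b : kap a b = kap b a.
Proof. by rewrite /kap -[b - a]opprB sqrrN; congr (_ / _); ring. Qed.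

Lemma eig_ext z z' F : (forall i, (i <= n)%N -> z i = z' i) -> eig z F -> eig z' F.
Proof. by move=> zz zF k kn; rewrite zF ?zz. Qed.

Lemma deg_scale m a F : deg m F -> deg m (a *: F).
Proof. by move=> dF; rewrite -[_ *: _]addr0; apply: (mm_deg_lin MM) => //; exact: mm_deg0. Qed.

Lemma deg_add m F G : deg m F -> deg m G -> deg m (F + G).
Proof. by move=> dF dG; rewrite -[F]scale1r; apply: (mm_deg_lin MM). Qed.

Lemma deg_inter m a b k F : (k < n)%N -> deg m F -> deg m (inter a b k F).
Proof.
by move=> kn dF; apply: deg_add; [exact: (mm_degT MM) | exact: deg_scale].
Qed.

Lemma texp_inj : injective (fun b : int => t ^ b).
Proof.
move=> a b /= ab; have [] := mm_generic MM (a := 0) (b := a - b).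
  by rewrite expr0 mul1r expfzDr // ab -invr_expz mulfV ?expfz_neq0.
by move=> _ /eqP; rewrite subr_eq0 => /eqP.
Qed.

Lemma qtexp_neq m a b : q ^+ m.+1 * t ^ a != t ^ b.
Proof.
apply/eqP => E; have [] // := mm_generic MM (a := m.+1) (b := a - b).
by rewrite expfzDr // mulrA E -invr_expz mulfV ?expfz_neq0.
Qed.

Lemma kap_neq0 m a b : kap (q ^+ m.+1 * t ^ a) (t ^ b) != 0.
Proof.
have tS e : t * t ^ e = t ^ (1 + e) by rewrite (expfzDr 1) // expr1z.
rewrite /kap !mulf_neq0 ?invr_neq0 ?expf_neq0 ?subr_eq0 ?qtexp_neq //.
  by rewrite mulrCA tS qtexp_neq.
by rewrite tS qtexp_neq.
Qed.

(** [dn] carries the nonzero entry from place k + 1 to place k and [up] carries it back; [kapc] is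
    the scalar of the round trip. *)
Definition dn m c k := inter (t ^ c k.+1) (q ^+ m * t ^ c 0) k.
Definition up m c k := inter (q ^+ m * t ^ c 0) (t ^ c k.+1) k.
Definition kapc m c k := kap (q ^+ m * t ^ c 0) (t ^ c k.+1).

Fixpoint dns m c d F : V := if d is d'.+1 then dn m c (n - d) (dns m c d' F) else F.
Fixpoint ups m c d F : V := if d is d'.+1 then ups m c d' (up m c (n - d) F) else F.
Fixpoint macd m S : V :=
  if m is m'.+1 then dns m (ct S) n (Phi (macd m' S)) else vac S.

Lemma dnZ m c k a F : dn m c k (a *: F) = a *: dn m c k F.
Proof. exact: (linZ (inter _ _ k)). Qed.

Fact dns_linear m c d : linear (dns m c d).
Proof. by elim: d => //= d IH a x y; rewrite IH /dn linearP. Qed.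
HB.instance Definition _ m c d :=
  GRing.isLinear.Build K V V *:%R (dns m c d) (dns_linear m c d).

Fact ups_linear m c d : linear (ups m c d).
Proof. by elim: d => //= d IH a x y; rewrite /up linearP IH. Qed.
HB.instance Definition _ m c d :=
  GRing.isLinear.Build K V V *:%R (ups m c d) (ups_linear m c d).

Lemma dnsZ m c d a F : dns m c d (a *: F) = a *: dns m c d F.
Proof. exact: linZ. Qed.

Lemma upsZ m c d a F : ups m c d (a *: F) = a *: ups m c d F.
Proof. exact: linZ. Qed.

Lemma dns0 m c d : dns m c d 0 = 0. Proof. exact: linear0. Qed.
Lemma ups0 m c d : ups m c d 0 = 0. Proof. exact: linear0. Qed.
Lemma Phi0 : Phi 0 = 0. Proof. exact: linear0. Qed.

Lemma spv_at m j c : spv m j c j = q ^+ m * t ^ c 0.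
Proof. by rewrite /spv ltnn eqxx. Qed.

Lemma spv_lt m j c i : (i < j)%N -> spv m j c i = t ^ c i.+1.
Proof. by rewrite /spv => ->. Qed.

Lemma spv_gt m j c i : (j < i)%N -> spv m j c i = t ^ c i.
Proof. by rewrite /spv => ji; rewrite ltnNge ltnW //= gtn_eqF. Qed.

Lemma swz_spv m c k : swz k (spv m k c) =1 spv m k.+1 c.
Proof.
move=> i; rewrite /swz; case: eqVneq => [->|ik].
  by rewrite spv_gt // spv_lt.
case: eqVneq => [->|ik1]; first by rewrite !spv_at.
have [ik'|ik'] := ltnP i k; first by rewrite !spv_lt //; lia.
rewrite !spv_gt //; lia.
Qed.

Lemma swz_spvS m c k : swz k (spv m k.+1 c) =1 spv m k c.
Proof.
move=> i; rewrite -[RHS]/((fun z => z i) _); rewrite /swz; case: eqVneq => [->|ik].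
  by rewrite !spv_at.
case: eqVneq => [->|ik1]; first by rewrite spv_lt // spv_gt.
have [ik'|ik'] := ltnP i k; first by rewrite !spv_lt //; lia.
rewrite !spv_gt //; lia.
Qed.

Lemma up_eig m c k F : (k < n)%N -> eig (spv m.+1 k c) F ->
  eig (spv m.+1 k.+1 c) (up m.+1 c k F).
Proof.
move=> kn eF; apply: eig_ext (fun i _ => swz_spv _ _ _ i) _.
have := inter_eig kn _ eF; rewrite spv_at spv_gt //; apply.
exact: qtexp_neq.
Qed.

Lemma dn_eig m c k F : (k < n)%N -> eig (spv m.+1 k.+1 c) F ->
  eig (spv m.+1 k c) (dn m.+1 c k F).
Proof.
move=> kn eF; apply: eig_ext (fun i _ => swz_spvS _ _ _ i) _.
have := inter_eig kn _ eF; rewrite spv_at spv_lt //; apply.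
by rewrite eq_sym qtexp_neq.
Qed.

Lemma dns_eig m c d F : (d <= n)%N -> eig (spv m.+1 n c) F ->
  eig (spv m.+1 (n - d) c) (dns m.+1 c d F).
Proof.
elim: d => [|d IH] dn eF; first by rewrite subn0.
apply: dn_eig; first lia.
have -> : ((n - d.+1).+1 = n - d)%N by lia.
exact: IH (ltnW dn) eF.
Qed.

Lemma ups_eig m c d F : (d <= n)%N -> eig (spv m.+1 (n - d) c) F ->
  eig (spv m.+1 n c) (ups m.+1 c d F).
Proof.
elim: d F => [|d IH] F dn eF; first by rewrite subn0 in eF.
apply: IH (ltnW dn) _.
have -> : (n - d = (n - d.+1).+1)%N by lia.
apply: up_eig eF; lia.
Qed.

Lemma dns_deg m c d e F : (d <= n)%N -> deg e F -> deg e (dns m c d F).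
Proof.
elim: d => //= d IH dn eF; apply: deg_inter; first lia.
exact: IH (ltnW dn) eF.
Qed.

Lemma ups_deg m c d e F : (d <= n)%N -> deg e F -> deg e (ups m c d F).
Proof.
elim: d F => //= d IH F dn eF; apply: IH (ltnW dn) _; apply: deg_inter eF; lia.
Qed.

Lemma up_dn m c k F : (k < n)%N -> up m.+1 c k (dn m.+1 c k F) = kapc m.+1 c k *: F.
Proof. by move=> kn; rewrite /up /dn interK // 1?kapC // eq_sym qtexp_neq. Qed.

Lemma dn_up m c k F : (k < n)%N -> dn m.+1 c k (up m.+1 c k F) = kapc m.+1 c k *: F.
Proof. by move=> kn; rewrite /up /dn interK // qtexp_neq. Qed.

Lemma ups_dns m c d F : (d <= n)%N ->
  exists2 a : K, a != 0 & ups m.+1 c d (dns m.+1 c d F) = a *: F.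
Proof.
elim: d => [|d IH] dn; first by exists 1; rewrite ?oner_eq0 ?scale1r.
have [a a0 E] := IH (ltnW dn).
exists (kapc m.+1 c (n - d.+1) * a); first by rewrite mulf_neq0 // kap_neq0.
rewrite /= up_dn; last by lia.
by rewrite upsZ E scalerA.
Qed.

Lemma dns_ups m c d F : (d <= n)%N ->
  exists2 a : K, a != 0 & dns m.+1 c d (ups m.+1 c d F) = a *: F.
Proof.
elim: d F => [|d IH] F dn; first by exists 1; rewrite ?oner_eq0 ?scale1r.
have [a a0 E] := IH (up m.+1 c (n - d.+1) F) (ltnW dn).
exists (a * kapc m.+1 c (n - d.+1)); first by rewrite mulf_neq0 // kap_neq0.
rewrite /= E dnZ.
by rewrite dn_up ?scalerA //; lia.
Qed.

Lemma Phi_eig m c F : eig (spv m 0 c) F -> eig (spv m.+1 n c) (Phi F).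
Proof.
move=> eF k; rewrite leq_eqVlt => /orP[/eqP->|kn].
  rewrite (xi_Phi_last n0 t0 R) // eF // PhiZ scalerA spv_at spv_at exprS.
  by rewrite mulrA.
by rewrite (xi_Phi n0 t0 R) // eF // PhiZ spv_gt // spv_lt.
Qed.

Lemma Phi_inj F G : Phi F = Phi G -> F = G.
Proof.
move/eqP; rewrite -subr_eq0 -PhiB => /eqP /(mm_Xinj MM)/(mm_Winj MM)/eqP.
by rewrite subr_eq0 => /eqP.
Qed.

(** Phi can be undone on eigenvectors: the eigenvalue of xi_n on F is not 1, so F is a multiple of F
    - [xi n F] and hence divisible by x_n, and w is onto in each degree. *)
Lemma eig_Phi m c F : deg m.+1 F -> eig (spv m.+1 n c) F ->
  exists G, [/\ F = Phi G, deg m G & eig (spv m 0 c) G].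
Proof.
move=> dF eF; have [H] := mm_div MM F.
rewrite eF // spv_at -{1}[F]scale1r -scalerBl => FH.
have x1 : 1 - q ^+ m.+1 * t ^ c 0 != 0.
  by rewrite subr_eq0 eq_sym -(expr0z t) qtexp_neq.
have FX : F = X n ((1 - q ^+ m.+1 * t ^ c 0)^-1 *: H).
  by rewrite (linZ (X n)) -FH scalerA mulVf // scale1r.
have [G dG GW] : exists2 G, deg m G & W G = (1 - q ^+ m.+1 * t ^ c 0)^-1 *: H.
  by apply: (mm_Wsurj MM); apply/(mm_degX MM); rewrite -FX.
have FG : F = Phi G by rewrite /Phi GW.
exists G; split => // -[|k] kn; apply: Phi_inj; rewrite [RHS]PhiZ.
  apply: (scalerI q0); rewrite -(xi_Phi_last n0 t0 R) // -FG eF // !spv_at.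
  by rewrite scalerA exprS mulrA.
by rewrite -(xi_Phi n0 t0 R) // -FG eF ?(ltnW kn) // spv_lt // spv_gt.
Qed.

Lemma macd_deg m S : deg m (macd m S).
Proof.
elim: m => [|m IH]; first exact: (mm_degvac MM).
apply: dns_deg => //; apply/(mm_degX MM); exact: (mm_degW MM).
Qed.

Lemma macd_eig m S : eig (spv m 0 (ct S)) (macd m S).
Proof.
elim: m => [|m IH] /=.
  2: by rewrite -{1}(subnn n); apply: dns_eig (leqnn n) (Phi_eig IH).
apply: eig_ext (mm_vac MM S) => -[|i] _; rewrite ?spv_at ?expr0 ?mul1r //.
Qed.

Lemma dns_ext m c c' d F : (d <= n)%N -> (forall k, (k <= n)%N -> c k = c' k) ->
  dns m c d F = dns m c' d F.
Proof.
elim: d => //= d IH dn cc; rewrite IH ?(ltnW dn) //; congr inter; rewrite cc //; lia.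
Qed.

(** Undoing the intertwiners and Phi lowers m until degree 0, where the spectral vectors are the
    content vectors of tableaux. All scalars met on the way are nonzero for generic q and t, so this
    gives both the possible spectral vectors and the simplicity of the spectrum. *)
Lemma eig_macd m c F : deg m F -> eig (spv m 0 c) F -> F != 0 ->
  exists S, (forall k, (k <= n)%N -> c k = ct S k) /\ exists a, F = a *: macd m S.
Proof.
elim: m c F => [|m IH] c F dF eF F0.
  apply: (mm_deg0_eig MM) => //; apply: eig_ext eF => -[|i] _.
    by rewrite spv_at expr0 mul1r.
  by rewrite spv_gt.
have eU : eig (spv m.+1 n c) (ups m.+1 c n F) by apply: ups_eig; rewrite ?subnn.
have [G [UG dG eG]] := eig_Phi (ups_deg m.+1 c (leqnn n) dF) eU.
have [a a0 E] := dns_ups m c F (leqnn n).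
have G0 : G != 0.
  apply: contraNneq F0 => G0; move: E; rewrite UG G0 Phi0 dns0 => /esym/eqP.
  by rewrite scaler_eq0 (negPf a0).
have [S [cS [b Gb]]] := IH c G dG eG G0.
exists S; split => //; exists (a^-1 * b).
apply: (scalerI a0); rewrite -E UG Gb PhiZ dnsZ !scalerA mulrA mulfV // mul1r.
by rewrite (dns_ext _ _ _ cS).
Qed.

(** Moving the nonzero entry to place 0 reduces this to [eig_macd]. The gain is that the exponents
    of any eigenvector are contents of a tableau, so that neighbouring ones differ and the last one
    is 0. *)
Lemma eig_content m j c F : (j <= n)%N -> deg m.+1 F -> eig (spv m.+1 j c) F ->
  F != 0 -> exists S, forall k, (k <= n)%N -> c k = ct S k.
Proof.
move=> jn dF eF F0.
have eD : eig (spv m.+1 0 c) (dns m.+1 c n (ups m.+1 c (n - j) F)).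
  rewrite -{1}(subnn n); apply: dns_eig => //; apply: ups_eig; rewrite ?leq_subr //.
  by rewrite subKn.
have [a a0 E] := ups_dns m c (ups m.+1 c (n - j) F) (leqnn n).
have [b b0 E'] := dns_ups m c F (leq_subr j n).
have dD : deg m.+1 (dns m.+1 c n (ups m.+1 c (n - j) F)).
  by apply: dns_deg => //; apply: ups_deg; rewrite ?leq_subr.
have [|S [cS _]] := eig_macd dD eD; last by exists S.
apply/eqP => D0; move: E; rewrite D0 ups0 => /esym/eqP.
rewrite scaler_eq0 (negPf a0) /= => /eqP U0; move: E'.
rewrite U0 dns0 => /esym/eqP.
by rewrite scaler_eq0 (negPf b0) (negPf F0).
Qed.

(** The summands may have different content vectors, since T_k acting away from the nonzero entry
    permutes contents. What is kept track of is the place of that entry, through [J], and the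
    content [e0] attached to it. *)
Inductive atoms m (e0 : int) (J : pred nat) : V -> Prop :=
| atoms0 : atoms m e0 J 0
| atomsS j c F G : J j -> (j <= n)%N -> c 0 = e0 -> deg m F -> eig (spv m j c) F ->
    atoms m e0 J G -> atoms m e0 J (F + G).

Lemma atoms1 m e0 (J : pred nat) j c F : J j -> (j <= n)%N -> c 0 = e0 -> deg m F ->
  eig (spv m j c) F -> atoms m e0 J F.
Proof.
by move=> Jj jn cc dF eF; rewrite -[F]addr0; apply: atomsS eF _ => //; exact: atoms0.
Qed.

Lemma eigZ z a F : eig z F -> eig z (a *: F).
Proof. by move=> eF k kn; rewrite xiZ eF // !scalerA mulrC. Qed.

Lemma atomsD m e0 J F G : atoms m e0 J F -> atoms m e0 J G -> atoms m e0 J (F + G).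
Proof.
move=> aF aG; elim: aF => [|j c F1 F2 *]; rewrite ?add0r // -addrA.
exact: (@atomsS _ _ _ j c).
Qed.

Lemma atomsZ m e0 J a F : atoms m e0 J F -> atoms m e0 J (a *: F).
Proof.
elim=> [|j c F1 F2 *]; first by rewrite scaler0; exact: atoms0.
rewrite scalerDr; apply: (@atomsS _ _ _ j c) => //; first exact: deg_scale.
exact: eigZ.
Qed.

Lemma atoms_sub m e0 (J J' : pred nat) F : (forall j, J j -> J' j) ->
  atoms m e0 J F -> atoms m e0 J' F.
Proof.
by move=> JJ; elim=> [|j c F1 F2 Jj *]; [exact: atoms0 | apply: (@atomsS _ _ _ j c); auto].
Qed.

(** Places before the nonzero entry carry the label of the next index, hence [k.+1] when k < j. *)
Let swz_spv_far m j c k i : k != j -> k.+1 != j ->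
  swz k (spv m j c) i = spv m j (swz (if (k < j)%N then k.+1 else k) c) i.
Proof.
move=> kj k1j.
have swl A a (f : nat -> A) : swz a f a = f a.+1 by rewrite /swz eqxx.
have swr A a (f : nat -> A) : swz a f a.+1 = f a by rewrite /swz eqxx; case: eqVneq => // ->.
have swf A a (f : nat -> A) b : b != a -> b != a.+1 -> swz a f b = f b.
  by rewrite /swz => /negPf-> /negPf->.
have [kj'|kj'] := ltnP k j.
  have [->|ik] := eqVneq i k; first by rewrite swl !spv_lt ?swl //; lia.
  have [->|ik1] := eqVneq i k.+1; first by rewrite swr !spv_lt ?swr //; lia.
  rewrite swf //; have [ij|ij|->] := ltngtP i j.
  - by rewrite !spv_lt // swf //; lia.
  - by rewrite !spv_gt // swf //; lia.
  by rewrite !spv_at swf.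
have [->|ik] := eqVneq i k; first by rewrite swl !spv_gt ?swl //; lia.
have [->|ik1] := eqVneq i k.+1; first by rewrite swr !spv_gt ?swr //; lia.
rewrite swf //; have [ij|ij|->] := ltngtP i j.
- by rewrite !spv_lt // swf //; lia.
- by rewrite !spv_gt // swf.
by rewrite !spv_at swf //; lia.
Qed.

(** T_k differs by a scalar from an intertwiner, which exists because neighbouring contents are
    distinct; this intertwiner affects neither the nonzero entry nor label 0. *)
Lemma atoms_T m e0 (J : pred nat) k F : (k < n)%N -> (forall j, J j -> k != j /\ k.+1 != j) ->
  atoms m.+1 e0 J F -> atoms m.+1 e0 J (T k F).
Proof.
move=> kn Jk; elim=> [|j c F1 F2 Jj jn cc dF eF _ aT].
  by rewrite linear0; exact: atoms0.
rewrite (linD (T k)); apply: atomsD => //.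
have [->|F0] := eqVneq F1 0; first by rewrite linear0; exact: atoms0.
have [S cS] := eig_content jn dF eF F0.
have [kj k1j] := Jk _ Jj.
set z := spv m.+1 j c in eF.
have zz : z k != z k.+1.
  have [kj'|kj'] := ltnP k j.
    rewrite /z !spv_lt //; last by lia.
    rewrite (inj_eq texp_inj) !cS; try lia.
    by apply: (mm_ctneq MM); lia.
  rewrite /z !spv_gt //; try lia.
  by rewrite (inj_eq texp_inj) !cS ?(mm_ctneq MM) //; lia.
have -> : T k F1 = inter (z k) (z k.+1) k F1 + (- ac (z k) (z k.+1)) *: F1.
  by rewrite /inter scaleNr addrK.
apply: atomsD; last by apply: atomsZ; apply: atoms1 eF.
apply: (@atoms1 _ _ _ j (swz (if (k < j)%N then k.+1 else k) c)) => //.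
- rewrite /swz; case: ltnP => //= kj'; case: eqP => //; lia.
- exact: deg_inter.
by apply: eig_ext (inter_eig kn zz eF) => i _; apply: swz_spv_far.
Qed.

Lemma dn_T m c k F : T k F = dn m c k F - ac (t ^ c k.+1) (q ^+ m * t ^ c 0) *: F.
Proof. by rewrite /dn /inter addrK. Qed.

Lemma up_T m c k F : T k F = up m c k F - ac (q ^+ m * t ^ c 0) (t ^ c k.+1) *: F.
Proof. by rewrite /up /inter addrK. Qed.

(** * Dunkl operators on joint eigenvectors *)

Section Dunkl.
Variables (D : V -> V).
Hypothesis DE : forall F, X n (D F) = F - xi n F.

Definition dunkl_op k F : V :=
  t ^ (k%:Z - n%:Z) *: Tdn n T (n - k) (D (Tup n T (n - k) F)).

Let Dinj F G : X n F = X n G -> F = G.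
Proof.
move/eqP; rewrite -subr_eq0 -linearB => /eqP/(mm_Xinj MM)/eqP.
by rewrite subr_eq0 => /eqP.
Qed.

Let DD F G : D (F + G) = D F + D G.
Proof. by apply: Dinj; rewrite (linD (X n)) !DE xiD opprD addrACA. Qed.

Let DZ a F : D (a *: F) = a *: D F.
Proof. by apply: Dinj; rewrite (linZ (X n)) !DE xiZ scalerBr. Qed.

Lemma D_atoms m e0 (J : pred nat) F : (forall j, J j -> (j < n)%N) -> atoms m.+1 e0 J F -> D F = 0.
Proof.
move=> Jn; elim=> [|j c F1 F2 Jj jn cc dF eF _ aT].
  by apply: (mm_Xinj MM); rewrite DE linear0 subr0.
rewrite DD aT addr0.
have [->|F0] := eqVneq F1 0.
  by apply: (mm_Xinj MM); rewrite DE linear0 subr0.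
have [S cS] := eig_content jn dF eF F0.
apply: (mm_Xinj MM); rewrite DE eF // spv_gt ?Jn // cS // (mm_ctlast MM) expr0z.
by rewrite scale1r subrr.
Qed.

Lemma dunkl_macd m S k : (0 < k <= n)%N -> dunkl_op k (macd m.+1 S) = 0.
Proof.
move=> /andP[k0 kn]; rewrite /dunkl_op (@D_atoms m (ct S 0) (pred1 0%N)).
- by rewrite linear0 scaler0.
- by move=> j /eqP->.
have : atoms m.+1 (ct S 0) (pred1 0%N) (macd m.+1 S).
  by apply: (@atoms1 _ _ _ 0 (ct S)) => //; [exact: macd_deg | exact: macd_eig].
have : (n - k < n)%N by lia.
elim: (n - k)%N (macd _ _) => //= d IH F dn aF; apply: IH; first exact: ltnW.
apply: atoms_T aF; first lia.
move=> j /eqP->; split=> //; lia.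
Qed.

(** In the word T_0 ... T_(n-1) each T_k is the intertwiner [up] minus a scalar. The intertwiner
    undoes one [dn] and contributes a factor [kapc]; the scalar term leaves the nonzero entry at
    place k, which the later letters do not touch, so that D kills it. *)
Lemma dunkl_macd0 m S : dunkl_op 0 (macd m.+1 S) =
  ((\prod_(k < n) kapc m.+1 (ct S) k) * (1 - q ^+ m.+1 * t ^ ct S 0)
   * (q ^+ m * t ^ ct S 0)) *: macd m S.
Proof.
set c := ct S; set x := q ^+ m.+1 * _; pose Z d := dns m.+1 c d (Phi (macd m S)).
have eZ d : (d <= n)%N -> eig (spv m.+1 (n - d) c) (Z d).
  by move=> dn; apply: dns_eig dn _; apply: Phi_eig; exact: macd_eig.
have dZ d : (d <= n)%N -> deg m.+1 (Z d).
  move=> dn; apply: dns_deg => //; apply/(mm_degX MM); apply: (mm_degW MM).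
  exact: macd_deg.
have key d a A : (d <= n)%N -> atoms m.+1 (c 0) (fun j => j < n - d)%N A ->
    exists2 B, atoms m.+1 (c 0) (fun j => j < n)%N B &
      Tup n T d (a *: Z d + A) = (a * \prod_(i < d) kapc m.+1 c (n - i.+1)) *: Z 0 + B.
  elim: d a A => [|d IH] a A dn aA.
    by exists A; rewrite ?big_ord0 ?mulr1 //; apply: atoms_sub aA => j; rewrite subn0.
  set k := (n - d.+1)%N; have kn : (k < n)%N by rewrite /k; lia.
  have [|B aB E] := IH (a * kapc m.+1 c k)
    (a *: (- ac (q ^+ m.+1 * t ^ c 0) (t ^ c k.+1) *: Z d.+1) + T k A) (ltnW dn).
    apply: atomsD.
      apply/atomsZ/atomsZ; apply: (@atoms1 _ _ _ k c) (eZ _ dn) => //.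
      - rewrite /k; lia.
      - exact: ltnW.
      - exact: dZ.
    apply: (@atoms_sub _ _ (fun j => j < k)%N); first by rewrite /k => j; lia.
    by apply: atoms_T aA => // j; rewrite -/k => jk; lia.
  exists B => //=; rewrite -/k (linD (T k)) (linZ (T k)) (@up_T m.+1 c k (Z d.+1)).
  rewrite up_dn // scalerDr scalerA -addrA -scaleNr E; congr (_ *: _ + _).
  by rewrite big_ord_recr /= -/k -mulrA [kapc _ _ _ * _]mulrC.
rewrite /dunkl_op subn0 -[macd m.+1 S]/(Z n).
have [|B aB E] := key n 1 0 (leqnn n); first exact: atoms0.
rewrite scale1r addr0 mul1r in E; rewrite E DD DZ (D_atoms _ aB) // addr0.
(* [Z 0] is [Phi (macd m S)], so D removes x_n again. What remains, w followed by the closing word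
   and a power of t, is xi_0, whose eigenvalue on [macd m S] is the last factor. *)
have -> : D (Z 0) = (1 - x) *: W (macd m S).
  apply: Dinj; rewrite DE (linZ (X n)) eZ // subn0 spv_at -/x -[Z 0]/(X n (W _)).
  by rewrite scalerBl scale1r.
rewrite !(linZ (Tdn n T n)) /=; set P := \prod_(i < n) _.
transitivity ((P * (1 - x)) *: (t ^ (0%:Z - n%:Z) *: Tdn n T n (W (macd m S)))).
  by rewrite !scalerA; congr (_ *: _); ring.
have -> : t ^ (0%:Z - n%:Z) *: Tdn n T n (W (macd m S)) = xi 0 (macd m S).
  by rewrite /xi subn0.
rewrite macd_eig // spv_at !scalerA; congr (_ * _ * _ *: _).
by rewrite [RHS](reindex_inj rev_ord_inj).
Qed.

Lemma dunkl_opZ k a F : dunkl_op k (a *: F) = a *: dunkl_op k F.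
Proof.
by rewrite /dunkl_op (linZ (Tup n T (n - k))) DZ (linZ (Tdn n T (n - k))) !scalerA mulrC.
Qed.

End Dunkl.

(** * Regularity of coefficients *)

Section Regularity.
Variables (rK : K -> Prop) (rV : V -> Prop).
Hypotheses (rK_mul : forall a b, rK a -> rK b -> rK (a * b))
  (rK_sub : forall a b, rK a -> rK b -> rK (a - b)) (rK1 : rK 1)
  (rKt : forall b, rK (t ^ b)).
Hypotheses (rV_add : forall F G, rV F -> rV G -> rV (F + G))
  (rV_scale : forall a F, rK a -> rV F -> rV (a *: F))
  (rV_T : forall k F, (k < n)%N -> rV F -> rV (T k F))
  (rV_W : forall F, rV F -> rV (W F)) (rV_X : forall F, rV F -> rV (X n F))
  (rV_vac : forall S, rV (vac S)).

Let rK_opp a : rK a -> rK (- a).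
Proof. by move=> ra; rewrite -sub0r -(subrr 1); apply: rK_sub => //; exact: rK_sub. Qed.

Let rV_Phi F : rV F -> rV (Phi F).
Proof. by move=> rF; apply/rV_X/rV_W. Qed.

Let rK1t : rK (1 - t).
Proof. by apply: rK_sub => //; rewrite -[t]expr1z. Qed.

(** Meant for the degrees below the critical one: there the differences q^m' t^a - t^b do not vanish
    at the special point, and the intertwiners have no other denominators. *)
Lemma macd_regular m S :
  (forall m' a b, (0 < m' <= m)%N -> rK (q ^+ m' * t ^ a - t ^ b)^-1) -> rV (macd m S).
Proof.
elim: m => //= m IH rm.
have {}IH : rV (macd m S).
  by apply: IH => m' a b /andP[m0 mm]; apply: rm; rewrite m0 ltnW.
suff H d : (d <= n)%N -> rV (dns m.+1 (ct S) d (Phi (macd m S))) by exact: H.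
elim: d => [|d IHd] dn /=; first exact: rV_Phi.
apply: rV_add; first by apply: rV_T (IHd (ltnW dn)); lia.
apply: rV_scale (IHd (ltnW dn)); apply: rK_mul; first by apply: rK_mul.
by rewrite -opprB invrN; apply: rK_opp; apply: rm; rewrite /= leqnn.
Qed.

Let rV_Tdn d F : (d <= n)%N -> rV F -> rV (Tdn n T d F).
Proof. by move=> dn rF; elim: d dn => //= d IH dn; apply: rV_T; [lia | apply: IH; lia]. Qed.

Let rV_xi0 F : rV F -> rV (xi 0 F).
Proof.
move=> rF; rewrite /xi; apply: rV_scale => //; apply: rV_Tdn; first exact: leq_subr.
exact: rV_W.
Qed.

(* The spectral value of [xi 0] separates [macd m.+1 S] from every atom in
   [Tdn n T n (Phi (macd m S))] whose nonzero entry is not in position 0. *)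
Lemma macd_regularS m S (l : seq int) : rV (macd m S) ->
  (forall e, e \in l -> rK (q ^+ m.+1 * t ^ ct S 0 - t ^ e)^-1) ->
  (forall S', ct S' 0 = ct S 0 -> ct S' 1 \in l) ->
  rV (macd m.+1 S).
Proof.
move=> rY rl lP; set x := q ^+ m.+1 * _ in rl; set c := ct S.
pose Z d := dns m.+1 c d (Phi (macd m S)).
have eZ d : (d <= n)%N -> eig (spv m.+1 (n - d) c) (Z d).
  by move=> dn; apply: dns_eig dn _; apply: Phi_eig; exact: macd_eig.
have dZ d : (d <= n)%N -> deg m.+1 (Z d).
  move=> dn; apply: dns_deg => //; apply/(mm_degX MM); apply: (mm_degW MM).
  exact: macd_deg.
have key d : (d <= n)%N -> exists2 A, atoms m.+1 (c 0) (fun j => n - d < j)%N A &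
    Tdn n T d (Phi (macd m S)) = Z d + A.
  elim: d => [|d IH] dn; first by exists 0; [exact: atoms0 | rewrite addr0].
  have [A aA /= ->] := IH (ltnW dn).
  set k := (n - d.+1)%N; have kn : (k < n)%N by rewrite /k; lia.
  rewrite (linD (T k)) (@dn_T m.+1 c k (Z d)) -addrA; eexists; last reflexivity.
  apply: atomsD.
    rewrite -scaleNr; apply: atomsZ.
    apply: (@atoms1 _ _ _ (n - d)%N c); rewrite /k; [lia | lia | by [] | |].
      exact: dZ (ltnW dn).
    exact: eZ (ltnW dn).
  apply: (@atoms_sub _ _ (fun j => n - d < j)%N); first by rewrite /k => j; lia.
  by apply: atoms_T aA => // j; rewrite /k => jk; lia.
(* [pr e] is 1 on the eigenvalue x of xi_0 and 0 on t^e, so the product over [l] keeps only the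
   component [macd m.+1 S]. *)
pose pr e F := (x - t ^ e)^-1 *: (xi 0 F - t ^ e *: F).
pose proj F := foldr pr F l.
have prD e F G : pr e (F + G) = pr e F + pr e G.
  by rewrite /pr xiD -[RHS]scalerDr; congr (_ *: _); rewrite scalerDr opprD addrACA.
have prZ e a F : pr e (a *: F) = a *: pr e F.
  rewrite /pr xiZ [RHS]scalerA [a * _]mulrC -[RHS]scalerA; congr (_ *: _).
  by rewrite [RHS]scalerBr; congr (_ - _); rewrite !scalerA mulrC.
have projD F G : proj (F + G) = proj F + proj G.
  by rewrite /proj; elim: (l) => //= e l' ->; rewrite prD.
have proj_eig la F : xi 0 F = la *: F ->
    proj F = (\prod_(e <- l) ((la - t ^ e) / (x - t ^ e))) *: F.
  move=> eF; rewrite /proj; elim: (l) => [|e l' /= ->]; first by rewrite big_nil scale1r.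
  rewrite prZ /pr eF -scalerBl !scalerA big_cons; congr (_ *: _).
  by rewrite mulrC mulrA mulrAC.
have proj_atoms A : atoms m.+1 (c 0) (fun j => 0 < j)%N A -> proj A = 0.
  elim=> [|j c' F1 F2 Jj jn cc dF eF _ a0].
    by rewrite (@proj_eig 0) ?scaler0 ?scale0r // linear0.
  rewrite projD a0 addr0; have [->|F0] := eqVneq F1 0.
    by rewrite (@proj_eig 0) ?scaler0 ?scale0r // linear0.
  have [S' cS'] := eig_content jn dF eF F0.
  (* With the nonzero entry elsewhere, place 0 carries label 1, whose content belongs to [l]. *)
  rewrite (proj_eig _ _ (eF 0%N _)) // spv_lt //.
  rewrite (big_rem (c' 1%N)) /=; last by rewrite cS' // lP // -cS'.
  by rewrite subrr !mul0r scale0r.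
have [A aA E] := key n (leqnn n).
have -> : macd m.+1 S = proj (Tdn n T n (Phi (macd m S))).
  rewrite E projD (proj_atoms A) ?addr0; last first.
    by apply: atoms_sub aA => j; rewrite subnn.
  have eY := @macd_eig m.+1 S 0 (leq0n n); rewrite spv_at -/x in eY.
  rewrite -[Z n]/(macd m.+1 S) (proj_eig _ _ eY) big1 ?scale1r // => e _.
  by rewrite divff // subr_eq0 qtexp_neq.
rewrite /proj; elim: l rl {lP prD prZ proj projD proj_eig proj_atoms} => /= [|e l IH] rl.
  by apply: rV_Tdn => //; exact: rV_Phi.
have rI := IH (fun e' el => rl e' (mem_behead (s := e :: l) el)).
apply: rV_scale; first by apply: rl; rewrite mem_head.
apply: rV_add; first exact: rV_xi0.
by rewrite -scaleNr; apply: rV_scale => //; exact: rK_opp.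
Qed.

End Regularity.

End Eigenvectors.

Local Notation row := Defs.row.
Local Notation col := Defs.col.

(** * Contents of tableaux *)

Section TableauCombinatorics.
Variables (N : nat) (tau : seq nat).
Hypothesis htau : is_partition N tau.
Implicit Types (S : rsyt N tau) (i j : 'I_N).

Let tau_sorted r r' : (r <= r')%N -> (nth 0%N tau r' <= nth 0%N tau r)%N.
Proof.
case/and3P: htau => st _ _ rr.
have [r's|r's] := ltnP r' (size tau); last by rewrite [nth _ _ r']nth_default.
have tr : transitive geq by move=> a b c ab bc; exact: leq_trans bc ab.
have re : reflexive geq by move=> a /=.
by apply: (sorted_leq_nth tr re 0%N st) => //; rewrite inE ?(leq_ltn_trans rr).
Qed.

Let tau_bound r c : (c < nth 0 tau r)%N -> (r < N)%N && (c < N)%N.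
Proof.
case/and3P: htau => _ t0 /eqP <- rc.
have rs : (r < size tau)%N by case: (ltnP r (size tau)) => // rs; rewrite nth_default in rc.
have szle : forall s : seq nat, 0%N \notin s -> (size s <= sumn s)%N.
  elim=> //= a s IH; rewrite inE negb_or => /andP[a0 /IH]; lia.
have nthle : forall (s : seq nat) k, (nth 0 s k <= sumn s)%N.
  elim=> [|a s IH] [|k] //=; [exact: leq_addr | exact: leq_trans (IH k) (leq_addl _ _)].
by rewrite (leq_trans rs (szle _ t0)) (leq_trans rc (nthle _ _)).
Qed.

Lemma cell_in S i : (col S i < nth 0 tau (row S i))%N.
Proof.
have /and4P[_ /eqP im _ _] := valP S.
have : val S i \in ferrers N tau by rewrite -im; apply/imsetP; exists i.
by rewrite inE.
Qed.

Lemma cell_ex S r c : (c < nth 0 tau r)%N -> exists i, row S i = r /\ col S i = c.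
Proof.
move=> rc; have /andP[rN cN] := tau_bound rc.
have /and4P[_ /eqP im _ _] := valP S.
have : (Ordinal rN, Ordinal cN) \in ferrers N tau by rewrite inE.
by rewrite -im => /imsetP[i _ /= E]; exists i; rewrite /Defs.row /Defs.col -E.
Qed.

Let cell_eq S S' i j : row S i = row S' j -> col S i = col S' j -> S i = S' j.
Proof.
rewrite /Defs.row /Defs.col.
by case: (S i) (S' j) => [a b] [c d] /= /val_inj-> /val_inj->.
Qed.

Lemma cell_inj S i j : row S i = row S j -> col S i = col S j -> i = j.
Proof.
have /and4P[/injectiveP inj _ _ _] := valP S => rij cij.
exact/inj/cell_eq.
Qed.

Let row_dec S i j : row S i = row S j -> (col S i < col S j)%N -> (j < i)%N.
Proof.
have /and4P[_ _ /forallP/(_ i)/forallP/(_ j)/implyP dec _] := valP S => rij cij.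
by apply: dec; rewrite cij andbT; apply/eqP/val_inj.
Qed.

Let col_dec S i j : col S i = col S j -> (row S i < row S j)%N -> (j < i)%N.
Proof.
have /and4P[_ _ _ /forallP/(_ i)/forallP/(_ j)/implyP dec] := valP S => cij rij.
by apply: dec; rewrite rij andbT; apply/eqP/val_inj.
Qed.

(** Compare both entries with the one in the row of i and the column of j; that box lies in the
    diagram. *)
Lemma label_mono S i j : (row S i <= row S j)%N -> (col S i <= col S j)%N -> (j <= i)%N.
Proof.
move=> rij cij.
have [k [rk ck]] : exists k, row S k = row S i /\ col S k = col S j.
  by apply: cell_ex; apply: leq_trans (cell_in S j) (tau_sorted rij).
apply: (@leq_trans k).
  move: rij; rewrite -rk leq_eqVlt => /orP[/eqP rkj|]; first by rewrite (cell_inj rkj ck).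
  by move/(col_dec ck)/ltnW.
move: cij; rewrite -ck leq_eqVlt => /orP[/eqP cik|]; first by rewrite (cell_inj rk (esym cik)).
by move/(row_dec (esym rk))/ltnW.
Qed.

Lemma content_eq S i j : content S i = content S j ->
  ((row S i <= row S j) = (col S i <= col S j))%N.
Proof. by rewrite /content => H; apply/idP/idP; lia. Qed.

(** The larger entry j is up-left of i on the same diagonal, and the boxes to the right of and below
    j hold two distinct values strictly between i and j. Hence the contents of three consecutive
    entries are pairwise distinct. *)
Lemma content_gap S i j : content S i = content S j -> (i < j)%N -> (i.+2 < j)%N.
Proof.
move=> cij ij.
have rji : (row S j < row S i)%N.
  by rewrite ltnNge; apply/negP => H; have := label_mono H; rewrite -content_eq // H; lia.
have cji : (col S j < col S i)%N by move: cij; rewrite /content; lia.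
have [a [ra ca]] : exists a, row S a = row S j /\ col S a = (col S j).+1.
  apply: cell_ex; apply: (@leq_trans (col S i).+1); first by lia.
  exact: leq_trans (cell_in S i) (tau_sorted (ltnW rji)).
have [b [rb cb]] : exists b, row S b = (row S j).+1 /\ col S b = col S j.
  apply: cell_ex; apply: (@leq_trans (col S i).+1); first by lia.
  exact: leq_trans (cell_in S i) (tau_sorted rji).
have ij1 : (i <= a)%N by apply: (@label_mono S); lia.
have ij2 : (i <= b)%N by apply: (@label_mono S); lia.
have ij3 : (a <= j)%N by apply: (@label_mono S); lia.
have ij4 : (b <= j)%N by apply: (@label_mono S); lia.
have n1 : a != i by apply/eqP => E; subst; lia.
have n2 : b != i by apply/eqP => E; subst; lia.
have n3 : a != j by apply/eqP => E; subst; lia.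
have n4 : b != j by apply/eqP => E; subst; lia.
have n5 : a != b by apply/eqP => E; subst; lia.
rewrite -!val_eqE /= in n1 n2 n3 n4 n5; lia.
Qed.

Lemma content_last S i : i.+1 = N -> content S i = 0.
Proof.
move=> iN; rewrite /content.
suff : (row S i <= 0)%N && (col S i <= 0)%N by lia.
have [j [rj cj]] : exists j, row S j = 0%N /\ col S j = 0%N.
  apply: cell_ex; apply: leq_ltn_trans (leq0n _) _; last first.
    exact: leq_trans (cell_in S i) (tau_sorted (leq0n _)).
have ij : (i <= j)%N by apply: (@label_mono S); rewrite ?rj ?cj.
have -> : i = j by apply: val_inj => /=; have := ltn_ord j; lia.
by rewrite rj cj.
Qed.

(** Descending induction on the entry. If i stood higher on its diagonal in A than in B, then the
    box of i in A would hold in B an entry larger than i, which by induction occupies the same box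
    in A. *)
Lemma content_inj S S' : (forall i, content S i = content S' i) -> S = S'.
Proof.
move=> cS; apply: val_inj; apply/ffunP => i.
suff H k : (forall j, (k < j)%N -> S j = S' j) -> forall i, (i : nat) = k -> S i = S' i.
  have [m] := ubnP (N - i); elim: m i => // m IH i im; apply: (H i) => // j ij.
  apply: IH; have := ltn_ord j; lia.
move=> {}H {}i ik; have := cS i.
have step (A B : rsyt N tau) : (forall j, (k < j)%N -> A j = B j) ->
    content A i = content B i -> ~~ (row A i < row B i)%N.
  move=> AB cAB; apply/negP => rAB.
  have cc : (col A i < col B i)%N by move: cAB; rewrite /content; lia.
  have [j [rj cj]] : exists j, row B j = row A i /\ col B j = col A i.
    apply: cell_ex; exact: cell_in.
  have ij : (i <= j)%N by apply: (@label_mono B); lia.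
  have jn : j != i by apply/eqP => E; subst; lia.
  have kj : (k < j)%N by rewrite -val_eqE /= in jn; lia.
  have := AB _ kj => E; move: rj cj; rewrite /Defs.row /Defs.col -E => rj cj.
  by move: jn; rewrite (cell_inj rj cj) eqxx.
move=> cSi.
have := step S S' H cSi; have := step S' S (fun j kj => esym (H j kj)) (esym cSi).
move: cSi; rewrite /content => cSi r1 r2.
by apply: cell_eq; lia.
Qed.

Lemma rsyt_swapE S i j : (i.+1 < N)%N ->
  content S i - content S (ordS i) != 1 -> content S i - content S (ordS i) != -1 ->
  rsyt_swap S i j = S (tperm i (ordS i) j).
Proof.
move=> iN c1 c2; have sE : (ordS i : nat) = i.+1 by rewrite /= modn_small.
rewrite /rsyt_swap val_insubd ifT ?ffunE //; set f := [ffun j => _].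
have /and4P[/injectiveP inj /eqP im _ _] := valP S.
have tv (a : 'I_N) : tperm i (ordS i) a =
    (if a == i :> nat then i.+1 else if a == i.+1 :> nat then i : nat else a) :> nat.
  case: tpermP => [->|->|]; first by rewrite eqxx sE.
    by rewrite sE gtn_eqF // eqxx.
  move=> ai as1; case: eqVneq => [/val_inj //|_]; case: eqVneq => // E.
  by case: as1; apply: val_inj; exact: etrans E (esym sE).
have tl (a b : 'I_N) : (a < b)%N -> ~ (a = i /\ b = ordS i) ->
    (tperm i (ordS i) a < tperm i (ordS i) b)%N.
  move=> ab nab; rewrite !tv.
  have {}nab : ~ (a = i :> nat /\ b = i.+1 :> nat).
    by case=> ai bi; case: nab; split; apply: val_inj => //; exact: etrans bi (esym sE).
  case: (eqVneq (a : nat) i) => ai; case: (eqVneq (b : nat) i) => bi;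
  case: (eqVneq (a : nat) i.+1) => ai1; case: (eqVneq (b : nat) i.+1) => bi1; lia.
apply/and4P; split.
- by apply/injectiveP => a b; rewrite !ffunE => /inj/perm_inj.
- apply/eqP; rewrite -im; apply/setP => b; apply/imsetP/imsetP => -[a _ ->].
    by exists (tperm i (ordS i) a); rewrite ?ffunE.
  by exists (tperm i (ordS i) a); rewrite ?ffunE ?tpermK.
- apply/forallP => a; apply/forallP => b; apply/implyP; rewrite !ffunE.
  case/andP => /eqP/(congr1 val)/= rab cab; have := row_dec rab cab.
  rewrite ltnNge [in X in _ -> X]ltnNge; apply: contra.
  rewrite leq_eqVlt => /orP[/eqP/val_inj E|ab]; first by rewrite E ltnn in cab.
  apply/ltnW/tl => // -[ai bi]; subst a b.
  rewrite tpermL tpermR in rab cab.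
  have [k [rk ck]] : exists k, row S k = row S i /\ col S k = (col S (ordS i)).+1.
    by apply: cell_ex; apply: leq_ltn_trans (cell_in S i).
  have ik : (i <= k)%N by apply: (@label_mono S); rewrite ?rk ?ck // /Defs.row rab.
  have ki : (k < ordS i)%N by apply: (@row_dec S); rewrite ?rk ?ck // /Defs.row rab.
  have {}ik : k = i by apply: val_inj => /=; lia.
  move: c1; rewrite /content -ik ck rk ik /Defs.row rab /=; lia.
apply/forallP => a; apply/forallP => b; apply/implyP; rewrite !ffunE.
case/andP => /eqP/(congr1 val)/= cab rab; have := col_dec cab rab.
rewrite ltnNge [in X in _ -> X]ltnNge; apply: contra.
rewrite leq_eqVlt => /orP[/eqP/val_inj E|ab]; first by rewrite E ltnn in rab.
apply/ltnW/tl => // -[ai bi]; subst a b.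
rewrite tpermL tpermR in rab cab.
have [k [rk ck]] : exists k, row S k = (row S (ordS i)).+1 /\ col S k = col S i.
  by apply: cell_ex; apply: leq_trans (cell_in S i) (tau_sorted rab).
have ik : (i <= k)%N by apply: (@label_mono S); rewrite ?rk ?ck // /Defs.col cab.
have ki : (k < ordS i)%N by apply: (@col_dec S); rewrite ?rk ?ck // /Defs.col cab.
have {}ik : k = i by apply: val_inj => /=; lia.
move: c2; rewrite /content -ik ck rk ik /Defs.col cab /=; lia.
Qed.

Section HatContents.
Variables (S : rsyt N tau) (one : 'I_N) (z : int).
Hypotheses (one0 : one = 0%N :> nat) (zS : z \in hat_contents S one).

Definition hat_cell r c := (c < nth 0 tau r - (r == row S one))%N.

Lemma hat_cell_label i : i != one -> hat_cell (row S i) (col S i).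
Proof.
move=> i1; rewrite /hat_cell; case: eqVneq => [ri|_]; last by rewrite subn0 cell_in.
rewrite subn1; have := cell_in S i; have := cell_in S one.
have : col S i != col S one by apply: contra i1 => /eqP ci; apply/eqP/(cell_inj ri ci).
rewrite -ri; case: (ltnP (col S one) (col S i)) => [lt _ _ _|]; last by lia.
by have := row_dec (esym ri) lt; rewrite one0.
Qed.

Lemma hat_cellP r c : hat_cell r c -> exists i, [/\ i != one, row S i = r & col S i = c].
Proof.
rewrite /hat_cell => rc.
have [i [ri ci]] : exists i, row S i = r /\ col S i = c.
  by apply: cell_ex; apply: leq_trans rc (leq_subr _ _).
exists i; split => //; apply/eqP => i1; subst i; rewrite -ri eqxx -ci in rc.
have [j [rj cj]] : exists j, row S j = row S one /\ col S j = (col S one).+1.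
  by apply: cell_ex; lia.
by have := @row_dec S one j (esym rj); rewrite cj => /(_ (leqnn _)); rewrite one0.
Qed.

Lemma hat_cell_mono r c r' c' :
  (r <= r')%N -> (c <= c')%N -> hat_cell r' c' -> hat_cell r c.
Proof.
move=> rr cc /hat_cellP[i [i1 ri ci]].
have [j [rj cj]] : exists j, row S j = r /\ col S j = c.
  apply: cell_ex; apply: leq_ltn_trans cc _; rewrite -ci.
  by apply: leq_trans (cell_in S i) _; apply: tau_sorted; rewrite ri.
rewrite -rj -cj; apply: hat_cell_label; apply: contra i1 => /eqP j1.
have : (i <= j)%N by apply: (@label_mono S); lia.
by rewrite j1 one0 leqn0 -one0 => /eqP /val_inj->.
Qed.

(** A block of equal rows can be lengthened at its first row, and the additional element of the set
    belongs to the box below the last row, when that row is nonempty. *)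
Lemma hat_contentsP : exists r c, [/\ z = c%:Z - r%:Z, ~~ hat_cell r c,
  r = 0%N \/ hat_cell r.-1 c & c = 0%N \/ hat_cell r c.-1].
Proof.
have thE r : nth 0%N (hat_shape S one) r = (nth 0 tau r - (r == row S one))%N.
  have [rs|rs] := ltnP r (size tau).
    by rewrite (nth_map 0%N) ?size_iota // nth_iota // add0n.
  by rewrite !nth_default // size_map size_iota.
move: zS; rewrite /hat_contents mem_cat => /orP[/mapP[r]|].
  rewrite mem_filter => /andP[rP _] ->; exists r, (nth 0%N (hat_shape S one) r).
  split => //; rewrite /hat_cell -!thE ?ltnn //.
    by case/orP: rP => [/eqP|]; [left | right].
  by case: (nth _ _ r) => [|c]; [left | right].
case: ifP => // th; rewrite inE => /eqP ->; exists (size tau), 0%N.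
split; rewrite ?sub0r //; rewrite /hat_cell; last by left.
  by rewrite [nth _ _ _]nth_default // sub0n.
right; move: th; rewrite (last_nth 0%N) size_map size_iota.
case: (size tau) => [|s] //=; last by rewrite thE.
Qed.

(** The entry 1 occupies the same corner in S' as in S, so the box of 2 lies in the diagram without
    that corner. If it were on the diagonal of the addable box (r, c), it would be strictly up-left
    of it, and the box below 2 would also avoid the corner; but this box would have to hold 1. *)
Lemma content1_neq (S' : rsyt N tau) (two : 'I_N) : two = 1%N :> nat ->
  content S' one = content S one -> content S' two != z.
Proof.
move=> two1 cS; apply/eqP => cz.
have [r [c [zE nrc rP cP]]] := hat_contentsP.
have oneE : row S' one = row S one /\ col S' one = col S one.
  have corner (A B : rsyt N tau) : content A one = content B one ->
      ~~ (row A one < row B one)%N.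
    move=> AB; apply/negP => rAB.
    have cAB : (col A one < col B one)%N by move: AB; rewrite /content; lia.
    have [j [rj cj]] : exists j, row A j = row B one /\ col A j = col B one.
      exact/cell_ex/cell_in.
    have : (j <= one)%N by apply: (@label_mono A); lia.
    rewrite one0 leqn0 -one0 => /eqP/val_inj j1; subst j; lia.
  have := corner _ _ cS; have := corner _ _ (esym cS).
  have := cS; rewrite /content; lia.
have hatS' i : i != one -> hat_cell (row S' i) (col S' i).
  move=> i1; have [j [rj cj]] : exists j, row S j = row S' i /\ col S j = col S' i.
    exact/cell_ex/cell_in.
  rewrite -rj -cj; apply: hat_cell_label; apply: contra i1 => /eqP j1; subst j.
  by apply/eqP/(@cell_inj S'); case: oneE => r1 c1; rewrite ?r1 ?c1.
have two_one : two != one by rewrite -val_eqE /= two1 one0.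
have h2 := hatS' _ two_one.
have rr : (row S' two < r)%N.
  rewrite ltnNge; apply: contra nrc => rr; apply: hat_cell_mono h2 => //.
  by move: cz; rewrite /content zE; lia.
have cc : (col S' two < c)%N by move: cz; rewrite /content zE; lia.
have hc : hat_cell (row S' two).+1 (col S' two).
  by case: cP => [c0|]; [lia | apply: hat_cell_mono; lia].
have [j [rj cj]] : exists j, row S' j = (row S' two).+1 /\ col S' j = col S' two.
  by apply: cell_ex; move: hc; rewrite /hat_cell; lia.
have := @col_dec S' two j (esym cj); rewrite rj => /(_ (leqnn _)).
rewrite two1 ltnS leqn0 -one0 => /eqP/val_inj j1; subst j.
move: hc; rewrite /hat_cell; case: oneE => r1 c1; rewrite -rj r1 eqxx -cj c1 => h.
have [j [rj' cj']] : exists j, row S j = row S one /\ col S j = (col S one).+1.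
  by apply: cell_ex; lia.
by have := @row_dec S one j (esym rj'); rewrite cj' => /(_ (leqnn _)); rewrite one0.
Qed.

Let diag (e : int) := #|[set i | (i != one) && (content S i == e)]|.

(** A diagonal enters the diagram at row 0, or at row -e in column 0 when e < 0; R is the first row
    where it has left the diagram. *)
Let diagE (e : int) R : (forall r c, c%:Z - r%:Z = e -> hat_cell r c = (r < R)%N) ->
  diag e = (R - (if (e < 0)%R then `|e| else 0))%N.
Proof.
move=> hR; set lo := (if _ then _ else _).
rewrite /diag cardE -(size_map (row S)) -[RHS](size_iota lo); apply: perm_size.
have inA i : i \in enum [set i | (i != one) && (content S i == e)]
    = (i != one) && (content S i == e) by rewrite mem_enum inE.
apply: uniq_perm; rewrite ?iota_uniq //.
  rewrite map_inj_in_uniq ?enum_uniq // => i j; rewrite !inA.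
  move=> /andP[_ /eqP ci] /andP[_ /eqP cj] rij; apply: (cell_inj rij).
  by move: ci cj; rewrite /content; lia.
move=> r; rewrite mem_iota; apply/mapP/andP => [ [i iA ->] | [lr rR] ].
  move: iA; rewrite inA => /andP[i1 /eqP ci]; have := hat_cell_label i1.
  rewrite (hR _ _ ci); move: ci; rewrite /content /lo; case: ifP; lia.
have [i [i1 ri ci]] : exists i, [/\ i != one, row S i = r & col S i = `|(r%:Z + e)%R|%N].
  by apply: hat_cellP; rewrite hR; move: lr rR; rewrite /lo; case: ifP; lia.
exists i => //; rewrite inA i1 /content ri ci /=.
by move: lr; rewrite /lo; case: ifP; lia.
Qed.

(** With (r, c) the addable box, the diagonals z + 1, z and z - 1 end before the rows r, r and r +
    1, which contributes r + (r + 1) - 2 r = 1. Their starting rows max(0, -e) have second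
    difference 1 at z = 0 and 0 elsewhere, whence the term [z == 0]. *)
Lemma hat_count :
  (#|[set i | (i != one) && (content S i == (z + 1)%R)]|
   + #|[set i | (i != one) && (content S i == (z - 1)%R)]| + (z == 0%R))%N =
  (#|[set i | (i != one) && (content S i == z)]|.*2 + 1)%N.
Proof.
have [r [c [zE nrc rP cP]]] := hat_contentsP.
rewrite -!/(diag _) (@diagE z r) ?(@diagE (z + 1) r) ?(@diagE (z - 1) r.+1).
- by case: eqP => ?; case: ifP => ?; case: ifP => ?; case: ifP => ?; lia.
- move=> a b ab; have [ra|ra] := ltnP r a.
    rewrite ltnS leqNgt ra; apply/negbTE; apply: contra nrc.
    by apply: hat_cell_mono; lia.
  rewrite ltnS ra; case: cP => [c0|]; first lia.
  by apply: hat_cell_mono; lia.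
- move=> a b ab; have [ra|ra] := ltnP a r.
    by case: rP => [r0|]; [lia | apply: hat_cell_mono; lia].
  by apply/negbTE; apply: contra nrc; apply: hat_cell_mono; lia.
move=> a b ab; have [ra|ra] := ltnP a r.
  by case: rP => [r0|]; [lia | apply: hat_cell_mono; lia].
by apply/negbTE; apply: contra nrc; apply: hat_cell_mono; lia.
Qed.

End HatContents.

End TableauCombinatorics.

(** * The Hecke algebra on tableaux *)

Section SixTerms.
Variables (K : fieldType) (I : finType).
Local Notation V := {ffun I -> K^o}.
Variables (f g : {linear V -> V}).
Implicit Types (p : V) (a b : K).

Let point (u v : V) : u = v -> forall U, u U = v U. Proof. by move->. Qed.

(** A swapped filling is a tableau only where its coefficient is nonzero. So each relation about a
    swapped vector is assumed after multiplication by that coefficient, and no coefficient is ever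
    cancelled. *)
Lemma comm_terms a b c d p p1 p2 p12 p21 :
  f p = a *: p + b *: p1 -> g p = c *: p + d *: p2 ->
  d *: f p2 = d *: (a *: p2 + b *: p21) -> b *: g p1 = b *: (c *: p1 + d *: p12) ->
  b *: (d *: p21) = b *: (d *: p12) -> f (g p) = g (f p).
Proof.
move=> Ef Eg Ef2 Eg1 Epp; rewrite Ef Eg (linD f) (linD g) !(linZ f) !(linZ g) Ef Eg.
apply/ffunP => U; have := point Ef2 U; have := point Eg1 U; have := point Epp U.
rewrite !ffunE /GRing.scale /= => pp -> ->.
move: (p U) (p1 U) (p2 U) (p12 U) (p21 U) pp => P P1 P2 P12 P21 pp.
transitivity (c * (a * P + b * P1) + d * (a * P2) + b * (d * P21)); first by ring.
by rewrite pp; ring.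
Qed.

(** The vectors stand for the six rearrangements of three consecutive entries, the last one reached
    by two routes as p121 and p212. The last three hypotheses compare the coefficients of p, p1 and
    p2. *)
Lemma braid_terms (ax bx ax' bx' ay by' ay' by2 as' bs : K)
    p p1 p2 p12 p21 p121 p212 :
  f p = ax *: p + bx *: p1 -> g p = ay *: p + by' *: p2 ->
  bx *: f p1 = bx *: (ax' *: p1 + bx' *: p) ->
  by' *: g p2 = by' *: (ay' *: p2 + by2 *: p) ->
  bx *: g p1 = bx *: (as' *: p1 + bs *: p12) ->
  by' *: f p2 = by' *: (as' *: p2 + bs *: p21) ->
  bx *: (bs *: f p12) = bx *: (bs *: (ay *: p12 + by' *: p121)) ->
  by' *: (bs *: g p21) = by' *: (bs *: (ax *: p21 + bx *: p212)) ->
  bx *: (by' *: (bs *: p121)) = bx *: (by' *: (bs *: p212)) ->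
  ax ^+ 2 * ay + as' * (bx * bx') = ay ^+ 2 * ax + as' * (by' * by2) ->
  bx * (ax * ay + ax' * as') = bx * (ay * as') ->
  by' * (ay * ax + ay' * as') = by' * (ax * as') ->
  f (g (f p)) = g (f (g p)).
Proof.
move=> f_p g_p f1 g2 g1 f2 f12 g21 pp c0 c1 c2.
have gf : g (f p) = ax *: (ay *: p + by' *: p2) + bx *: (as' *: p1 + bs *: p12).
  by rewrite f_p (linD g) !(linZ g) g_p g1.
have fg : f (g p) = ay *: (ax *: p + bx *: p1) + by' *: (as' *: p2 + bs *: p21).
  by rewrite g_p (linD f) !(linZ f) f_p f2.
rewrite gf fg !((linD f), (linZ f), (linD g), (linZ g)) f_p g_p.
apply/ffunP => U; have := point f1 U; have := point g2 U; have := point f2 U.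
have := point g1 U; have := point f12 U; have := point g21 U; have := point pp U.
rewrite !ffunE /GRing.scale /=.
move: (f p1 U) (f p2 U) (g p1 U) (g p2 U) (f p12 U) (g p21 U) => F1 F2 G1 G2 F12 G21.
move: (p U) (p1 U) (p2 U) (p12 U) (p21 U) (p121 U) (p212 U) => P P1 P2 P12 P21 P121 P212.
move=> ppU g21U f12U g1U f2U g2U f1U.
transitivity (ax * (ay * (ax * P + bx * P1)) + ax * (by' * F2)
   + (as' * (bx * F1) + bx * (bs * F12))); first by ring.
rewrite f2U f1U f12U.
transitivity (ay * (ax * (ay * P + by' * P2)) + ay * (bx * G1)
   + (as' * (by' * G2) + by' * (bs * G21))); last by ring.
rewrite g1U g2U g21U.
transitivity ((ax ^+ 2 * ay + as' * (bx * bx')) * P + (bx * (ax * ay + ax' * as')) * P1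
  + (by' * (ax * as')) * P2 + bx * bs * ay * P12 + by' * bs * ax * P21
  + bx * (by' * (bs * P121))); first by ring.
by rewrite c0 c1 -c2 ppU; ring.
Qed.

End SixTerms.

Lemma scale_eq (K : fieldType) (U : lmodType K) (a : K) (u v : U) :
  (a != 0 -> u = v) -> a *: u = a *: v.
Proof. by have [->|a0] := eqVneq a 0; [rewrite !scale0r | move=> ->]. Qed.

Lemma inord_neq n i j : (i <= n)%N -> (j <= n)%N -> i != j ->
  (inord i : 'I_n.+1) != inord j.
Proof. by move=> ilt jlt; apply: contraNneq => /(congr1 val)/=; rewrite !inordK // => ->. Qed.

Lemma inord_ordS n k : (k < n)%N -> ordS (inord k : 'I_n.+1) = inord k.+1.
Proof.
by move=> kn; apply: val_inj => /=; rewrite !inordK ?modn_small //; lia.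
Qed.

Lemma tperm_braid (I : finType) (a b c : I) : a != b -> b != c -> a != c ->
  (tperm a b * tperm b c * tperm a b = tperm b c * tperm a b * tperm b c)%g.
Proof.
move=> ab bc ac.
have J (s x : {perm I}) : (s^-1 = s -> s * x * s = x ^ s)%g.
  by move=> sV; rewrite conjgE sV mulgA.
by rewrite !J ?tpermV // !tpermJ tpermR tpermL !tpermD // eq_sym.
Qed.

Section TabHecke.
Variables (K : fieldType) (n : nat) (tau : seq nat) (t : K).
Local Notation N := n.+1.
Hypothesis htau : is_partition N tau.
Hypotheses (t0 : t != 0) (tgen : forall b : int, b != 0 -> t ^ b != 1).
Local Notation V := (tabspace K N tau).
Local Notation tab := (@tab K N tau).
Implicit Types (S : rsyt N tau) (v : V).

Definition ct S k : int := content S (inord k).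
Definition stab S k : rsyt N tau := rsyt_swap S (inord k).

(** One formula for the diagonal coefficient of T_i in all four cases: it is t at b = 1 and -1 at b
    = -1. The off-diagonal [psi] vanishes at these two values, so the default value of [rsyt_swap]
    never matters; [psi2 b] is the product of [psi b] and [psi (- b)]. *)
Definition phi (b : int) : K := t ^ b * (t - 1) / (t ^ b - 1).
Definition psi (b : int) : K :=
  if (b == 1) || (b == -1) then 0 else
  if 0 < b then 1 else t * (t ^ (b + 1) - 1) * (t ^ (b - 1) - 1) / (t ^ b - 1) ^+ 2.
Definition psi2 (b : int) : K :=
  t * (t ^ (b + 1) - 1) * (t ^ (b - 1) - 1) / (t ^ b - 1) ^+ 2.

Let t1 : t - 1 != 0.
Proof. by rewrite subr_eq0 -[t]expr1z tgen. Qed.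

Let tb1 b : b != 0 -> t ^ b - 1 != 0.
Proof. by move=> b0; rewrite subr_eq0 tgen. Qed.

Lemma psi2N b : b != 0 -> psi2 (- b) = psi2 b.
Proof.
move=> b0; have B1 := tb1 b0; have B0 : t ^ b != 0 by rewrite expfz_neq0.
rewrite /psi2 !expfzDr // !exprN1 expr1z -invr_expz; move: B1 B0; set B := t ^ b.
move=> B1 B0.
have B2 : 1 - B != 0 by rewrite -opprB oppr_eq0.
by field; rewrite ?mulN1r ?t0 ?B0 ?B1 ?B2.
Qed.

Lemma psi_mul b : b != 0 -> psi b * psi (- b) = psi2 b.
Proof.
move=> b0; rewrite /psi eqr_oppLR [- b == -1]eqr_opp orbC.
have psi2_1 : psi2 1 = 0.
  by rewrite /psi2 (_ : 1 - 1 = 0 :> int) // expr0z subrr mulr0 mul0r.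
have [->|b1] := eqVneq b 1; first by rewrite orbT mul0r psi2_1.
have [->|b2] := eqVneq b (-1); first by rewrite mul0r psi2N // psi2_1.
rewrite /= oppr_gt0; have [bp|bn|] := ltrgt0P b; last by move/eqP: b0.
  by rewrite mul1r -psi2N.
by rewrite mulr1.
Qed.

Definition cdiff S k : int := ct S k - ct S k.+1.

Lemma ctS_neq S k : (k < n)%N -> ct S k != ct S k.+1.
Proof.
move=> kn; apply/eqP => H; have := content_gap htau H; rewrite !inordK; lia.
Qed.

Lemma ctSS_neq S k : (k.+1 < n)%N -> ct S k != ct S k.+2.
Proof.
move=> kn; apply/eqP => H; have := content_gap htau H; rewrite !inordK; lia.
Qed.

Lemma cdiff_neq0 S k : (k < n)%N -> cdiff S k != 0.
Proof. by move=> kn; rewrite subr_eq0 ctS_neq. Qed.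

Lemma psi_neq b : psi b != 0 -> (b != 1) && (b != -1).
Proof. by rewrite /psi -negb_or; case: ifP => //; rewrite eqxx. Qed.

Lemma stabE S k j : (k < n)%N -> psi (cdiff S k) != 0 ->
  stab S k j = S (tperm (inord k) (inord k.+1) j).
Proof.
move=> kn /psi_neq/andP[c1 c2]; rewrite /stab rsyt_swapE ?inord_ordS //.
by rewrite inordK //; lia.
Qed.

Lemma ct_stab S k j : (k < n)%N -> (j <= n)%N -> psi (cdiff S k) != 0 ->
  ct (stab S k) j = if j == k then ct S k.+1 else if j == k.+1 then ct S k else ct S j.
Proof.
move=> kn jn p0; rewrite /ct /content /Defs.row /Defs.col stabE //.
have [->|jk] := eqVneq j k; first by rewrite tpermL.
have [->|jk1] := eqVneq j k.+1; first by rewrite tpermR.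
rewrite tpermD // -val_eqE /= !inordK //; lia.
Qed.

Lemma ct_stab_l S k : (k < n)%N -> psi (cdiff S k) != 0 -> ct (stab S k) k = ct S k.+1.
Proof. by move=> kn p0; rewrite (ct_stab kn (ltnW kn) p0) eqxx. Qed.

Lemma ct_stab_r S k : (k < n)%N -> psi (cdiff S k) != 0 -> ct (stab S k) k.+1 = ct S k.
Proof. by move=> kn p0; rewrite (ct_stab kn kn p0) eqxx gtn_eqF. Qed.

Lemma ct_stab_far S k j : (k < n)%N -> psi (cdiff S k) != 0 -> (j <= n)%N ->
  j != k -> j != k.+1 -> ct (stab S k) j = ct S j.
Proof. by move=> kn p0 jn /negPf jk /negPf jk1; rewrite (ct_stab kn jn p0) jk jk1. Qed.

Lemma cdiff_stab S k : (k < n)%N -> psi (cdiff S k) != 0 ->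
  cdiff (stab S k) k = - cdiff S k.
Proof.
move=> kn p0; by rewrite /cdiff ct_stab_l // ct_stab_r // [RHS]opprB.
Qed.

Lemma cdiff_stab_next S k : (k.+1 < n)%N -> psi (cdiff S k) != 0 ->
  cdiff (stab S k) k.+1 = cdiff S k + cdiff S k.+1.
Proof.
move=> kn p0; have k1n := ltnW kn.
rewrite /cdiff (ct_stab_r k1n p0) (ct_stab_far k1n p0 kn) ?gtn_eqF //.
by rewrite addrA subrK.
Qed.

Lemma cdiff_stab_prev S k : (k.+1 < n)%N -> psi (cdiff S k.+1) != 0 ->
  cdiff (stab S k.+1) k = cdiff S k + cdiff S k.+1.
Proof.
move=> kn p0; have k1n := ltnW kn.
rewrite /cdiff (ct_stab_l kn p0) (ct_stab_far kn p0 (ltnW k1n)) ?ltn_eqF //.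
by rewrite addrA subrK.
Qed.

Lemma cdiff_stab_next2 S k : (k.+1 < n)%N -> psi (cdiff S k) != 0 ->
  psi (cdiff S k + cdiff S k.+1) != 0 ->
  cdiff (stab (stab S k) k.+1) k = cdiff S k.+1.
Proof.
move=> kn p0 p1; have k1n := ltnW kn.
rewrite -(cdiff_stab_next kn p0) in p1.
rewrite /cdiff (ct_stab_l kn p1) (ct_stab_far kn p1 (ltnW k1n)) ?ltn_eqF //.
by rewrite (ct_stab_l k1n p0) (ct_stab_far k1n p0 kn) ?gtn_eqF.
Qed.

Lemma cdiff_stab_prev2 S k : (k.+1 < n)%N -> psi (cdiff S k.+1) != 0 ->
  psi (cdiff S k + cdiff S k.+1) != 0 ->
  cdiff (stab (stab S k.+1) k) k.+1 = cdiff S k.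
Proof.
move=> kn p0 p1; have k1n := ltnW kn.
rewrite -(cdiff_stab_prev kn p0) in p1.
rewrite /cdiff (ct_stab_r k1n p1) (ct_stab_far k1n p1 kn) ?gtn_eqF //.
by rewrite (ct_stab_r kn p0) (ct_stab_far kn p0 (ltnW k1n)) ?ltn_eqF.
Qed.

Lemma stabK S k : (k < n)%N -> psi (cdiff S k) != 0 -> psi (- cdiff S k) != 0 ->
  stab (stab S k) k = S.
Proof.
move=> kn p0 p1; apply: val_inj; apply/ffunP => j.
by rewrite [LHS]stabE ?cdiff_stab // stabE // tpermK.
Qed.

Definition tv k v : V := tauT t v (inord k).

Fact tv_linear k : linear (tv k).
Proof.
move=> a u v; rewrite /tv /tauT scaler_sumr -big_split; apply: eq_bigr => S _.
by rewrite !ffunE scalerDl scalerA.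
Qed.
HB.instance Definition _ k := GRing.isLinear.Build K V V *:%R (tv k) (tv_linear k).

Lemma tvD k u v : tv k (u + v) = tv k u + tv k v. Proof. exact: linearD. Qed.
Lemma tvZ k a v : tv k (a *: v) = a *: tv k v. Proof. exact: linearZ. Qed.

Lemma tab_sum v : v = \sum_S v S *: tab S.
Proof.
apply/ffunP => U; rewrite sum_ffunE (bigD1 U) //= !ffunE eqxx [_ *: _]mulr1.
by rewrite big1 ?addr0 // => S SU; rewrite !ffunE eq_sym (negPf SU) scaler0.
Qed.

Lemma tauT_tabs i S : tauT t (tab S) i = tauT_tab t i S.
Proof.
rewrite /tauT (bigD1 S) //= ffunE eqxx scale1r big1 ?addr0 // => U US.
by rewrite ffunE (negPf US) scale0r.
Qed.

Lemma tv_tab S k : (k < n)%N ->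
  tv k (tab S) = phi (cdiff S k) *: tab S + psi (cdiff S k) *: tab (stab S k).
Proof.
move=> kn; have c0 := cdiff_neq0 S kn.
rewrite /tv tauT_tabs /tauT_tab inord_ordS // -/(ct S k) -/(ct S k.+1) -/(cdiff S k).
rewrite /psi; move: (cdiff S k) c0 => b b0; have B1 := tb1 b0.
have B0 : t ^ b != 0 by rewrite expfz_neq0.
have [->|b1] /= := eqVneq b 1.
  by rewrite scale0r addr0 /phi expr1z mulfK.
have [->|b2] /= := eqVneq b (-1).
  rewrite scale0r addr0 /phi exprN1 -scaleN1r; congr (_ *: _).
  have : 1 - t != 0 by rewrite -opprB oppr_eq0.
  by move=> t2; field; rewrite ?mulN1r ?t0 ?t2 ?t1.
case: ifP => _; last by rewrite addrC.
rewrite scale1r addrC; congr (_ *: _ + _); rewrite /phi -invr_expz.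
by field; rewrite ?mulN1r ?B0 ?B1.
Qed.

Lemma linear_tab (f g : {linear V -> V}) : (forall S, f (tab S) = g (tab S)) -> f =1 g.
Proof.
by move=> fg v; rewrite [v]tab_sum !linear_sum; apply: eq_bigr => S _; rewrite !linearZ fg.
Qed.

Let tX b : t ^ (b + 1) = t ^ b * t. Proof. by rewrite expfzDr // expr1z. Qed.
Let tY b : t ^ (b - 1) = t ^ b / t. Proof. by rewrite expfzDr // exprN1. Qed.

Let phiD x y : phi (x + y) = t ^ x * t ^ y * (t - 1) / (t ^ x * t ^ y - 1).
Proof. by rewrite /phi expfzDr. Qed.

Let phiN x : x != 0 -> phi (- x) = (t - 1) / (1 - t ^ x).
Proof.
move=> x0; rewrite /phi -invr_expz; have X0 : t ^ x != 0 by rewrite expfz_neq0.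
have X1 := tb1 x0; move: (t ^ x) X0 X1 => X X0 X1.
have X2 : 1 - X != 0 by rewrite -opprB oppr_eq0.
by field; rewrite ?mulN1r ?X0 ?X1 ?X2.
Qed.

Let phi_quad b : b != 0 -> phi b ^+ 2 + psi2 b = (t - 1) * phi b + t.
Proof.
move=> b0; rewrite /phi /psi2 tX tY; have X1 := tb1 b0.
by field; rewrite ?mulN1r ?X1 ?t0.
Qed.

Let phi_opp b : b != 0 -> phi b + phi (- b) = t - 1.
Proof.
move=> b0; rewrite phiN // /phi; have X1 := tb1 b0.
have X2 : 1 - t ^ b != 0 by rewrite -opprB oppr_eq0.
by field; rewrite ?mulN1r ?X1 ?X2.
Qed.

Let phi_yb x y : x != 0 -> y != 0 -> x + y != 0 ->
  phi x * phi y + phi (- x) * phi (x + y) = phi y * phi (x + y).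
Proof.
move=> x0 y0 xy0; rewrite phiD phiN // /phi; have X1 := tb1 x0; have Y1 := tb1 y0.
have XY := tb1 xy0; rewrite expfzDr // in XY.
have X2 : 1 - t ^ x != 0 by rewrite -opprB oppr_eq0.
by field; rewrite ?mulN1r ?X1 ?X2 ?Y1 ?XY.
Qed.

Let phi_yb2 x y : x != 0 -> y != 0 -> x + y != 0 ->
  phi x ^+ 2 * phi y + phi (x + y) * psi2 x = phi y ^+ 2 * phi x + phi (x + y) * psi2 y.
Proof.
move=> x0 y0 xy0; rewrite phiD /phi /psi2 !tX !tY; have X1 := tb1 x0; have Y1 := tb1 y0.
have XY := tb1 xy0; rewrite expfzDr // in XY.
by field; rewrite ?mulN1r ?X1 ?t0 ?Y1 ?XY.
Qed.

Lemma psi_tv_stab S k : (k < n)%N ->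
  psi (cdiff S k) *: tv k (tab (stab S k)) =
  psi (cdiff S k) *: (phi (- cdiff S k) *: tab (stab S k) + psi (- cdiff S k) *: tab S).
Proof.
move=> kn; apply: scale_eq => p0.
rewrite tv_tab // cdiff_stab //; congr (_ + _).
apply: scale_eq => p1.
by rewrite stabK.
Qed.

Lemma tv_quad k v : (k < n)%N -> tv k (tv k v) = (t - 1) *: tv k v + t *: v.
Proof.
move=> kn; apply: (linear_tab (f := tv k \o tv k)
  (g := ((t - 1) \*: tv k) \+ (t \*: (idfun : V -> V)))) => S /=.
have b0 := cdiff_neq0 S kn; have H := psi_tv_stab S kn.
rewrite tv_tab // tvD !tvZ H tv_tab //; move: b0 => {H}.
set b := cdiff S k => b0; apply/ffunP => U; rewrite !ffunE; set p := _%:R; set p1 := _%:R.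
have E1 := phi_quad b0; have E2 := phi_opp b0; rewrite -psi_mul // in E1.
transitivity ((phi b ^+ 2 + psi b * psi (- b)) * p + psi b * (phi b + phi (- b)) * p1).
  by rewrite /GRing.scale /=; ring.
by rewrite E1 E2 /GRing.scale /=; ring.
Qed.

Lemma tv_comm i j v : (i.+1 < j)%N -> (j < n)%N -> tv i (tv j v) = tv j (tv i v).
Proof.
move=> ij jn; have iN : (i < n)%N by lia.
apply: (linear_tab (f := tv i \o tv j) (g := tv j \o tv i)) => S /=.
have cij : psi (cdiff S i) != 0 -> cdiff (stab S i) j = cdiff S j.
  by move=> p0; rewrite /cdiff !ct_stab_far //; lia.
have cji : psi (cdiff S j) != 0 -> cdiff (stab S j) i = cdiff S i.
  by move=> p0; rewrite /cdiff !ct_stab_far //; lia.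
have E1 : psi (cdiff S j) *: tv i (tab (stab S j)) = psi (cdiff S j) *:
    (phi (cdiff S i) *: tab (stab S j) + psi (cdiff S i) *: tab (stab (stab S j) i)).
  apply: scale_eq => p0.
  by rewrite (tv_tab _ iN) (cji p0).
have E2 : psi (cdiff S i) *: tv j (tab (stab S i)) = psi (cdiff S i) *:
    (phi (cdiff S j) *: tab (stab S i) + psi (cdiff S j) *: tab (stab (stab S i) j)).
  apply: scale_eq => p0.
  rewrite (tv_tab _ jn) (cij p0); reflexivity.
have E3 : psi (cdiff S i) *: (psi (cdiff S j) *: tab (stab (stab S j) i)) =
    psi (cdiff S i) *: (psi (cdiff S j) *: tab (stab (stab S i) j)).
  apply: scale_eq => p0.
  apply: scale_eq => p1.
  congr (tab _); apply: val_inj; apply/ffunP => x.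
  rewrite [LHS]stabE ?cji // [in LHS]stabE // [RHS]stabE ?cij // [in RHS]stabE //.
  congr (val S _); rewrite -!permM; congr (_ x).
  by rewrite conjgC tpermJ !tpermD //; apply: inord_neq; lia.
exact: (comm_terms (tv_tab S iN) (tv_tab S jn) E1 E2 E3).
Qed.

(** The contents of k, k + 1 and k + 2 are pairwise distinct, so the differences x, y and x + y that
    occur after any of the swaps are nonzero and every [phi] involved is defined. *)
Lemma tv_braid k v : (k.+1 < n)%N ->
  tv k (tv k.+1 (tv k v)) = tv k.+1 (tv k (tv k.+1 v)).
Proof.
move=> kn; have k1n : (k < n)%N by lia.
have [ab bc ac] : [/\ inord k != inord k.+1 :> 'I_N, inord k.+1 != inord k.+2 :> 'I_N
    & inord k != inord k.+2 :> 'I_N] by split; apply: inord_neq; lia.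
apply: (linear_tab (f := tv k \o tv k.+1 \o tv k)
  (g := tv k.+1 \o tv k \o tv k.+1)) => S /=.
set x := cdiff S k; set y := cdiff S k.+1.
have xyE : x + y = ct S k - ct S k.+2 by rewrite /x /y /cdiff addrA subrK.
have x0 : x != 0 := cdiff_neq0 S k1n.
have y0 : y != 0 := cdiff_neq0 S kn.
have xy0 : x + y != 0 by rewrite xyE subr_eq0 ctSS_neq.
have d1 := @cdiff_stab_next S k kn; have d2 := @cdiff_stab_prev S k kn.
have d12 p0 := @cdiff_stab_next2 S k kn p0; have d21 p0 := @cdiff_stab_prev2 S k kn p0.
rewrite -/x -/y in d1 d2 d12 d21.
have g1 : psi x *: tv k.+1 (tab (stab S k)) = psi x *: (phi (x + y) *: tab (stab S k)
    + psi (x + y) *: tab (stab (stab S k) k.+1)).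
  apply: scale_eq => p0.
  by rewrite (tv_tab _ kn) (d1 p0).
have f2 : psi y *: tv k (tab (stab S k.+1)) = psi y *: (phi (x + y) *: tab (stab S k.+1)
    + psi (x + y) *: tab (stab (stab S k.+1) k)).
  apply: scale_eq => p0.
  rewrite (tv_tab _ k1n) (d2 p0); reflexivity.
have f12 : psi x *: (psi (x + y) *: tv k (tab (stab (stab S k) k.+1))) =
    psi x *: (psi (x + y) *: (phi y *: tab (stab (stab S k) k.+1)
       + psi y *: tab (stab (stab (stab S k) k.+1) k))).
  apply: scale_eq => p0.
  apply: scale_eq => p1.
  rewrite (tv_tab _ k1n) (d12 p0 p1); reflexivity.
have g21 : psi y *: (psi (x + y) *: tv k.+1 (tab (stab (stab S k.+1) k))) =
    psi y *: (psi (x + y) *: (phi x *: tab (stab (stab S k.+1) k)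
       + psi x *: tab (stab (stab (stab S k.+1) k) k.+1))).
  apply: scale_eq => p0.
  apply: scale_eq => p1.
  rewrite (tv_tab _ kn) (d21 p0 p1); reflexivity.
have pp : psi x *: (psi y *: (psi (x + y) *: tab (stab (stab (stab S k) k.+1) k))) =
    psi x *: (psi y *: (psi (x + y) *: tab (stab (stab (stab S k.+1) k) k.+1))).
  apply: scale_eq => p0.
  apply: scale_eq => p1.
  apply: scale_eq => p2.
  congr (tab _); apply: val_inj; apply/ffunP => j.
  have q1 : psi (cdiff (stab S k) k.+1) != 0 by rewrite (d1 p0).
  have q2 : psi (cdiff (stab (stab S k) k.+1) k) != 0 by rewrite (d12 p0 p2).
  have r1 : psi (cdiff (stab S k.+1) k) != 0 by rewrite (d2 p1).
  have r2 : psi (cdiff (stab (stab S k.+1) k) k.+1) != 0 by rewrite (d21 p1 p2).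
  rewrite [LHS](stabE _ k1n q2) (stabE _ kn q1) (stabE _ k1n p0).
  rewrite [RHS](stabE _ kn r2) (stabE _ k1n r1) (stabE _ kn p1).
  congr (val S _); rewrite -!permM; congr (_ j).
  by rewrite ?mulgA tperm_braid.
apply: (braid_terms (tv_tab S k1n) (tv_tab S kn) (psi_tv_stab S k1n) (psi_tv_stab S kn)
  g1 f2 f12 g21 pp).
- rewrite (psi_mul x0) (psi_mul y0); exact: phi_yb2.
- by rewrite phi_yb.
by have := phi_yb y0 x0; rewrite [y + x]addrC => /(_ xy0) ->.
Qed.

(** The Jucys-Murphy recursion: the argument is S T_k with each tableau weighted by t to the content
    of its entry k + 1. It yields the eigenvalue of xi_k on constants from that of xi_(k+1). *)
Lemma tv_ct S k : (k < n)%N ->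
  tv k ((phi (cdiff S k) * t ^ ct S k.+1) *: tab S
        + (psi (cdiff S k) * t ^ ct S k) *: tab (stab S k)) = (t * t ^ ct S k) *: tab S.
Proof.
move=> kn; have b0 := cdiff_neq0 S kn; have H := psi_tv_stab S kn.
have cE : t ^ ct S k = t ^ ct S k.+1 * t ^ cdiff S k by rewrite -expfzDr // /cdiff addrC subrK.
rewrite tvD [psi _ * _]mulrC -(scalerA (t ^ ct S k)) !tvZ H tv_tab // cE.
move: b0 => {H cE}; set b := cdiff S k => b0.
have E1 : phi b ^+ 2 + psi b * psi (- b) * t ^ b = t * t ^ b.
  rewrite psi_mul // /phi /psi2 tX tY; have X1 := tb1 b0.
  by field; rewrite ?mulN1r ?X1 ?t0.
have E0 : phi b + phi (- b) * t ^ b = 0.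
  rewrite phiN // /phi; have X1 := tb1 b0.
  have X2 : 1 - t ^ b != 0 by rewrite -opprB oppr_eq0.
  by field; rewrite ?mulN1r ?X1 ?X2.
apply/ffunP => U; rewrite !ffunE; set p := _%:R; set p1 := _%:R; set c1 := t ^ ct S k.+1.
transitivity (c1 * (phi b ^+ 2 + psi b * psi (- b) * t ^ b) * p
  + c1 * psi b * (phi b + phi (- b) * t ^ b) * p1).
  by rewrite /GRing.scale /=; ring.
by rewrite E1 E0 /GRing.scale /=; ring.
Qed.

Lemma tv_hecke : hecke_rels n t (fun k => tv k : {linear V -> V}).
Proof. by split=> *; [exact: tv_quad | exact: tv_braid | exact: tv_comm]. Qed.

End TabHecke.

(** * The Hecke algebra on polynomials *)

Section PolyIdentities.
(* [iota] evaluates in a field in which the differences of variables are invertible;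
   [s1], [s2] exchange the first two, resp. the last two, of the variables [a b c]. *)
Variables (P : Type) (E : fieldType) (iota : P -> E) (s1 s2 A1 A2 : P -> P).
Variables (t a b c : E).
Hypotheses (ab : a - b != 0) (bc : b - c != 0) (ac : a - c != 0).
Hypotheses (s11 : involutive s1) (s22 : involutive s2)
  (s121 : forall r, s2 (s1 (s2 r)) = s1 (s2 (s1 r))).
Hypotheses
  (iA1 : forall r, iota (A1 r) = (1 - t) * b * (iota r - iota (s1 r)) / (a - b))
  (iA2 : forall r, iota (A2 r) = (1 - t) * c * (iota r - iota (s2 r)) / (b - c))
  (i1A1 : forall r, iota (s1 (A1 r)) = (1 - t) * a * (iota (s1 r) - iota r) / (b - a))
  (i2A2 : forall r, iota (s2 (A2 r)) = (1 - t) * b * (iota (s2 r) - iota r) / (c - b))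
  (i1A2 : forall r, iota (s1 (A2 r)) =
     (1 - t) * c * (iota (s1 r) - iota (s1 (s2 r))) / (a - c))
  (i2A1 : forall r, iota (s2 (A1 r)) =
     (1 - t) * c * (iota (s2 r) - iota (s2 (s1 r))) / (a - c))
  (i12A1 : forall r, iota (s1 (s2 (A1 r))) =
     (1 - t) * c * (iota (s1 (s2 r)) - iota (s1 (s2 (s1 r)))) / (b - c))
  (i21A2 : forall r, iota (s2 (s1 (A2 r))) =
     (1 - t) * b * (iota (s2 (s1 r)) - iota (s1 (s2 (s1 r)))) / (a - b)).

Let ba : b - a != 0. Proof. by rewrite -opprB oppr_eq0. Qed.
Let cb : c - b != 0. Proof. by rewrite -opprB oppr_eq0. Qed.

Lemma quad_AA p : iota (A1 (A1 p)) = (t - 1) * iota (A1 p).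
Proof. by rewrite iA1 i1A1 iA1; field; rewrite ?ab ?ba. Qed.

Lemma quad_As p :
  iota (A1 (s1 p)) + iota (s1 (A1 p)) + (t - 1) * iota p = (t - 1) * iota (s1 p).
Proof. by rewrite iA1 i1A1 s11; field; rewrite ?ab ?ba. Qed.

Lemma braid_1 p : iota (A1 (A2 (A1 p))) + t * iota (s1 (A2 (s1 p))) =
  iota (A2 (A1 (A2 p))) + t * iota (s2 (A1 (s2 p))).
Proof.
rewrite !(iA1, iA2, i1A1, i2A2, i1A2, i2A1, i12A1, i21A2, s11, s22) s121.
by field; rewrite ?ab ?ba ?bc ?cb ?ac.
Qed.

Lemma braid_s1 p : iota (s1 (A2 (A1 p))) + iota (A1 (A2 (s1 p)))
  + (t - 1) * iota (s1 (A2 (s1 p))) = iota (A2 (s1 (A2 p))).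
Proof.
rewrite !(iA1, iA2, i1A1, i2A2, i1A2, i2A1, i12A1, i21A2, s11, s22).
by field; rewrite ?ab ?ba ?bc ?cb ?ac.
Qed.

Lemma braid_s2 p : iota (s2 (A1 (A2 p))) + iota (A2 (A1 (s2 p)))
  + (t - 1) * iota (s2 (A1 (s2 p))) = iota (A1 (s2 (A1 p))).
Proof.
rewrite !(iA1, iA2, i1A1, i2A2, i1A2, i2A1, i12A1, i21A2, s11, s22) ?s121.
by field; rewrite ?ab ?ba ?bc ?cb ?ac.
Qed.

Lemma braid_s12 p : iota (s1 (s2 (A1 p))) = iota (A2 (s1 (s2 p))).
Proof. by rewrite i12A1 iA2 s121. Qed.

Lemma braid_s21 p : iota (A1 (s2 (s1 p))) = iota (s2 (s1 (A2 p))).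
Proof. by rewrite i21A2 iA1. Qed.

End PolyIdentities.

(** * Divided differences of polynomials *)

Section LinearExtension.
Variables (K : fieldType) (N : nat).
Implicit Types p : {mpoly K[N]}.

(** Operators given by their values on monomials, so that homogeneity and compatibility with
    specialization can be checked on monomials. *)
Definition lext (f : 'X_{1..N} -> {mpoly K[N]}) p : {mpoly K[N]} :=
  \sum_(m <- msupp p) p@_m *: f m.

Lemma lextE f p d : (msize p <= d)%N ->
  lext f p = \sum_(m : 'X_{1..N < d}) p@_m *: f m.
Proof.
move=> pd; set I : subFinType _ := 'X_{1..N < d}.
rewrite /lext (big_mksub I) ?msupp_uniq //=; first last.
  by move=> m /msize_mdeg_lt /leq_trans; apply.
by rewrite big_rmcond //= => m /memN_msupp_eq0 ->; rewrite scale0r.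
Qed.

Fact lext_linear f : linear (lext f).
Proof.
move=> a p r; pose d := maxn (msize (a *: p + r)) (maxn (msize p) (msize r)).
rewrite !(@lextE _ _ d) ?leq_max ?leqnn ?orbT // scaler_sumr -big_split.
by apply: eq_bigr => m _; rewrite mcoeffD mcoeffZ scalerDl scalerA.
Qed.
HB.instance Definition _ f :=
  GRing.isLinear.Build K {mpoly K[N]} {mpoly K[N]} *:%R (lext f) (lext_linear f).

Lemma lextX f m : lext f 'X_[m] = f m.
Proof. by rewrite /lext msuppX big_seq1 mcoeffX eqxx scale1r. Qed.

Lemma linear_lext (f : {linear {mpoly K[N]} -> {mpoly K[N]}}) p :
  f p = lext (fun m => f 'X_[m]) p.
Proof. by rewrite {1}[p]mpolyE linear_sum; apply: eq_bigr => m _; rewrite linearZ. Qed.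

Lemma mpoly_rmorph_eq (f g : {lrmorphism {mpoly K[N]} -> {mpoly K[N]}}) :
  (forall i, f 'X_i = g 'X_i) -> f =1 g.
Proof.
move=> fg p; rewrite [p]mpolyE !linear_sum; apply: eq_bigr => m _; rewrite !linearZ /=.
by congr (_ *: _); rewrite mpolyXE_id !rmorph_prod; apply: eq_bigr => i _;
  rewrite !rmorphXn /= fg.
Qed.

End LinearExtension.

Section DividedDifference.
Variables (K : fieldType) (N : nat).
Implicit Types (i j : 'I_N) (m : 'X_{1..N}) (p : {mpoly K[N]}).

Definition mnm_drop i j m : 'X_{1..N} :=
  [multinom if (k == i) || (k == j) then 0%N else m k | k < N].

(* [('X_i ^+ a - 'X_j ^+ a) / ('X_i - 'X_j)] *)
Definition dpow i j a : {mpoly K[N]} := \sum_(k < a) 'X_i ^+ (a.-1 - k) * 'X_j ^+ k.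

(** The divided difference of a monomial: a common power of x_i x_j splits off and a geometric sum
    remains. The explicit form contains neither q nor t, unlike the chosen quotient [mquot] it
    exhibits linearity and degree. *)
Definition dmon i j m : {mpoly K[N]} :=
  'X_[mnm_drop i j m] * (if (m j <= m i)%N
    then ('X_i * 'X_j) ^+ (m j) * dpow i j (m i - m j)
    else - (('X_i * 'X_j) ^+ (m i) * dpow i j (m j - m i))).

Definition dd i j : {mpoly K[N]} -> {mpoly K[N]} := lext (dmon i j).
HB.instance Definition _ i j := GRing.Linear.on (dd i j).

Lemma mpolyX_drop i j m : i != j ->
  'X_[m] = 'X_[mnm_drop i j m] * 'X_i ^+ m i * 'X_j ^+ m j :> {mpoly K[N]}.
Proof.
move=> ij; rewrite !mpolyXn -!mpolyXD; congr mpolyX; apply/mnmP => k.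
rewrite !mnmDE !mulmnE !mnm1E mnmE.
have ji : (j == i) = false by rewrite eq_sym (negPf ij).
have [->|ki] := eqVneq k i; first by rewrite ji /= mul1n mul0n addn0.
have [->|kj] := eqVneq k j; first by rewrite /= mul0n mul1n.
by rewrite /= !mul0n !addn0.
Qed.

Lemma msymXi (s : 'S_N) i : msym s 'X_i = 'X_(s i) :> {mpoly K[N]}.
Proof.
rewrite msymX; congr mpolyX; apply/mnmP => k; rewrite mnmE !mnm1E.
by rewrite -(inj_eq (@perm_inj _ s) i) permKV.
Qed.

Lemma msym_drop i j m :
  msym (tperm i j) 'X_[mnm_drop i j m] = 'X_[mnm_drop i j m] :> {mpoly K[N]}.
Proof.
rewrite msymX tpermV; congr mpolyX; apply/mnmP => k; rewrite !mnmE.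
by case: tpermP => [->|->|/eqP/negPf-> /eqP/negPf->]; rewrite ?eqxx ?orbT.
Qed.

Lemma dmonE i j m : i != j ->
  ('X_i - 'X_j) * dmon i j m = 'X_[m] - msym (tperm i j) 'X_[m].
Proof.
move=> ij; rewrite (mpolyX_drop m ij) !rmorphM !rmorphXn /= msym_drop !msymXi.
rewrite tpermL tpermR /dmon; set x := 'X_i; set y := 'X_j; set z := 'X_[_].
have H a : (x - y) * dpow i j a = x ^+ a - y ^+ a by rewrite subrXX.
case: leqP => mji.
  have E u : u ^+ m i = u ^+ (m i - m j) * u ^+ m j :> {mpoly K[N]} by rewrite -exprD subnK.
  transitivity (z * (x * y) ^+ m j * ((x - y) * dpow i j (m i - m j))); first by ring.
  by rewrite H exprMn !E; ring.
have E u : u ^+ m j = u ^+ (m j - m i) * u ^+ m i :> {mpoly K[N]}.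
  by rewrite -exprD subnK // ltnW.
transitivity (- (z * (x * y) ^+ m i * ((x - y) * dpow i j (m j - m i)))); first by ring.
by rewrite H exprMn !E; ring.
Qed.

Lemma ddE i j p : i != j -> ('X_i - 'X_j) * dd i j p = p - msym (tperm i j) p.
Proof.
move=> ij.
have -> : p - msym (tperm i j) p =
    \sum_(m <- msupp p) p@_m *: ('X_[m] - msym (tperm i j) 'X_[m]).
  under eq_bigr do rewrite scalerBr -msymZ.
  by rewrite sumrB -mpolyE -(raddf_sum (msym (tperm i j))) -mpolyE.
rewrite /dd mulr_sumr; apply: eq_bigr => m _.
by rewrite -scalerAr dmonE.
Qed.

Lemma subX_neq0 i j : i != j -> 'X_i - 'X_j != 0 :> {mpoly K[N]}.
Proof.
move=> ij; apply/eqP => /(congr1 (mcoeff U_(i))).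
by rewrite mcoeffB !mcoeffXU eqxx eq_sym (negPf ij) subr0 mcoeff0 => /eqP; rewrite oner_eq0.
Qed.

Lemma dd_unique i j p r : i != j -> ('X_i - 'X_j) * r = p - msym (tperm i j) p ->
  r = dd i j p.
Proof. by move=> ij rE; apply: (mulfI (subX_neq0 ij)); rewrite rE ddE. Qed.

Lemma mquot_dd i j p : i != j ->
  mquot (p - msym (tperm i j) p) ('X_i - 'X_j) = dd i j p.
Proof.
move=> ij; rewrite /mquot; case: xgetP => [r _ /= rE | /(_ (dd i j p)) /=].
  by apply: dd_unique => //; rewrite mulrC.
by rewrite mulrC ddE.
Qed.

End DividedDifference.

Section FieldIdentities.
Variables (E : fieldType) (a b c d u y1 y2 y3 y4 : E).
Hypothesis ab : a - b != 0.

Lemma Aop_field : (1 - u) * (b * c) = (1 - u) * b * ((a - b) * c) / (a - b).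
Proof. by field; rewrite ?ab. Qed.

Lemma Aop_field_comm : c - d != 0 ->
  (1 - u) * b * ((1 - u) * d * (y1 - y2) / (c - d)
    - (1 - u) * d * (y3 - y4) / (c - d)) / (a - b) =
  (1 - u) * d * ((1 - u) * b * (y1 - y3) / (a - b)
    - (1 - u) * b * (y2 - y4) / (a - b)) / (c - d).
Proof. by move=> cd; field; rewrite ?ab ?cd. Qed.

Lemma Aop_field_X : (1 - u) * b * (b * y1 - a * y2) / (a - b) + (1 - u) * (b * y1) =
  a * ((1 - u) * b * (y1 - y2) / (a - b)).
Proof. by field; rewrite ?ab. Qed.

Lemma Aop_field_far : (1 - u) * b * (c * y1 - c * y2) / (a - b) =
  c * ((1 - u) * b * (y1 - y2) / (a - b)).
Proof. by field; rewrite ?ab. Qed.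

End FieldIdentities.

Section PolyOperators.
Variables (K : fieldType) (N : nat) (t : K).
Implicit Types (i j k l : 'I_N) (p r : {mpoly K[N]}).

Definition Aop i j p : {mpoly K[N]} := (1 - t) *: ('X_j * dd i j p).

Fact Aop_linear i j : linear (Aop i j).
Proof.
move=> a p r; rewrite /Aop linearP mulrDr scalerDr -scalerAr !scalerA.
by rewrite [(1 - t) * a]mulrC.
Qed.
HB.instance Definition _ i j :=
  GRing.isLinear.Build K {mpoly K[N]} {mpoly K[N]} *:%R (Aop i j) (Aop_linear i j).

Local Notation iota := (@FracField.tofrac {mpoly K[N]}).
Let t' := iota (t%:MP).

Let iotaZ a p : iota (a *: p) = iota a%:MP * iota p.
Proof. by rewrite -mul_mpolyC rmorphM. Qed.

Let iota_inj : injective iota.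
Proof. by move=> p r /eqP; rewrite tofrac_eq => /eqP. Qed.

Let iota1t : iota (1 - t)%:MP = 1 - t'.
Proof. by rewrite mpolyCB rmorphB mpolyC1 rmorph1. Qed.

Let iotat1 : iota (t - 1)%:MP = t' - 1.
Proof. by rewrite mpolyCB rmorphB mpolyC1 rmorph1. Qed.

Let Xneq i j : i != j -> iota 'X_i - iota 'X_j != 0.
Proof. by move=> ij; rewrite -rmorphB tofrac_eq0 subX_neq0. Qed.

(** In the field of fractions the divided difference is a true quotient, and permuting variables
    acts on numerator and denominator. All relations between these operators become identities of
    rational functions. *)
Let iotaA (s : 'S_N) i j p : i != j -> iota (msym s (Aop i j p)) =
  (1 - t') * iota 'X_(s j) * (iota (msym s p) - iota (msym s (msym (tperm i j) p)))
  / (iota 'X_(s i) - iota 'X_(s j)).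
Proof.
move=> ij; have sij : s i != s j by rewrite (inj_eq perm_inj).
have -> : iota (msym s p) - iota (msym s (msym (tperm i j) p)) =
    (iota 'X_(s i) - iota 'X_(s j)) * iota (msym s (dd i j p)).
  by rewrite -tofracB -msymB -ddE // msymM msymB !msymXi tofracM tofracB.
rewrite /Aop msymZ iotaZ msymM msymXi tofracM iota1t; have := Xneq sij.
exact: Aop_field.
Qed.

Let iotaA1 i j p : i != j -> iota (Aop i j p) =
  (1 - t') * iota 'X_j * (iota p - iota (msym (tperm i j) p)) / (iota 'X_i - iota 'X_j).
Proof. by move=> ij; have := iotaA 1 p ij; rewrite !msym1m !perm1. Qed.

Lemma msym_tpermK i j : involutive (msym (R := K) (tperm i j)).
Proof. by move=> p; rewrite -msymMm tperm2 msym1m. Qed.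

Let iotaAs i j p : i != j -> iota (msym (tperm i j) (Aop i j p)) =
  (1 - t') * iota 'X_i * (iota (msym (tperm i j) p) - iota p) / (iota 'X_j - iota 'X_i).
Proof. by move=> ij; rewrite iotaA // msym_tpermK tpermL tpermR. Qed.

Lemma Aop_quad i j p : i != j -> Aop i j (Aop i j p) = (t - 1) *: Aop i j p.
Proof.
move=> ij; apply: iota_inj; rewrite [RHS]iotaZ iotat1.
exact: (quad_AA (iota := iota) (s1 := msym (tperm i j)) (A1 := Aop i j)
  (Xneq ij) (fun r => iotaA1 r ij) (fun r => iotaAs r ij)).
Qed.

Lemma Aop_sym i j p : i != j ->
  Aop i j (msym (tperm i j) p) + msym (tperm i j) (Aop i j p) + (t - 1) *: p =
  (t - 1) *: msym (tperm i j) p.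
Proof.
move=> ij; apply: iota_inj; rewrite !tofracD !(iotaZ (t - 1)) iotat1.
exact: (quad_As (iota := iota) (s1 := msym (tperm i j)) (A1 := Aop i j)
  (Xneq ij) (@msym_tpermK i j) (fun r => iotaA1 r ij) (fun r => iotaAs r ij)).
Qed.

Lemma Aop_msym (s : 'S_N) i j p : i != j -> msym s (Aop i j p) = Aop (s i) (s j) (msym s p).
Proof.
move=> ij; have sij : s i != s j by rewrite (inj_eq perm_inj).
apply: iota_inj; rewrite (iotaA s p ij) (iotaA1 (msym s p) sij).
have -> : msym s (msym (tperm i j) p) = msym (tperm (s i) (s j)) (msym s p).
  by rewrite -!msymMm -tpermJ -conjgC.
reflexivity.
Qed.

Lemma Aop_comm i j k l p : i != j -> k != l -> i != k -> i != l -> j != k -> j != l ->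
  Aop i j (Aop k l p) = Aop k l (Aop i j p).
Proof.
move=> ij kl ik il jk jl.
have ki : k != i by rewrite eq_sym. have li : l != i by rewrite eq_sym.
have kj : k != j by rewrite eq_sym. have lj : l != j by rewrite eq_sym.
apply: iota_inj; rewrite (iotaA1 _ ij) (iotaA1 _ kl) (Aop_msym _ _ kl).
rewrite (tpermD ik jk) (tpermD il jl) (iotaA1 _ kl) (iotaA1 (Aop i j p) kl).
rewrite (iotaA1 _ ij) (Aop_msym _ _ ij) (tpermD ki li) (tpermD kj lj) (iotaA1 _ ij).
have -> : msym (tperm i j) (msym (tperm k l) p) = msym (tperm k l) (msym (tperm i j) p).
  rewrite -!msymMm; congr (msym _ p).
  by rewrite conjgC tpermJ (tpermD ik jk) (tpermD il jl).
exact: (Aop_field_comm _ _ _ _ _ (Xneq ij) (Xneq kl)).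
Qed.

Section Braid.
Variables (i j k : 'I_N).
Hypotheses (ij : i != j) (jk : j != k) (ik : i != k).
Local Notation s1 := (msym (R := K) (tperm i j)).
Local Notation s2 := (msym (R := K) (tperm j k)).
Local Notation A1 := (Aop i j).
Local Notation A2 := (Aop j k).

Lemma msym_braid p : s2 (s1 (s2 p)) = s1 (s2 (s1 p)).
Proof. by rewrite -!msymMm ?mulgA -tperm_braid. Qed.

Let tl : tperm j k i = i. Proof. by rewrite tpermD // eq_sym. Qed.
Let tr : tperm i j k = k. Proof. by rewrite tpermD. Qed.

Let i1A2 r : iota (s1 (A2 r)) =
  (1 - t') * iota 'X_k * (iota (s1 r) - iota (s1 (s2 r))) / (iota 'X_i - iota 'X_k).
Proof. by rewrite iotaA // tpermR tr. Qed.

Let i2A1 r : iota (s2 (A1 r)) =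
  (1 - t') * iota 'X_k * (iota (s2 r) - iota (s2 (s1 r))) / (iota 'X_i - iota 'X_k).
Proof. by rewrite iotaA // tpermL tl. Qed.

Let i12A1 r : iota (s1 (s2 (A1 r))) = (1 - t') * iota 'X_k *
  (iota (s1 (s2 r)) - iota (s1 (s2 (s1 r)))) / (iota 'X_j - iota 'X_k).
Proof. by rewrite -msymMm iotaA // !permM tpermL tl tpermL tr -!msymMm mulgA. Qed.

Let i21A2 r : iota (s2 (s1 (A2 r))) = (1 - t') * iota 'X_j *
  (iota (s2 (s1 r)) - iota (s1 (s2 (s1 r)))) / (iota 'X_i - iota 'X_j).
Proof.
by rewrite -msym_braid -msymMm iotaA // !permM tpermR tl tr tpermR -!msymMm mulgA.
Qed.

Lemma Aop_braid p : A1 (A2 (A1 p)) + t *: s1 (A2 (s1 p))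
  = A2 (A1 (A2 p)) + t *: s2 (A1 (s2 p)).
Proof.
apply: iota_inj; rewrite (tofracD _ (t *: s1 (A2 (s1 p)))) (tofracD _ (t *: s2 (A1 (s2 p)))).
rewrite (iotaZ t (s1 (A2 (s1 p)))) (iotaZ t (s2 (A1 (s2 p)))).
exact: (braid_1 (iota := iota) (s1 := s1) (s2 := s2) (A1 := A1) (A2 := A2)
  (Xneq ij) (Xneq jk) (Xneq ik) (@msym_tpermK i j) (@msym_tpermK j k)
  msym_braid (fun r => iotaA1 r ij) (fun r => iotaA1 r jk)
  (fun r => iotaAs r ij) (fun r => iotaAs r jk) i1A2 i2A1 i12A1 i21A2).
Qed.

Lemma Aop_braid_s1 p : s1 (A2 (A1 p)) + A1 (A2 (s1 p)) + (t - 1) *: s1 (A2 (s1 p))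
  = A2 (s1 (A2 p)).
Proof.
apply: iota_inj; rewrite !tofracD !(iotaZ (t - 1)) iotat1.
exact: (braid_s1 (iota := iota) (s1 := s1) (s2 := s2) (A1 := A1) (A2 := A2)
  (Xneq ij) (Xneq jk) (Xneq ik) (@msym_tpermK i j) (fun r => iotaA1 r ij)
  (fun r => iotaA1 r jk) (fun r => iotaAs r ij) i1A2 i12A1 i21A2).
Qed.

Lemma Aop_braid_s2 p : s2 (A1 (A2 p)) + A2 (A1 (s2 p)) + (t - 1) *: s2 (A1 (s2 p))
  = A1 (s2 (A1 p)).
Proof.
apply: iota_inj; rewrite !tofracD !(iotaZ (t - 1)) iotat1.
exact: (braid_s2 (iota := iota) (s1 := s1) (s2 := s2) (A1 := A1) (A2 := A2)
  (Xneq ij) (Xneq jk) (Xneq ik) (@msym_tpermK j k) msym_braid (fun r => iotaA1 r ij)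
  (fun r => iotaA1 r jk) (fun r => iotaAs r jk) i2A1 i12A1 i21A2).
Qed.

Lemma Aop_braid_s12 p : s1 (s2 (A1 p)) = A2 (s1 (s2 p)).
Proof. by apply: iota_inj; exact: (braid_s12 (iota := iota) (s1 := s1) (s2 := s2) (A1 := A1) (A2 := A2)
  msym_braid (fun r => iotaA1 r jk) i12A1). Qed.

Lemma Aop_braid_s21 p : A1 (s2 (s1 p)) = s2 (s1 (A2 p)).
Proof. by apply: iota_inj; exact: (braid_s21 (iota := iota) (s1 := s1) (s2 := s2) (A1 := A1) (A2 := A2)
  (fun r => iotaA1 r ij) i21A2). Qed.

End Braid.

Lemma Aop_X i j p : i != j ->
  Aop i j ('X_j * p) + (1 - t) *: ('X_j * p) = 'X_i * Aop i j p.
Proof.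
move=> ij; apply: iota_inj.
rewrite tofracD (iotaZ _ ('X_j * p)) iota1t (iotaA1 _ ij) msymM msymXi tpermR !tofracM (iotaA1 _ ij).
exact: (Aop_field_X _ _ _ (Xneq ij)).
Qed.

Lemma Aop_X_far i j k p : i != j -> k != i -> k != j -> Aop i j ('X_k * p) = 'X_k * Aop i j p.
Proof.
move=> ij ki kj; have ik : i != k by rewrite eq_sym.
have jk : j != k by rewrite eq_sym.
apply: iota_inj; rewrite tofracM !(iotaA1 _ ij) msymM msymXi (tpermD ik jk) !tofracM.
exact: (Aop_field_far _ _ _ _ (Xneq ij)).
Qed.

(* If [sigma] maps the pair of variables ['X_i], ['X_j] to a common multiple of
   ['X_k], ['X_l], it intertwines the corresponding operators. *)
Lemma Aop_subst (sigma : {lrmorphism {mpoly K[N]} -> {mpoly K[N]}}) (c : K) i j k l p :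
  i != j -> k != l -> sigma 'X_i = c *: 'X_k -> sigma 'X_j = c *: 'X_l ->
  sigma (msym (tperm i j) p) = msym (tperm k l) (sigma p) ->
  sigma (Aop i j p) = Aop k l (sigma p).
Proof.
move=> ij kl si sj ss; rewrite /Aop (linZ sigma) rmorphM /= sj -scalerAl scalerAr.
congr (_ *: (_ * _)); apply: dd_unique => //.
transitivity (sigma (p - msym (tperm i j) p)); last by rewrite linearB /= ss.
by rewrite -ddE // rmorphM rmorphB /= si sj -scalerBr -scalerAl scalerAr.
Qed.

End PolyOperators.

(** * The polynomial module *)

Section TensorOperators.
Variables (K : fieldType) (n : nat) (tau : seq nat).
Local Notation N := n.+1.
Local Notation V := (tabspace K N tau).
Local Notation P := (polytab K N tau).
Local Notation mp := {mpoly K[N]}.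
Local Notation tab := (@tab K N tau).
Implicit Types (v : V) (p : mp) (F : P) (S : rsyt N tau).

Lemma tensDl p p' v : tens (p + p') v = tens p v + tens p' v.
Proof. by apply/ffunP => S; rewrite !ffunE scalerDr. Qed.

Lemma tensZl a p v : tens (a *: p) v = a *: tens p v.
Proof. by apply/ffunP => S; rewrite !ffunE !scalerA mulrC. Qed.

Lemma tensDr p v v' : tens p (v + v') = tens p v + tens p v'.
Proof. by apply/ffunP => S; rewrite !ffunE scalerDl. Qed.

Lemma tensZr a p v : tens p (a *: v) = a *: tens p v.
Proof. by apply/ffunP => S; rewrite !ffunE scalerA. Qed.

Lemma tens_sumr I (r : seq I) (G : I -> V) p :
  tens p (\sum_(i <- r) G i) = \sum_(i <- r) tens p (G i).
Proof.
elim: r => [|i r IH]; last by rewrite !big_cons tensDr IH.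
by rewrite !big_nil; apply/ffunP => S; rewrite !ffunE scale0r.
Qed.

Lemma tens_sum F : F = \sum_S tens (F S) (tab S).
Proof.
apply/ffunP => U; rewrite sum_ffunE (bigD1 U) //= !ffunE eqxx scale1r.
by rewrite big1 ?addr0 // => S SU; rewrite !ffunE eq_sym (negPf SU) scale0r.
Qed.

(* The operator [f (x) g]. *)
Definition opP (f : mp -> mp) (g : V -> V) F : P := \sum_S tens (f (F S)) (g (tab S)).

Fact opP_linear (f : {linear mp -> mp}) (g : V -> V) : linear (opP f g).
Proof.
move=> a F G; rewrite /opP scaler_sumr -big_split; apply: eq_bigr => S _.
by rewrite !ffunE linearP tensDl tensZl.
Qed.
HB.instance Definition _ (f : {linear mp -> mp}) (g : V -> V) :=
  GRing.isLinear.Build K P P *:%R (opP f g) (opP_linear f g).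

Lemma opP_tens (f : {linear mp -> mp}) (g : {linear V -> V}) p v :
  opP f g (tens p v) = tens (f p) (g v).
Proof.
rewrite [in RHS](tab_sum v) linear_sum tens_sumr; apply: eq_bigr => S _.
by rewrite ffunE (linZ f) (linZ g) tensZl tensZr.
Qed.

Lemma linear_tens (f g : {linear P -> P}) :
  (forall p v, f (tens p v) = g (tens p v)) -> f =1 g.
Proof.
by move=> fg F; rewrite [F]tens_sum !linear_sum; apply: eq_bigr => S _; rewrite fg.
Qed.

End TensorOperators.

Lemma braid_sum (V : zmodType) (a0 b1 m2 d e1 k1 k0 g h a0' b2 m1 e2 k2 k0' : V) :
  a0 + k0 = a0' + k0' -> b1 + e1 + k1 = m1 -> b2 + e2 + k2 = m2 ->
  a0 + b1 + (m2 + d) + (e1 + (k1 + k0) + (g + h)) =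
  a0' + b2 + (m1 + g) + (e2 + (k2 + k0') + (d + h)).
Proof.
move=> H <- <-; rewrite !addrA.
rewrite [LHS](ACl ((1*9)*2*3*4*5*6*7*8*10*11)) /= H.
by rewrite [RHS](ACl ((1*9)*3*2*7*8*10*4*5*6*11)).
Qed.

Section AbstractTensor.
Variables (K : fieldType) (M V P : lmodType K) (B : M -> V -> P) (t : K).
Hypotheses (BDl : forall p p' v, B (p + p') v = B p v + B p' v)
  (BZl : forall a p v, B (a *: p) v = a *: B p v)
  (BDr : forall p v v', B p (v + v') = B p v + B p v')
  (BZr : forall a p v, B p (a *: v) = a *: B p v).
Variables (A1 A2 s1 s2 : M -> M) (f1 f2 : V -> V) (T1 T2 : P -> P).
Hypotheses (T1D : {morph T1 : F G / F + G}) (T2D : {morph T2 : F G / F + G})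
  (T1B : forall p v, T1 (B p v) = B (A1 p) v + B (s1 p) (f1 v))
  (T2B : forall p v, T2 (B p v) = B (A2 p) v + B (s2 p) (f2 v)).

Lemma tensor_quad p v : f1 (f1 v) = (t - 1) *: f1 v + t *: v ->
  A1 (A1 p) = (t - 1) *: A1 p -> s1 (s1 p) = p ->
  A1 (s1 p) + s1 (A1 p) + (t - 1) *: p = (t - 1) *: s1 p ->
  T1 (T1 (B p v)) = (t - 1) *: T1 (B p v) + t *: B p v.
Proof.
move=> ff AA ss As; rewrite T1B T1D !T1B ff AA ss BDr !BZr BZl scalerDr -!addrA.
congr (_ + _); rewrite addrA addrA; congr (_ + _).
by rewrite -BZl -!BDl -BZl [s1 _ + _]addrC As.
Qed.

Lemma tensor_comm p v : f1 (f2 v) = f2 (f1 v) -> A1 (A2 p) = A2 (A1 p) ->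
  A1 (s2 p) = s2 (A1 p) -> s1 (A2 p) = A2 (s1 p) -> s1 (s2 p) = s2 (s1 p) ->
  T1 (T2 (B p v)) = T2 (T1 (B p v)).
Proof.
by move=> ff AA As sA ss; rewrite T2B T1B T1D T2D !T1B !T2B ff AA As sA ss addrACA.
Qed.

(** Expand T = A (x) 1 + s (x) f and collect the terms by words in f1 and f2. The relation f^2 = (t
    - 1) f + t sends the terms with a repeated f to the words of length 1 and 0, which is the origin
    of the factors t - 1 and t in the last three hypotheses. *)
Lemma tensor_braid p v : f1 (f1 v) = (t - 1) *: f1 v + t *: v ->
  f2 (f2 v) = (t - 1) *: f2 v + t *: v -> f1 (f2 (f1 v)) = f2 (f1 (f2 v)) ->
  s1 (s2 (s1 p)) = s2 (s1 (s2 p)) -> s1 (s2 (A1 p)) = A2 (s1 (s2 p)) ->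
  A1 (s2 (s1 p)) = s2 (s1 (A2 p)) ->
  A1 (A2 (A1 p)) + t *: s1 (A2 (s1 p)) = A2 (A1 (A2 p)) + t *: s2 (A1 (s2 p)) ->
  s1 (A2 (A1 p)) + A1 (A2 (s1 p)) + (t - 1) *: s1 (A2 (s1 p)) = A2 (s1 (A2 p)) ->
  s2 (A1 (A2 p)) + A2 (A1 (s2 p)) + (t - 1) *: s2 (A1 (s2 p)) = A1 (s2 (A1 p)) ->
  T1 (T2 (T1 (B p v))) = T2 (T1 (T2 (B p v))).
Proof.
move=> q1 q2 fff sss ssA Ass br br1 br2; rewrite T1B T2D !T2B !T1D !T1B.
rewrite !T2D !T2B q1 q2 fff sss ssA Ass !BDr !BZr.
by apply: braid_sum; rewrite -!BZl -!BDl ?br ?br1 ?br2.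
Qed.

End AbstractTensor.

Section PolyDaha.
Variables (K : fieldType) (n : nat) (tau : seq nat) (q t : K).
Local Notation N := n.+1.
Hypothesis htau : is_partition N tau.
Hypotheses (n0 : (0 < n)%N) (q0 : q != 0) (t0 : t != 0)
  (tgen : forall b : int, b != 0 -> t ^ b != 1).
Local Notation V := (tabspace K N tau).
Local Notation P := (polytab K N tau).
Local Notation mp := {mpoly K[N]}.
Local Notation tab := (@tab K N tau).
Local Notation io := (@inord n).
Local Notation tv := (@tv K n tau t).
Implicit Types (v : V) (p : mp) (F : P) (S : rsyt N tau).

Definition Ak k : mp -> mp := Aop t (io k) (io k.+1).
Definition sk k : mp -> mp := msym (tperm (io k) (io k.+1)).
Definition mulX k p : mp := 'X_(io k) * p.
Definition wtup : N.-tuple mp :=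
  [tuple if j == 0%N :> nat then q *: 'X_(ord_pred j) else 'X_(ord_pred j) | j < N].
Definition sigma : mp -> mp := comp_mpoly wtup.

HB.instance Definition _ k := GRing.Linear.on (Ak k).
HB.instance Definition _ k := GRing.LRMorphism.on (sk k).
Fact mulX_linear k : linear (mulX k).
Proof. by move=> a p r; rewrite /mulX mulrDr -scalerAr. Qed.
HB.instance Definition _ k := GRing.isLinear.Build K mp mp *:%R (mulX k) (mulX_linear k).
HB.instance Definition _ := GRing.LRMorphism.on sigma.

Definition hT k F : P := opP (Ak k) idfun F + opP (sk k) (tv k) F.
Fact hT_linear k : linear (hT k).
Proof. by move=> a F G; rewrite /hT !linearP scalerDr addrACA. Qed.
HB.instance Definition _ k := GRing.isLinear.Build K P P *:%R (hT k) (hT_linear k).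

Definition delta : V -> V := Tup n (fun k => tv k : {linear V -> V}) n.
HB.instance Definition _ := GRing.Linear.on delta.
Definition hW : P -> P := opP sigma delta.
HB.instance Definition _ := GRing.Linear.on hW.
Definition hX k : P -> P := opP (mulX k) idfun.
HB.instance Definition _ k := GRing.Linear.on (hX k).

Lemma hT_tens k p v : hT k (tens p v) = tens (Ak k p) v + tens (sk k p) (tv k v).
Proof. by rewrite /hT !opP_tens. Qed.

Lemma hW_tens p v : hW (tens p v) = tens (sigma p) (delta v).
Proof. exact: opP_tens. Qed.

Lemma hX_tens k p v : hX k (tens p v) = tens (mulX k p) v.
Proof. exact: opP_tens. Qed.

Lemma hTD k F G : hT k (F + G) = hT k F + hT k G. Proof. exact: linearD. Qed.
Lemma hTZ k a F : hT k (a *: F) = a *: hT k F. Proof. exact: linearZ. Qed.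
Lemma hWD F G : hW (F + G) = hW F + hW G. Proof. exact: linearD. Qed.
Lemma hXD k F G : hX k (F + G) = hX k F + hX k G. Proof. exact: linearD. Qed.
Lemma hXZ k a F : hX k (a *: F) = a *: hX k F. Proof. exact: linearZ. Qed.

Let io_neq k l : (k <= n)%N -> (l <= n)%N -> k != l -> io k != io l.
Proof. exact: inord_neq. Qed.

Let ioS k : (k < n)%N -> io k != io k.+1.
Proof. by move=> kn; apply: io_neq; lia. Qed.

Lemma hT_quad k F : (k < n)%N -> hT k (hT k F) = (t - 1) *: hT k F + t *: F.
Proof.
move=> kn; apply: (linear_tens (f := hT k \o hT k)
  (g := ((t - 1) \*: hT k) \+ (t \*: (idfun : P -> P)))) => p v /=.
apply: (tensor_quad (@tensDl _ _ _) (@tensZl _ _ _) (@tensDr _ _ _) (@tensZr _ _ _)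
  (hTD k) (hT_tens k)).
- exact: (tv_quad htau t0 tgen v kn).
- apply: Aop_quad; exact: ioS.
- exact: msym_tpermK.
exact: (Aop_sym t p (ioS kn)).
Qed.

Lemma hT_braid k F : (k.+1 < n)%N ->
  hT k (hT k.+1 (hT k F)) = hT k.+1 (hT k (hT k.+1 F)).
Proof.
move=> kn; have kn' := ltnW kn.
have ac : io k != io k.+2 by apply: io_neq; lia.
have ab := ioS kn'; have bc := ioS kn.
apply: (linear_tens (f := hT k \o hT k.+1 \o hT k)
  (g := hT k.+1 \o hT k \o hT k.+1)) => p v /=.
apply: (tensor_braid (@tensDl _ _ _) (@tensZl _ _ _) (@tensDr _ _ _) (@tensZr _ _ _)
  (hTD k) (hTD k.+1) (hT_tens k) (hT_tens k.+1)).
- exact: (tv_quad htau t0 tgen v kn').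
- exact: (tv_quad htau t0 tgen v kn).
- exact: (tv_braid htau t0 tgen v kn).
- exact/esym/msym_braid.
- exact: Aop_braid_s12.
- exact: Aop_braid_s21.
- exact: Aop_braid.
- exact: Aop_braid_s1.
exact: Aop_braid_s2.
Qed.

Lemma hT_comm i j F : (i.+1 < j)%N -> (j < n)%N -> hT i (hT j F) = hT j (hT i F).
Proof.
move=> ij jn; have iN : (i < n)%N by lia.
have [ik il jk jl] : [/\ io i != io j, io i != io j.+1, io i.+1 != io j
  & io i.+1 != io j.+1] by split; apply: io_neq; lia.
have [ki li kj lj] : [/\ io j != io i, io j.+1 != io i, io j != io i.+1
  & io j.+1 != io i.+1] by split; rewrite eq_sym.
apply: (linear_tens (f := hT i \o hT j) (g := hT j \o hT i)) => p v /=.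
apply: (tensor_comm (hTD i) (hTD j) (hT_tens i) (hT_tens j)).
- exact: (hecke_comm (tv_hecke htau t0 tgen) v ij jn).
- by apply: Aop_comm => //; exact: ioS.
- by rewrite /Ak /sk Aop_msym ?ioS // (tpermD ki li) (tpermD kj lj).
- by rewrite /Ak /sk Aop_msym ?ioS // (tpermD ik jk) (tpermD il jl).
rewrite /sk -!msymMm; congr (msym _ p).
by rewrite conjgC tpermJ (tpermD ik jk) (tpermD il jl).
Qed.

Lemma hT_hecke : hecke_rels n t (fun k => hT k : {linear P -> P}).
Proof. by split=> *; [exact: hT_quad | exact: hT_braid | exact: hT_comm]. Qed.

Let cq (j : 'I_N) : K := if j == 0%N :> nat then q else 1.

Lemma sigmaX (j : 'I_N) : sigma 'X_j = cq j *: 'X_(ord_pred j).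
Proof.
rewrite /sigma comp_mpolyXU -tnth_nth tnth_mktuple /cq.
by case: ifP; rewrite ?scale1r.
Qed.

Let pred_io k : (k < n)%N -> ord_pred (io k.+1) = io k.
Proof.
move=> kn; apply: val_inj => /=; rewrite !inordK //; last lia.
have -> : ((k.+1 + N).-1 = k + N)%N by lia.
by rewrite modnDr modn_small //; lia.
Qed.

Let pred_io0 : ord_pred (io 0) = io n.
Proof. by apply: val_inj => /=; rewrite !inordK //= modn_small. Qed.

Lemma sigmaXS k : (k < n)%N -> sigma 'X_(io k.+1) = 'X_(io k).
Proof. by move=> kn; rewrite sigmaX pred_io // /cq inordK // scale1r. Qed.

Lemma sigmaX0 : sigma 'X_(io 0) = q *: 'X_(io n).
Proof. by rewrite sigmaX pred_io0 /cq inordK. Qed.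

Let predI : injective (@ord_pred N).
Proof. exact: ord_pred_inj. Qed.

Let tperm_pred (a b x : 'I_N) :
  ord_pred (tperm a b x) = tperm (ord_pred a) (ord_pred b) (ord_pred x).
Proof. by rewrite (inj_tperm _ _ _ predI). Qed.

Let cq_tperm (a b j : 'I_N) : a != 0%N :> nat -> b != 0%N :> nat ->
  cq (tperm a b j) = cq j.
Proof. by rewrite /cq => /negPf a0 /negPf b0; case: tpermP => [->|->|//]; rewrite a0 b0. Qed.

Lemma sigma_sk k p : (k.+1 < n)%N -> sigma (sk k.+1 p) = sk k (sigma p).
Proof.
move=> kn; have k1n := ltnW kn.
apply: (mpoly_rmorph_eq (f := sigma \o sk k.+1) (g := sk k \o sigma)) => j /=.
rewrite /sk msymXi !sigmaX msymZ msymXi tperm_pred !pred_io //.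
by rewrite cq_tperm ?inordK.
Qed.

Lemma sigma_Ak k p : (k.+1 < n)%N -> sigma (Ak k.+1 p) = Ak k (sigma p).
Proof.
move=> kn; have k1n := ltnW kn.
apply: (@Aop_subst _ _ t (sigma : {lrmorphism mp -> mp}) 1).
- exact: ioS.
- exact: ioS.
- by rewrite scale1r; exact: sigmaXS.
- by rewrite scale1r; exact: sigmaXS.
exact: sigma_sk.
Qed.

Let sigmaZ a p : sigma (a *: p) = a *: sigma p.
Proof. exact: linearZ. Qed.

Let sigma2X (j : 'I_N) : sigma (sigma 'X_j) =
  (cq j * cq (ord_pred j)) *: 'X_(ord_pred (ord_pred j)).
Proof. by rewrite sigmaX sigmaZ sigmaX scalerA. Qed.

(** One rotation gives the factor q to x_0 but not to x_1. After two rotations both have it, and the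
    pair (x_0, x_1) becomes q times (x_(n-1), x_n); this is why the wrap-around relation involves w
    twice. *)
Lemma sigma2_sk p : sigma (sigma (sk 0 p)) = sk n.-1 (sigma (sigma p)).
Proof.
apply: (mpoly_rmorph_eq (f := sigma \o sigma \o sk 0) (g := sk n.-1 \o sigma \o sigma)).
move=> j; rewrite -[LHS]/(sigma (sigma (sk 0 'X_j))) -[RHS]/(sk n.-1 (sigma (sigma 'X_j))).
rewrite /sk msymXi 2!sigma2X msymZ msymXi !tperm_pred pred_io // pred_io0 (prednK n0).
have predn : (n.-1 < n)%N by rewrite prednK.
have := pred_io predn; rewrite (prednK n0) => ->.
rewrite [tperm (io n) _]tpermC; congr (_ *: _).
have cn0 : cq (io n) = 1 by rewrite /cq inordK // eqn0Ngt n0.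
have c0 : cq (io 0) = q by rewrite /cq inordK.
have c1 : cq (io 1) = 1 by rewrite /cq inordK.
have i01 : io 0 != io 1 by apply: ioS.
have [->|j0] := eqVneq j (io 0); first by rewrite !tpermL pred_io0 c0 c1 cn0 tpermR c0 mulrC.
have [->|j1] := eqVneq j (io 1).
  by rewrite !tpermR pred_io // tpermL c0 c1 cn0 mulrC.
rewrite (tpermD (z := j)) 1?eq_sym // tpermD //.
  by rewrite -(pred_io n0) (inj_eq predI) eq_sym.
by rewrite -pred_io0 (inj_eq predI) eq_sym.
Qed.

Lemma sigma2_Ak p : sigma (sigma (Ak 0 p)) = Ak n.-1 (sigma (sigma p)).
Proof.
have nE := prednK n0.
rewrite /Ak nE; apply: (@Aop_subst _ _ t (sigma \o sigma : {lrmorphism mp -> mp}) q).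
- exact: ioS.
- by apply: io_neq; lia.
- rewrite -[LHS]/(sigma (sigma 'X_(io 0))) sigmaX0 sigmaZ.
  have predn : (n.-1 < n)%N by rewrite nE.
  by have := sigmaXS predn; rewrite nE => ->.
- by rewrite -[LHS]/(sigma (sigma 'X_(io 1))) sigmaXS // sigmaX0.
by have := sigma2_sk p; rewrite /sk nE.
Qed.

Lemma tensor_daha : daha_rels n q t (fun k => hT k : {linear P -> P})
  (hW : {linear P -> P}) (fun k => hX k : {linear P -> P}).
Proof.
have tvH := tv_hecke htau t0 tgen.
split.
- exact: hT_hecke.
- move=> k F kn; apply: (linear_tens (f := hW \o hT k.+1) (g := hT k \o hW)) => p v.
  change (hW (hT k.+1 (tens p v)) = hT k (hW (tens p v))).
  rewrite (hT_tens k.+1 p v) (hWD (tens _ _) (tens _ _)) (hW_tens (Ak k.+1 p) v).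
  rewrite (hW_tens (sk k.+1 p) (tv k.+1 v)) (hW_tens p v) (hT_tens k (sigma p) (delta v)).
  have -> : delta (tv k.+1 v) = tv k (delta v) := Tup_braid t0 tvH v kn.
  rewrite (sigma_Ak p kn) (sigma_sk p kn); reflexivity.
- move=> F.
  apply: (linear_tens (f := hT n.-1 \o hW \o hW) (g := hW \o hW \o hT 0)) => p v.
  change (hT n.-1 (hW (hW (tens p v))) = hW (hW (hT 0 (tens p v)))).
  rewrite (hT_tens 0 p v) (hWD (tens _ _) (tens _ _)) (hW_tens (Ak 0 p) v).
  rewrite (hW_tens (sk 0 p)) (hWD (tens _ _) (tens _ _)).
  rewrite (hW_tens (sigma (Ak 0 p))) (hW_tens (sigma (sk 0 p))).
  rewrite (hW_tens p v) (hW_tens (sigma p)) (hT_tens n.-1).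
  have -> : delta (delta (tv 0 v)) = tv n.-1 (delta (delta v)).
    exact: esym (Tup_square t0 tvH v n0).
  rewrite (sigma2_Ak p) (sigma2_sk p); reflexivity.
- move=> k F kn; apply: (linear_tens (f := (hT k \o hX k.+1) \+ ((1 - t) \*: hX k.+1))
    (g := hX k \o hT k)) => p v.
  change (hT k (hX k.+1 (tens p v)) + (1 - t) *: hX k.+1 (tens p v) = hX k (hT k (tens p v))).
  rewrite (hX_tens k.+1 p v) (hT_tens k (mulX k.+1 p) v) (hT_tens k p v).
  rewrite (hXD k (tens _ _) (tens _ _)) (hX_tens k (Ak k p) v).
  rewrite (hX_tens k (sk k p) (tv k v)) addrAC -tensZl -tensDl /mulX /Ak.
  rewrite (Aop_X t p (ioS kn)); congr (_ + tens _ _).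
  by rewrite /sk msymM msymXi tpermR.
- move=> k j F kn jn jk jk1.
  have [a b] : io k != io j /\ io k.+1 != io j by split; apply: io_neq; lia.
  apply: (linear_tens (f := hT k \o hX j) (g := hX j \o hT k)) => p v.
  change (hT k (hX j (tens p v)) = hX j (hT k (tens p v))).
  rewrite (hX_tens j p v) (hT_tens k (mulX j p) v) (hT_tens k p v).
  rewrite (hXD j (tens _ _) (tens _ _)) (hX_tens j (Ak k p) v).
  rewrite (hX_tens j (sk k p) (tv k v)) /mulX; congr (tens _ _ + tens _ _).
    by apply: Aop_X_far; [exact: ioS | rewrite eq_sym | rewrite eq_sym].
  by rewrite /sk msymM msymXi tpermD.
- move=> k F kn; apply: (linear_tens (f := hW \o hX k.+1) (g := hX k \o hW)) => p v.
  change (hW (hX k.+1 (tens p v)) = hX k (hW (tens p v))).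
  rewrite (hX_tens k.+1 p v) (hW_tens (mulX k.+1 p) v) (hW_tens p v) (hX_tens k (sigma p)).
  by congr (tens _ _); rewrite /mulX [LHS]rmorphM; congr (_ * _); exact: sigmaXS.
move=> F; apply: (linear_tens (f := hW \o hX 0) (g := q \*: (hX n \o hW))) => p v.
  change (hW (hX 0 (tens p v)) = q *: hX n (hW (tens p v))).
rewrite (hX_tens 0 p v) (hW_tens (mulX 0 p) v) (hW_tens p v) (hX_tens n (sigma p)).
rewrite -tensZl; congr (tens _ _).
by rewrite /mulX [LHS]rmorphM scalerAl; congr (_ * _); exact: sigmaX0.
Qed.

End PolyDaha.

(** * Degrees of the operators *)

Section Homogeneity.
Variables (K : fieldType) (N : nat).
Local Notation mp := {mpoly K[N]}.
Implicit Types (p : mp) (i j : 'I_N).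

Lemma homogX i : ('X_i : mp) \is 1%N.-homog.
Proof. by rewrite dhomogX /= mdeg1. Qed.

Lemma homog_lext (f : {linear mp -> mp}) d p :
  (forall m, f 'X_[m] \is (mdeg m).-homog) -> p \is d.-homog -> f p \is d.-homog.
Proof.
move=> fm /dhomogP pd; rewrite linear_lext /lext big_seq; apply: rpred_sum => m mp0.
by apply: dhomogZ; rewrite -(pd _ mp0).
Qed.

Lemma homog_exp i b : ('X_i : mp) ^+ b \is b.-homog.
Proof. by have := dhomogMn b (homogX i); rewrite mul1n. Qed.

Lemma homog_msym (s : 'S_N) d p : p \is d.-homog -> msym s p \is d.-homog.
Proof.
apply: (homog_lext (f := msym s : {linear mp -> mp})) => m /=.
by rewrite msymX dhomogX /= mdeg_mperm.
Qed.

Lemma homog_dpow i j a : dpow K i j a \is (a.-1).-homog.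
Proof.
apply: rpred_sum => k _.
have {2}-> : a.-1 = (a.-1 - k + k)%N by have := ltn_ord k; lia.
by apply: dhomogM; exact: homog_exp.
Qed.

Lemma mdeg_drop i j m : i != j -> mdeg m = (mdeg (mnm_drop i j m) + m i + m j)%N.
Proof.
move=> ij.
have {1}-> : m = (mnm_drop i j m + U_(i) *+ m i + U_(j) *+ m j)%MM.
  apply/mnmP => k; rewrite !mnmDE !mulmnE !mnm1E mnmE.
  have ji : (j == i) = false by rewrite eq_sym (negPf ij).
  have [->|ki] := eqVneq k i; first by rewrite ji /= mul1n mul0n addn0.
  have [->|kj] := eqVneq k j; first by rewrite /= mul0n mul1n.
  by rewrite /= !mul0n !addn0.
by rewrite !mdegD !mdegMn !mdeg1 !mul1n.
Qed.

Lemma homog_Xdmon i j m : i != j -> 'X_j * dmon K i j m \is (mdeg m).-homog.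
Proof.
move=> ij; rewrite (mdeg_drop m ij) /dmon.
have H a b : (b < a)%N -> 'X_j * ('X_[mnm_drop i j m] * (('X_i * 'X_j) ^+ b * dpow K i j (a - b)))
    \is (mdeg (mnm_drop i j m) + a + b).-homog.
  move=> ba.
  have -> : (mdeg (mnm_drop i j m) + a + b =
      1 + (mdeg (mnm_drop i j m) + ((1 + 1) * b + (a - b).-1)))%N by lia.
  apply: dhomogM; first exact: homogX.
  apply: dhomogM; first by rewrite dhomogX.
  apply: dhomogM; last exact: homog_dpow.
  by apply: dhomogMn; apply: dhomogM; exact: homogX.
(* Equal exponents stand apart: [dpow] is then an empty sum, while the degree count of [H] needs a
   positive difference. *)
case: ltngtP => [ltm|ltm|->].
- exact: H.
- by rewrite mulrN mulrN rpredN addnAC; exact: H.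
by rewrite subnn /dpow big_ord0 !mulr0 rpred0.
Qed.

Lemma homog_Aop t i j d p : i != j -> p \is d.-homog -> Aop t i j p \is d.-homog.
Proof.
move=> ij; apply: (homog_lext (f := Aop t i j : {linear mp -> mp})) => m.
rewrite /= /Aop /dd lextX; apply: dhomogZ.
exact: homog_Xdmon.
Qed.

Lemma homog_comp (lq : N.-tuple mp) d p : (forall i, tnth lq i \is 1%N.-homog) ->
  p \is d.-homog -> p \mPo lq \is d.-homog.
Proof.
move=> lqh; apply: (homog_lext (f := comp_mpoly lq : {linear mp -> mp})) => m.
rewrite /= comp_mpolyX mdegE.
elim/big_rec2: _ => [|i r e _ IH]; first exact: dhomog1.
by apply: dhomogM IH; have := dhomogMn (m i) (lqh i); rewrite mul1n.
Qed.

Lemma homog_mulX i d p : ('X_i * p \is d.+1.-homog) = (p \is d.-homog).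
Proof.
apply/idP/idP => [/dhomogP h|h]; last by rewrite -add1n; apply: dhomogM h; exact: homogX.
apply/dhomogP => m mp0.
have /h : (U_(i) + m)%MM \in msupp ('X_i * p).
  rewrite !mcoeff_msupp mulrC in mp0 *. by rewrite (mcoeffMX p U_(i)%MM m).
by rewrite /= mdegD mdeg1 => -[].
Qed.

End Homogeneity.

Section TensorModel.
Variables (K : fieldType) (n : nat) (tau : seq nat) (q t : K).
Local Notation N := n.+1.
Hypothesis htau : is_partition N tau.
Hypotheses (n0 : (0 < n)%N) (q0 : q != 0) (t0 : t != 0)
  (tgen : forall b : int, b != 0 -> t ^ b != 1).
Local Notation V := (tabspace K N tau).
Local Notation P := (polytab K N tau).
Local Notation mp := {mpoly K[N]}.
Local Notation tab := (@tab K N tau).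
Local Notation io := (@inord n).
Local Notation tv := (@tv K n tau t).
Local Notation tvl := (fun k => tv k : {linear V -> V}).
Local Notation hT := (@hT K n tau t).
Local Notation hW := (@hW K n tau q t).
Local Notation hX := (@hX K n tau).
Local Notation hTl := (fun k => hT k : {linear P -> P}).
Local Notation sigma := (@sigma K n q).
Local Notation delta := (@delta K n tau t).
Implicit Types (v : V) (p : mp) (F : P) (S : rsyt N tau).

Let tvH : hecke_rels n t tvl := tv_hecke htau t0 tgen.
Let daha : daha_rels n q t hTl (hW : {linear P -> P}) (fun k => hX k : {linear P -> P})
  := @tensor_daha K n tau q t htau n0 q0 t0 tgen.

Lemma opP_id (f : {linear mp -> mp}) F U : opP f (idfun : V -> V) F U = f (F U).
Proof.
rewrite /opP sum_ffunE (bigD1 U) //= !ffunE eqxx scale1r big1 ?addr0 // => S SU.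
by rewrite !ffunE eq_sym (negPf SU) scale0r.
Qed.

Lemma hXE k F U : hX k F U = 'X_(io k) * F U.
Proof. exact: opP_id. Qed.

Lemma hX_inj k F : hX k F = 0 -> F = 0.
Proof.
move=> /ffunP F0; apply/ffunP => U; have := F0 U; rewrite hXE !ffunE => /eqP.
rewrite mulf_eq0 => /orP[|/eqP//] /eqP /(congr1 (mcoeff U_(io k))).
by rewrite mcoeff0 mcoeffXU eqxx => /eqP; rewrite oner_eq0.
Qed.

Definition deg m F : Prop := forall S, F S \is m.-homog.

Lemma deg_tens m p v : p \is m.-homog -> deg m (tens p v).
Proof. by move=> pm S; rewrite ffunE; exact: dhomogZ. Qed.

Lemma deg_lin m a F G : deg m F -> deg m G -> deg m (a *: F + G).
Proof. by move=> dF dG S; rewrite !ffunE; apply: rpredD => //; exact: dhomogZ. Qed.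

Lemma deg_sum m (I : finType) (G : I -> P) :
  (forall i, deg m (G i)) -> deg m (\sum_i G i).
Proof. by move=> dG S; rewrite sum_ffunE; apply: rpred_sum => i _; exact: dG. Qed.

Lemma deg_opP m (f : mp -> mp) g F :
  (forall p, p \is m.-homog -> f p \is m.-homog) -> deg m F -> deg m (opP f g F).
Proof. by move=> fm dF; apply: deg_sum => S; apply/deg_tens/fm/dF. Qed.

Let ioS k : (k < n)%N -> io k != io k.+1.
Proof. by move=> kn; apply: inord_neq; lia. Qed.

Lemma deg_hT m k F : (k < n)%N -> deg m F -> deg m (hT k F).
Proof.
move=> kn dF; rewrite -[hT k F]scale1r -[1 *: _]addr0.
move=> S; rewrite addr0 scale1r ffunE; apply: rpredD.
  by apply: deg_opP dF _ => p; apply: homog_Aop; exact: ioS.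
by apply: deg_opP dF _ => p; exact: homog_msym.
Qed.

Definition wtup' : N.-tuple mp :=
  [tuple if j == n :> nat then q^-1 *: 'X_(ordS j) else 'X_(ordS j) | j < N].
Definition sigma' : mp -> mp := comp_mpoly wtup'.
HB.instance Definition _ := GRing.LRMorphism.on sigma'.
Definition hWinv : P -> P := opP sigma' (Tidn t tvl n).
HB.instance Definition _ := GRing.Linear.on hWinv.

Let sigma'X (j : 'I_N) :
  sigma' 'X_j = (if j == n :> nat then q^-1 else 1) *: 'X_(ordS j).
Proof.
by rewrite /sigma' comp_mpolyXU -tnth_nth tnth_mktuple; case: ifP; rewrite ?scale1r.
Qed.

Let val_ordS (j : 'I_N) : (ordS j == 0%N :> nat) = (j == n :> nat).
Proof.
rewrite /=; have := ltn_ord j; rewrite ltnS leq_eqVlt => /orP[/eqP->|jn].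
  by rewrite modnn !eqxx.
by rewrite modn_small // [in RHS]ltn_eqF.
Qed.

Let val_pred (j : 'I_N) : (ord_pred j == n :> nat) = (j == 0%N :> nat).
Proof. by rewrite -val_ordS ord_predK. Qed.

Lemma sigmaK p : sigma' (sigma p) = p.
Proof.
apply: (mpoly_rmorph_eq (f := sigma' \o sigma) (g := idfun)) => j.
rewrite -[LHS]/(sigma' (sigma 'X_j)) sigmaX [LHS]linearZ /= sigma'X val_pred ord_predK.
by case: ifP => _; rewrite !scalerA ?mul1r ?mulfV // scale1r.
Qed.

Lemma sigma'K p : sigma (sigma' p) = p.
Proof.
apply: (mpoly_rmorph_eq (f := sigma \o sigma') (g := idfun)) => j.
rewrite -[LHS]/(sigma (sigma' 'X_j)) sigma'X [LHS]linearZ /= sigmaX val_ordS ordSK.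
by case: ifP => _; rewrite !scalerA ?mul1r ?mulVf // scale1r.
Qed.

Lemma hWinv_tens p v : hWinv (tens p v) = tens (sigma' p) (Tidn t tvl n v).
Proof. exact: opP_tens. Qed.

Lemma hWK F : hWinv (hW F) = F.
Proof.
apply: (linear_tens (f := hWinv \o hW) (g := idfun)) => p v.
rewrite -[LHS]/(hWinv (hW (tens p v))) hW_tens hWinv_tens sigmaK.
by congr (tens _ _); exact: (TupK t0 tvH).
Qed.

Lemma hWinvK F : hW (hWinv F) = F.
Proof.
apply: (linear_tens (f := hW \o hWinv) (g := idfun)) => p v.
rewrite -[LHS]/(hW (hWinv (tens p v))) hWinv_tens hW_tens sigma'K.
by congr (tens _ _); exact: (TidnK t0 tvH).
Qed.

Lemma deg_hW m F : deg m F -> deg m (hW F).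
Proof.
apply: deg_opP => p; apply: homog_comp => i; rewrite tnth_mktuple.
by case: ifP => _; [apply: dhomogZ|]; exact: homogX.
Qed.

Lemma deg_hWinv m F : deg m F -> deg m (hWinv F).
Proof.
apply: deg_opP => p; apply: homog_comp => i; rewrite tnth_mktuple.
by case: ifP => _; [apply: dhomogZ|]; exact: homogX.
Qed.

Lemma deg_hX m k F : deg m.+1 (hX k F) <-> deg m F.
Proof. by split=> dF S; have := dF S; rewrite hXE homog_mulX. Qed.

Definition vac S : P := tens 1 (tab S).

Lemma Ak1 k : @Ak K n t k 1 = 0.
Proof.
rewrite /Ak /Aop (_ : dd _ _ 1 = 0) ?mulr0 ?scaler0 //.
by rewrite -mpolyX0 /dd lextX /dmon !mnm0E leqnn subnn /dpow big_ord0 !mulr0.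
Qed.

Lemma hT_const k v : hT k (tens 1 v) = tens 1 (tv k v).
Proof.
rewrite hT_tens Ak1 (rmorph1 (@sk K n k)).
by rewrite (_ : tens 0 v = 0) ?add0r //; apply/ffunP => S; rewrite !ffunE scaler0.
Qed.

Lemma Tinv_hTE k F : Tinv t hTl k F = t^-1 *: (hT k F + (1 - t) *: F).
Proof. reflexivity. Qed.

Lemma Tinv_tvE k v : Tinv t tvl k v = t^-1 *: (tv k v + (1 - t) *: v).
Proof. reflexivity. Qed.

Lemma hXB k F G : hX k (F - G) = hX k F - hX k G.
Proof. exact: linearB. Qed.

Lemma tidn_tens k v : Tidn t hTl k (tens 1 v) = tens 1 (Tidn t tvl k v).
Proof.
elim: k v => //= k IH v; rewrite -IH; congr (Tidn _ _ _ _).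
by rewrite Tinv_hTE Tinv_tvE hT_const -tensZr -tensDr -tensZr.
Qed.

Lemma vac_last S : xi n t hTl hW n (vac S) = vac S.
Proof.
rewrite /xi subnn subrr expr0z scale1r /= /vac tidn_tens hW_tens rmorph1.
by congr (tens _ _); exact: (TidnK t0 tvH).
Qed.

(** Descent from k = n. There the inverses in xi_n cancel the action of w on tableaux, which gives
    eigenvalue 1, and the entry N has content 0; [xi_step] and [tv_ct] lower k by one. *)
Lemma xi_vac S k : (k <= n)%N -> xi n t hTl hW k (vac S) = t ^ ct S k *: vac S.
Proof.
move=> kn; rewrite -(subKn kn); elim: (n - k)%N (leq_subr k n) S => [|d IH] dn S.
  rewrite subn0 vac_last /ct (content_last htau) ?inordK // expr0z.
  by rewrite scale1r.
set j := (n - d.+1)%N; have jn : (j < n)%N by rewrite /j; lia.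
have jE : (n - d = j.+1)%N by rewrite /j; lia.
have {}IH U : xi n t hTl hW j.+1 (vac U) = t ^ ct U j.+1 *: vac U.
  by rewrite -jE; apply: IH; exact: ltnW.
apply: (scalerI t0); rewrite -(xi_step n0 t0 daha _ jn).
have hTv U : hT j (vac U) = phi t (cdiff U j) *: vac U + psi t (cdiff U j) *: vac (stab U j).
  by rewrite /vac hT_const (tv_tab htau t0 tgen _ jn) tensDr !tensZr.
change (hT j (xi n t hTl hW j.+1 (hT j (vac S))) = t *: (t ^ ct S j *: vac S)).
rewrite hTv xiD !xiZ !IH !scalerA.
have -> : (psi t (cdiff S j) * t ^ ct (stab S j) j.+1) *: vac (stab S j) =
    (psi t (cdiff S j) * t ^ ct S j) *: vac (stab S j).
  rewrite -!(scalerA (psi t (cdiff S j))); apply: scale_eq => p0.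
  by congr (t ^ _ *: _); apply: ct_stab_r p0.
rewrite /vac -!tensZr -tensDr hT_const (tv_ct htau t0 tgen _ jn).
by rewrite tensZr.
Qed.

Lemma deg_vac S : deg 0 (vac S).
Proof. by apply: deg_tens; exact: dhomog1. Qed.

Lemma homog0P p : p \is 0%N.-homog -> p = (p@_0%MM)%:MP.
Proof.
move=> p0; apply/mpolyP => m; rewrite mcoeffC.
have [->|m0] := eqVneq 0%MM m; first by rewrite mulr1.
by rewrite mulr0 (dhomog_nemf_coeff p0) // mdeg_eq0 eq_sym.
Qed.

(** A vector of degree 0 is a combination of the 1 (x) S, on which every xi_k is diagonal. As t is
    not a root of unity and contents determine the tableau, only one coefficient can be nonzero. *)
Lemma vac_eig c F : deg 0 F -> (forall k, (k <= n)%N -> xi n t hTl hW k F = t ^ c k *: F) ->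
  F != 0 -> exists S, (forall k, (k <= n)%N -> c k = ct S k) /\ exists a, F = a *: vac S.
Proof.
move=> dF eF F0; pose a S := (F S)@_0%MM.
have FS S : F S = (a S)%:MP by exact: homog0P.
have FE : F = \sum_S a S *: vac S.
  rewrite {1}[F]tens_sum; apply: eq_bigr => S _.
  by rewrite FS /vac -tensZl -mul_mpolyC mulr1.
have co (b : rsyt N tau -> K) U : (\sum_S b S *: vac S) U = (b U)%:MP.
  rewrite sum_ffunE (bigD1 U) //= !ffunE eqxx scale1r big1 ?addr0 => [|S SU].
    by rewrite -mul_mpolyC mulr1.
  by rewrite !ffunE eq_sym (negPf SU) scale0r scaler0.
have aE S k : (k <= n)%N -> a S != 0 -> c k = ct S k.
  move=> kn aS; have := eF k kn; rewrite {1}FE (linear_sum (xi n t hTl hW k)).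
  have xE U : xi n t hTl hW k (a U *: vac U) = (a U * t ^ ct U k) *: vac U.
    by rewrite xiZ (xi_vac U kn) scalerA.
  rewrite (eq_bigr _ (fun U _ => xE U)).
  move=> /ffunP /(_ S); rewrite co ffunE FS -mul_mpolyC -mpolyCM.
  move=> /(congr1 (mcoeff 0%MM)); rewrite !mcoeffC !eqxx !mulr1.
  rewrite mulrC => /(mulIf aS) E; apply: esym; apply/eqP; rewrite -subr_eq0.
  apply: contraT => /tgen; rewrite expfzDr // E -expfzDr // subrr expr0z.
  by rewrite eqxx.
have [S aS] : exists S, a S != 0.
  apply/existsP; apply: contraNT F0; rewrite negb_exists => /forallP a0.
  by rewrite FE big1 // => S _; move: (a0 S); rewrite negbK => /eqP ->; rewrite scale0r.
exists S; split=> [k kn|]; first exact: aE.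
exists (a S); rewrite {1}FE (bigD1 S) //= big1 ?addr0 // => U US.
have [->|aU] := eqVneq (a U) 0; first by rewrite scale0r.
case/eqP: US; apply: (content_inj htau) => i.
have iE : io i = i by apply: val_inj; rewrite /= inordK.
have := aE U i (ltn_ord i) aU; rewrite (aE S i (ltn_ord i) aS) /ct iE.
by move=> ->.
Qed.

(** Modulo multiples of x_0, the word T_(k-1)^-1 ... T_0^-1 acts on polynomials by this permutation
    alone and on tableaux as itself. *)
Fixpoint sw k p : mp := if k is k'.+1 then sw k' (sk k' p) else p.

Lemma Tinv_hX0 k F : (k <= n)%N -> exists G, Tidn t hTl k (hX k F) = hX 0 G.
Proof.
elim: k F => [|k IH] F kn; first by exists F.
have [G GE] := IH (hT k F) (ltnW kn).
exists (t^-1 *: G); rewrite hXZ -GE /=.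
rewrite /Tinv (T_X daha F kn) linearZ.
by [].
Qed.

Lemma Tidn_tens k p v : (k <= n)%N ->
  exists G, Tidn t hTl k (tens p v) = tens (sw k p) (Tidn t tvl k v) + hX 0 G.
Proof.
elim: k p v => [|k IH] p v kn; first by exists 0; rewrite (linear0 (hX 0)) addr0.
have [G1 E1] := IH (sk k p) (Tinv t tvl k v) (ltnW kn).
set r := t^-1 * (1 - t).
have [G2 E2] := Tinv_hX0 (r *: tens (dd (io k) (io k.+1) p) v) (ltnW kn).
exists (G1 + G2); rewrite hXD addrA /= -E1 -E2 -(linD (Tidn t hTl k)).
congr (Tidn _ _ _ _).
(* The part of t T_k^-1 that leaves the tableau fixed: besides the permutation it produces only a
   multiple of x_k, which the remaining inverses carry to a multiple of x_0. *)
have E : @Ak K n t k p + (1 - t) *: p = (1 - t) *: (sk k p + mulX k (dd (io k) (io k.+1) p)).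
  rewrite /Ak /Aop /mulX -scalerDr; congr (_ *: _).
  have : p = ('X_(io k) - 'X_(io k.+1)) * dd (io k) (io k.+1) p + sk k p.
    by rewrite ddE ?subrK //; exact: ioS.
  by move: (dd _ _ p) (sk k p) => d s ->; ring.
rewrite Tinv_hTE Tinv_tvE hXZ hX_tens hT_tens tensZr tensDr (tensZr (1 - t)).
rewrite -(tensZl (1 - t) p v) [tens (Ak _ _ _) v + _]addrC -addrA -tensDl E tensZl tensDl.
by rewrite !scalerDr !scalerA addrA.
Qed.

Lemma swD k p r : sw k (p + r) = sw k p + sw k r.
Proof. by elim: k p r => //= k IH p r; rewrite -IH rmorphD. Qed.
Lemma swM k p r : sw k (p * r) = sw k p * sw k r.
Proof. by elim: k p r => //= k IH p r; rewrite -IH rmorphM. Qed.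
Lemma swZ k a p : sw k (a *: p) = a *: sw k p.
Proof. by elim: k p => //= k IH p; rewrite -IH linearZ. Qed.
Lemma sw1 k : sw k 1 = 1.
Proof. by elim: k => //= k IH; rewrite rmorph1. Qed.

Lemma swX j k : (j <= n)%N -> (k <= n)%N ->
  sw k 'X_(io j) = (if j == k then 'X_(io 0) else if (j < k)%N then 'X_(io j.+1) else 'X_(io j)) :> mp.
Proof.
move=> jn; elim: k j jn => [|k IH] j jn kn /=.
  by case: j jn => // j _; rewrite ltn0.
have C i : (i <= n)%N -> sw k 'X_(io i) = (if i == k then 'X_(io 0)
    else if (i < k)%N then 'X_(io i.+1) else 'X_(io i)) by move=> ilt; rewrite IH // ltnW.
rewrite /sk msymXi; case: tpermP => [/(congr1 val)|/(congr1 val)|].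
- rewrite /= !inordK //; last exact: ltnW.
  by move=> jk; rewrite C //; repeat (case: ifP => ?); rewrite ?jk //; lia.
- rewrite /= !inordK // => jk; rewrite C; last exact: ltnW.
  by repeat (case: ifP => ?); rewrite ?jk //; lia.
move=> h1 h2; rewrite C //.
have jk : j <> k by move=> E; apply: h1; rewrite E.
have jk1 : j <> k.+1 by move=> E; apply: h2; rewrite E.
by repeat (case: ifP => ?) => //; lia.
Qed.

Lemma sw0 k : sw k 0 = 0.
Proof. by elim: k => //= k IH; rewrite rmorph0. Qed.

(** The rotation undoes the permutation: together they fix every variable except x_n, which is
    multiplied by q, so the two polynomials agree at x_n = 0. This is why the division by x_N in D_N
    is exact. *)
Lemma sigma_sw_div p : exists r, p - sigma (sw n p) = 'X_(io n) * r.
Proof.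
pose D p := exists r, p - sigma (sw n p) = 'X_(io n) * r.
have DD p1 p2 : D p1 -> D p2 -> D (p1 + p2).
  move=> [r1 E1] [r2 E2]; exists (r1 + r2).
  by rewrite swD rmorphD mulrDr -E1 -E2 opprD addrACA.
have DM p1 p2 : D p1 -> D p2 -> D (p1 * p2).
  move=> [r1 E1] [r2 E2]; exists (r1 * p2 + sigma (sw n p1) * r2).
  rewrite swM rmorphM mulrDr mulrA -E1 mulrCA -E2.
  by rewrite mulrBl mulrBr addrA subrK.
have D1 : D 1 by exists 0; rewrite sw1 rmorph1 subrr mulr0.
have D0 : D 0 by exists 0; rewrite sw0 rmorph0 subrr mulr0.
have DZ a p1 : D p1 -> D (a *: p1).
  by move=> [r E]; exists (a *: r); rewrite swZ linearZ /= -scalerBr E scalerAr.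
suff DX i : D 'X_i.
  rewrite -/(D p) [p]mpolyE; apply: (big_ind D D0 DD) => m _; apply: DZ.
  rewrite mpolyXE_id; apply: (big_ind D D1 DM) => i _.
  by elim: (m i) => [|e IH]; [rewrite expr0; exact: D1 | rewrite exprS; exact: DM].
have -> : i = io i by apply: val_inj; rewrite /= inordK.
have il := ltn_ord i; rewrite ltnS in il; rewrite /D (swX il (leqnn n)).
have [iE|iln] := eqVneq (i : nat) n.
  by exists (1 - q)%:MP; rewrite sigmaX0 iE mulrC mul_mpolyC scalerBl scale1r.
have {}iln : (i < n)%N by rewrite ltn_neqAle iln.
by exists 0; rewrite iln (sigmaXS htau n0 q0 t0 iln) subrr mulr0.
Qed.

Lemma sub_xi_div F : exists G, F - xi n t hTl hW n F = hX n G.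
Proof.
pose D F := exists G, F - xi n t hTl hW n F = hX n G.
have DD F1 F2 : D F1 -> D F2 -> D (F1 + F2).
  move=> [r1 E1] [r2 E2]; exists (r1 + r2).
  by rewrite xiD hXD -E1 -E2 opprD addrACA.
rewrite -/(D F) [F]tens_sum; apply: big_ind => //.
  by exists 0; rewrite (linear0 (xi n t hTl hW n)) subrr (linear0 (hX n)).
move=> S _; move: (F S) (tab S) => p v.
have [G E] := Tidn_tens p v (leqnn n).
have [r rE] := sigma_sw_div p.
exists (tens r v - q *: hW G).
rewrite /xi subnn subrr expr0z scale1r /= E hWD hW_tens (W_X0 daha).
have -> : delta (Tidn t tvl n v) = v by exact: (TidnK t0 tvH).
rewrite opprD addrA hXB hXZ hX_tens /mulX -rE; congr (_ - _).
by apply/ffunP => U; rewrite !ffunE scalerBr.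
Qed.

Hypothesis qtgen : forall (a : nat) (b : int), q ^+ a * t ^ b = 1 -> a = 0%N /\ b = 0.

Lemma tensor_model : macdonald_model n q t hTl (hW : {linear P -> P})
  (fun k => hX k : {linear P -> P}) (@ct n tau) vac deg.
Proof.
split.
- exact: n0.
- exact: t0.
- exact: q0.
- exact: qtgen.
- exact: daha.
- by move=> F E; rewrite -[F]hWK [hW F]E (linear0 hWinv).
- by move=> m F dF; exists (hWinv F); [exact: deg_hWinv | exact: hWinvK].
- by move=> F; exact: hX_inj.
- exact: sub_xi_div.
- exact: deg_lin.
- by move=> m S; rewrite ffunE; exact: dhomog0.
- exact: deg_hT.
- exact: deg_hW.
- by move=> m F; exact: deg_hX.
- by move=> S; rewrite /ct (content_last htau) // inordK.
- by move=> S k kn; exact: (ctS_neq htau t0 tgen).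
- exact: xi_vac.
- exact: deg_vac.
- exact: vac_eig.
Qed.

End TensorModel.

(** * The operators of the statement *)

Section Words.
Variable n : nat.
Local Notation N := n.+1.
Local Notation io := (@inord n).

Lemma enum_filter_inord (Q : pred nat) s : sorted ltn s ->
  (forall j, (j \in s) = (j <= n)%N && Q j) ->
  [seq j : 'I_N <- enum 'I_N | Q j] = [seq io j | j <- s].
Proof.
move=> ss sQ; have E : [seq io j | j <- iota 0 N] = enum 'I_N.
  by rewrite -val_enum_ord -map_comp map_id_in // => j _; rewrite /= inord_val.
rewrite -E filter_map; congr map; apply: (irr_sorted_eq ltn_trans ltnn) => //.
  by apply: sorted_filter => //; [exact: ltn_trans | exact: iota_ltn_sorted].
move=> j; rewrite mem_filter mem_iota /= add0n sQ ltnS andbC.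
by case: (leqP j n) => //= jn; rewrite inordK.
Qed.

Lemma foldl_iota (A : Type) (f : A -> 'I_N -> A) (g : nat -> A -> A) a d x :
  (forall k y, (k < a + d)%N -> f y (io k) = g k y) ->
  foldl f x [seq io j | j <- iota a d] = foldl (fun y k => g k y) x (iota a d).
Proof.
elim: d a x => //= d IH a x fg; rewrite fg; last by lia.
by apply: IH => k y kd; apply: fg; lia.
Qed.

Lemma foldl_rev_iota (A : Type) (f : A -> 'I_N -> A) (g : nat -> A -> A) a d x :
  (forall k y, (k < a + d)%N -> f y (io k) = g k y) ->
  foldl f x (rev [seq io j | j <- iota a d]) = foldl (fun y k => g k y) x (rev (iota a d)).
Proof.
move=> fg; rewrite -map_rev.
have: all (fun k => k < a + d)%N (rev (iota a d)).
  by apply/allP => j; rewrite mem_rev mem_iota => /andP[].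
by elim: (rev _) x => //= k s IH x /andP[kd sd]; rewrite fg // IH.
Qed.

End Words.

Section Links.
Variables (K : fieldType) (n : nat) (tau : seq nat) (q t : K).
Local Notation N := n.+1.
Hypothesis htau : is_partition N tau.
Hypotheses (n0 : (0 < n)%N) (q0 : q != 0) (t0 : t != 0)
  (tgen : forall b : int, b != 0 -> t ^ b != 1).
Local Notation V := (tabspace K N tau).
Local Notation P := (polytab K N tau).
Local Notation mp := {mpoly K[N]}.
Local Notation tab := (@tab K N tau).
Local Notation io := (@inord n).
Local Notation tv := (@tv K n tau t).
Local Notation tvl := (fun k => tv k : {linear V -> V}).
Local Notation hT := (@hT K n tau t).
Local Notation hW := (@hW K n tau q t).
Local Notation hX := (@hX K n tau).
Local Notation hTl := (fun k => hT k : {linear P -> P}).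
Local Notation txi := (xi n t hTl hW).
Implicit Types (v : V) (p : mp) (F : P) (S : rsyt N tau).

Let hTH : hecke_rels n t hTl := daha_hecke (tensor_daha htau n0 q0 t0 tgen).

Lemma heckeT_hT k F : (k < n)%N -> heckeT t F (io k) = hT k F.
Proof.
move=> kn; rewrite /heckeT /hT /opP -big_split; apply: eq_bigr => S _.
have kk : io k != io k.+1 by apply: inord_neq; lia.
rewrite (inord_ordS kn).
rewrite /psubst_s.
rewrite (inord_ordS kn).
rewrite (mquot_dd (F S) kk).
reflexivity.
Qed.

Lemma heckeTinv_Tinv k F : (k < n)%N -> heckeTinv t F (io k) = Tinv t hTl k F.
Proof.
move=> kn; rewrite /heckeTinv /op_inv.
case: xgetP => [G _ /= GE | /(_ (Tinv t hTl k F)) /=].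
  by rewrite -GE heckeT_hT // (TinvK t0 hTH).
by rewrite heckeT_hT // (TKinv t0 hTH).
Qed.

Lemma foldl_rev0 (A : Type) (g : nat -> A -> A) k x :
  foldl (fun y j => g j y) x (rev (iota 0 k.+1)) =
  foldl (fun y j => g j y) (g k x) (rev (iota 0 k)).
Proof. by rewrite -addn1 iotaD rev_cat. Qed.

Lemma heckeW_hW F : heckeW q t F = hW F.
Proof.
rewrite /heckeW /hW /opP; apply: eq_bigr => S _; congr tens.
rewrite (@enum_filter_inord n (fun j => j.+1 < N)%N (iota 0 n)); first last.
- by move=> j; rewrite mem_iota; lia.
- exact: iota_ltn_sorted.
rewrite /tau_word (@foldl_iota n _ _ (fun k v => tv k v)) // /delta.
suff H d v : (d <= n)%N -> foldl (fun y k => tv k y) v (iota (n - d) d) = Tup n tvl d v.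
  by rewrite -(H n) // subnn.
elim: d v => //= d IH v dn; rewrite -IH; last exact: ltnW.
by congr (foldl _ _ (iota _ _)); lia.
Qed.

Lemma cherednik_xi k F : (k <= n)%N -> cherednik q t (io k) F = txi k F.
Proof.
move=> kn; rewrite /cherednik /xi inordK //.
rewrite (@enum_filter_inord n (fun j => j < k)%N (iota 0 k)); first last.
- by move=> j; rewrite mem_iota; lia.
- exact: iota_ltn_sorted.
rewrite (@enum_filter_inord n (fun j => (k <= j) && (j.+1 < N))%N (iota k (n - k))); first last.
- by move=> j; rewrite mem_iota; lia.
- exact: iota_ltn_sorted.
rewrite (@foldl_rev_iota n _ (@heckeTinv K N tau t) (fun k F => Tinv t hTl k F)); last first.
  by move=> j y jk; rewrite heckeTinv_Tinv //; lia.
rewrite (@foldl_rev_iota n _ (@heckeT K N tau t) (fun k F => hT k F)); last first.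
  by move=> j y jk; rewrite heckeT_hT //; lia.
rewrite heckeW_hW; congr (_ *: _).
  by congr (t ^ _); lia.
have -> : foldl (fun y j => Tinv t hTl j y) F (rev (iota 0 k)) = Tidn t hTl k F.
  elim: k F {kn} => // k IH F; rewrite foldl_rev0 IH; reflexivity.
suff H d G : (d <= n)%N -> foldl (fun y j => hT j y) G (rev (iota (n - d) d)) = Tdn n hTl d G.
  by have := H (n - k)%N (hW (Tidn t hTl k F)) (leq_subr _ _); rewrite subKn.
elim: d => [//|d IH dn]; have dS : ((n - d.+1).+1 = n - d)%N by lia.
have -> : rev (iota (n - d.+1) d.+1) = rcons (rev (iota (n - d) d)) (n - d.+1)%N.
  by rewrite /= rev_cons dS.
rewrite -cats1 foldl_cat (IH (ltnW dn)); reflexivity.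
Qed.

Definition dlast F : P := dunkl_last q t (io n) F.

Lemma dlastE F : hX n (dlast F) = F - txi n F.
Proof.
have [G GE] := @sub_xi_div K n tau q t htau n0 q0 t0 tgen F.
rewrite GE; congr (hX n _); apply/ffunP => S; rewrite ffunE cherednik_xi // GE hXE.
rewrite /mquot; case: xgetP => [r _ /= rE | /(_ (G S)) /=]; last by rewrite mulrC.
have X0 : 'X_(io n) != 0 :> mp.
  apply/eqP => /(congr1 (mcoeff U_(io n))).
  by rewrite mcoeff0 mcoeffXU eqxx => /eqP; rewrite oner_eq0.
by apply: (mulIf X0); rewrite rE mulrC.
Qed.

Lemma dunkl_dunkl_op k F : (k <= n)%N ->
  dunkl q t (io k) F = dunkl_op n t hTl dlast k F.
Proof.
move=> kn; rewrite /dunkl /dunkl_op inordK //=.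
suff H d F' : (d <= n)%N ->
    dunkl_rec q t d (io (n - d)) F' = t ^ (- d%:Z) *: Tdn n hTl d (dlast (Tup n hTl d F')).
  have := H (n - k)%N F (leq_subr _ _); rewrite subKn // => ->.
  by congr (_ ^ _ *: _); lia.
elim: d F' => [|d IH] F' dn; first by rewrite subn0 /= expr0z scale1r.
have dS : (n - d = (n - d.+1).+1)%N by lia.
rewrite /= heckeT_hT; last lia. rewrite heckeT_hT; last lia.
rewrite inord_ordS; last lia. rewrite -dS IH; last exact: ltnW.
rewrite hTZ scalerA; congr (_ *: _).
by rewrite -exprN1 -expfzDr //; congr (_ ^ _); lia.
Qed.

End Links.

(** * Specialization *)

Section Specialize.
Variables (C : fieldType) (q0 t0 : C).
Local Notation K := {fraction {mpoly C[2]}}.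
Local Notation ev a := (a.@[tnth [tuple q0; t0]]).
Local Notation tofrac := (@FracField.tofrac {mpoly C[2]}).
Implicit Types (f : K) (c : C).

(* [f] has no pole at the point and takes the value [c] there.  All operators
   respect this relation, which transports identities over [C(q, t)] to the point. *)
Definition rel f c : Prop := exists a b, frac_repr_at q0 t0 f a b /\ c = ev a / ev b.

Lemma tofrac_neq0 (b : {mpoly C[2]}) : ev b != 0 -> tofrac b != 0.
Proof. by rewrite tofrac_eq0; apply: contraNneq => ->; rewrite meval0. Qed.

Lemma rel_fun f c c' : rel f c -> rel f c' -> c = c'.
Proof.
move=> [a [b [[b0 ->] ->]]] [a' [b' [[b'0 E] ->]]].
apply/eqP; rewrite eqr_div // -!mevalM; apply/eqP; congr (ev _).
move/eqP: E; rewrite eqr_div ?tofrac_neq0 // -!tofracM.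
by rewrite tofrac_eq => /eqP.
Qed.

Lemma relD f c f' c' : rel f c -> rel f' c' -> rel (f + f') (c + c').
Proof.
move=> [a [b [[b0 ->] ->]]] [a' [b' [[b'0 ->] ->]]].
exists (a * b' + a' * b), (b * b'); split; last by rewrite mevalD !mevalM addf_div.
split; first by rewrite mevalM mulf_neq0.
by rewrite tofracD !tofracM addf_div ?tofrac_neq0.
Qed.

Lemma relM f c f' c' : rel f c -> rel f' c' -> rel (f * f') (c * c').
Proof.
move=> [a [b [[b0 ->] ->]]] [a' [b' [[b'0 ->] ->]]].
exists (a * a'), (b * b'); split; last by rewrite !mevalM mulf_div.
split; first by rewrite mevalM mulf_neq0.
by rewrite !tofracM mulf_div.
Qed.

Lemma rel_poly (a : {mpoly C[2]}) : rel (tofrac a) (ev a).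
Proof.
exists a, 1; rewrite meval1 divr1; split=> //.
by split; [rewrite meval1 oner_eq0 | rewrite tofrac1 divr1].
Qed.

Lemma rel0 : rel 0 0.
Proof. by have := rel_poly 0; rewrite tofrac0 meval0. Qed.

Lemma rel1 : rel 1 1.
Proof. by have := rel_poly 1; rewrite tofrac1 meval1. Qed.

Lemma relN f c : rel f c -> rel (- f) (- c).
Proof.
have := rel_poly (- 1); rewrite tofracN tofrac1 mevalN meval1.
by move=> r1 rf; rewrite -mulN1r -(mulN1r c); exact: relM.
Qed.

Lemma relB f c f' c' : rel f c -> rel f' c' -> rel (f - f') (c - c').
Proof. by move=> rf rf'; apply: relD rf (relN rf'). Qed.

Lemma rel_inv f c : c != 0 -> rel f c -> rel f^-1 c^-1.
Proof.
move=> c0 [a [b [[b0 fE] cE]]]; move: c0; rewrite cE mulf_eq0 invr_eq0 negb_or => /andP[a0 _].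
exists b, a; rewrite invf_div; split=> //; split=> //.
by rewrite fE invf_div.
Qed.

Lemma relX f c e : rel f c -> rel (f ^+ e) (c ^+ e).
Proof. by move=> rf; elim: e => [|e IH]; [exact: rel1 | rewrite !exprS; exact: relM]. Qed.

Lemma relXz f c (e : int) : c != 0 -> rel f c -> rel (f ^ e) (c ^ e).
Proof.
move=> c0 rf; case: e => e; first exact: relX.
by rewrite !NegzE -!exprnN -!exprVn; apply/relX/rel_inv.
Qed.

Lemma rel_bool (b : bool) : rel b%:R b%:R.
Proof. by case: b; [exact: rel1 | exact: rel0]. Qed.

Lemma rel_q : rel qvar q0.
Proof. by have := rel_poly 'X_ord0; rewrite mevalXU. Qed.

Lemma rel_t : rel tvar t0.
Proof. by have := rel_poly 'X_ord_max; rewrite mevalXU. Qed.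

Lemma rel_eval f c : rel f c -> frac_eval q0 t0 f = c.
Proof.
move=> rf; rewrite /frac_eval; case: xgetP => [c' _ /= rc'|/(_ c) []//].
exact: rel_fun rc' rf.
Qed.

Lemma rel_regular f c : rel f c -> regular_at q0 t0 f.
Proof. by move=> [a [b [r _]]]; exists a, b. Qed.

Lemma rel_frac_eval f : regular_at q0 t0 f -> rel f (frac_eval q0 t0 f).
Proof.
move=> [a [b r]]; have rf : rel f (ev a / ev b) by exists a, b.
by rewrite (rel_eval rf).
Qed.

Lemma rel_sum (I : Type) (r : seq I) (P : pred I) (F : I -> K) (G : I -> C) :
  (forall i, P i -> rel (F i) (G i)) -> rel (\sum_(i <- r | P i) F i) (\sum_(i <- r | P i) G i).
Proof.
by move=> FG; elim/big_rec2: _ => [|i x y Pi]; [exact: rel0 | apply: relD; exact: FG].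
Qed.

Section Polynomials.
Variable N : nat.
Implicit Types (p r : {mpoly K[N]}) (x y : {mpoly C[N]}).

Definition relP p x : Prop := forall m, rel p@_m x@_m.

Lemma relP_fun p x y : relP p x -> relP p y -> x = y.
Proof. by move=> h h'; apply/mpolyP => m; exact: rel_fun (h m) (h' m). Qed.

Lemma relPD p x r y : relP p x -> relP r y -> relP (p + r) (x + y).
Proof. by move=> h h' m; rewrite !mcoeffD; exact: relD. Qed.

Lemma relPN p x : relP p x -> relP (- p) (- x).
Proof. by move=> h m; rewrite !mcoeffN; exact: relN. Qed.

Lemma relPM p x r y : relP p x -> relP r y -> relP (p * r) (x * y).
Proof. by move=> h h' m; rewrite !mcoeffM; apply: rel_sum => i _; exact: relM. Qed.

Lemma relPZ a c p x : rel a c -> relP p x -> relP (a *: p) (c *: x).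
Proof. by move=> h h' m; rewrite !mcoeffZ; exact: relM. Qed.

Lemma relPX m : relP 'X_[m] 'X_[m].
Proof. by move=> k; rewrite !mcoeffX; exact: rel_bool. Qed.

Lemma relP1 : relP 1 1.
Proof. by rewrite -!mpolyX0; exact: relPX. Qed.

Lemma relP0 : relP 0 0.
Proof. by move=> m; rewrite !mcoeff0; exact: rel0. Qed.

Lemma relP_exp p x e : relP p x -> relP (p ^+ e) (x ^+ e).
Proof. by move=> rp; elim: e => [|e IH]; [exact: relP1 | rewrite !exprS; exact: relPM]. Qed.

Lemma relP_sum (I : Type) (s : seq I) (P : pred I) (F : I -> {mpoly K[N]}) (G : I -> {mpoly C[N]}) :
  (forall i, P i -> relP (F i) (G i)) -> relP (\sum_(i <- s | P i) F i) (\sum_(i <- s | P i) G i).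
Proof.
by move=> FG; elim/big_rec2: _ => [|i x y Pi]; [exact: relP0 | apply: relPD; exact: FG].
Qed.

Lemma relP_prod (I : Type) (s : seq I) (P : pred I) (F : I -> {mpoly K[N]}) (G : I -> {mpoly C[N]}) :
  (forall i, P i -> relP (F i) (G i)) -> relP (\prod_(i <- s | P i) F i) (\prod_(i <- s | P i) G i).
Proof.
by move=> FG; elim/big_rec2: _ => [|i x y Pi]; [exact: relP1 | apply: relPM; exact: FG].
Qed.

Lemma relP_lext fK fC p x : (forall m, relP (fK m) (fC m)) -> relP p x ->
  relP (lext fK p) (lext fC x).
Proof.
move=> ff pp; rewrite (lextE fK (leq_maxl (msize p) (msize x))).
rewrite (lextE fC (leq_maxr (msize p) (msize x))).
by apply: relP_sum => m _; apply: relPZ.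
Qed.

Lemma relP_comp (l : N.-tuple {mpoly K[N]}) (l' : N.-tuple {mpoly C[N]}) p x :
  (forall i, relP (tnth l i) (tnth l' i)) -> relP p x -> relP (p \mPo l) (x \mPo l').
Proof.
move=> ll pp; rewrite (linear_lext (comp_mpoly l) p) (linear_lext (comp_mpoly l') x).
apply: relP_lext => // m; rewrite /= !comp_mpolyX.
by apply: relP_prod => i _; exact: relP_exp.
Qed.

Lemma relP_msym s p x : relP p x -> relP (msym s p) (msym s x).
Proof. by move=> pp m; rewrite !mcoeff_sym. Qed.

Lemma relP_dd i j p x : relP p x -> relP (dd i j p) (dd i j x).
Proof.
apply: relP_lext => m; rewrite /dmon.
have rdp b : relP (dpow K i j b) (dpow C i j b).
  by apply: relP_sum => k _; apply: relPM; apply: relP_exp; exact: relPX.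
have rXdp e b : relP (('X_i * 'X_j) ^+ e * dpow K i j b) (('X_i * 'X_j) ^+ e * dpow C i j b).
  by apply: relPM (rdp b); apply: relP_exp; apply: relPM; exact: relPX.
apply: relPM; first exact: relPX.
by case: ifP => _; [exact: rXdp | apply: relPN; exact: rXdp].
Qed.

(** Multiplication by a variable only shifts coefficients, so the division in D_N introduces no new
    denominator. *)
Lemma relP_divX i p x : relP ('X_i * p) ('X_i * x) -> relP p x.
Proof.
move=> h m; have := h (U_(i) + m)%MM.
by rewrite (mulrC 'X_i p) (mulrC 'X_i x) !(mcoeffMX _ U_(i)%MM m).
Qed.

(** With its default value at poles [frac_eval] is not additive on C(q,t), so the coefficient of
    each monomial is extracted by hand from the sum over the support. *)
Lemma relP_specialize p : (forall m, regular_at q0 t0 p@_m) ->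
  relP p (map_mpoly (frac_eval q0 t0) p).
Proof.
move=> rp m; rewrite /map_mpoly /mmap raddf_sum /=.
rewrite (eq_bigr (fun i => frac_eval q0 t0 p@_i * (i == m)%:R)); last first.
  by move=> i _; rewrite mmap1_id mul_mpolyC mcoeffZ mcoeffX.
have [mp|mp] := boolP (m \in msupp p).
  rewrite (big_rem m) //= eqxx mulr1 big_seq big1 ?addr0; first exact: rel_frac_eval.
  move=> i; rewrite mem_rem_uniq ?msupp_uniq // inE => /andP[/negPf -> _].
  by rewrite mulr0.
rewrite big_seq big1 => [|i ip]; first by rewrite memN_msupp_eq0 //; exact: rel0.
by have /negPf -> : i != m by [apply: contraNneq mp => <-]; rewrite mulr0.
Qed.

End Polynomials.

Section Operators.
Variables (n : nat) (tau : seq nat).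
Local Notation N := n.+1.
Hypotheses (htau : is_partition N tau) (n0 : (0 < n)%N).
Hypotheses (tK0 : (tvar : K) != 0) (qK0 : (qvar : K) != 0)
  (tKgen : forall b : int, b != 0 -> (tvar : K) ^ b != 1).
Hypotheses (tC0 : t0 != 0) (qC0 : q0 != 0) (tCgen : forall b : int, b != 0 -> t0 ^ b != 1).
Local Notation VK := (tabspace K N tau).
Local Notation VC := (tabspace C N tau).
Local Notation PK := (polytab K N tau).
Local Notation PC := (polytab C N tau).
Local Notation tvK := (fun k => @tv K n tau tvar k : {linear VK -> VK}).
Local Notation tvC := (fun k => @tv C n tau t0 k : {linear VC -> VC}).
Local Notation hTK := (fun k => @hT K n tau tvar k : {linear PK -> PK}).
Local Notation hTC := (fun k => @hT C n tau t0 k : {linear PC -> PC}).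
Local Notation hWK := (@hW K n tau qvar tvar).
Local Notation hWC := (@hW C n tau q0 t0).
Implicit Types (v : VK) (w : VC) (F G : PK) (A B : PC).

Definition relV v w : Prop := forall S, rel (v S) (w S).
Definition relF F A : Prop := forall S, relP (F S) (A S).

Lemma relVD v w u w1 : relV v w -> relV u w1 -> relV (v + u) (w + w1).
Proof. by move=> h h' S; rewrite !ffunE; exact: relD. Qed.

Lemma relVZ a c v w : rel a c -> relV v w -> relV (a *: v) (c *: w).
Proof. by move=> h h' S; rewrite !ffunE; exact: relM. Qed.

Lemma relV_tab S : relV (tab _ S) (tab _ S).
Proof. by move=> U; rewrite !ffunE; exact: rel_bool. Qed.

Lemma relFD F A G B : relF F A -> relF G B -> relF (F + G) (A + B).
Proof. by move=> h h' S; rewrite !ffunE; exact: relPD. Qed.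

Lemma relFN F A : relF F A -> relF (- F) (- A).
Proof. by move=> h S; rewrite !ffunE; exact: relPN. Qed.

Lemma relFZ a c F A : rel a c -> relF F A -> relF (a *: F) (c *: A).
Proof. by move=> h h' S; rewrite !ffunE; exact: relPZ. Qed.

Lemma relF_fun F A B : relF F A -> relF F B -> A = B.
Proof. by move=> h h'; apply/ffunP => S; exact: relP_fun (h S) (h' S). Qed.

Lemma relF_tens p x v w : relP p x -> relV v w -> relF (tens p v) (tens x w).
Proof. by move=> h h' S; rewrite !ffunE; exact: relPZ. Qed.

Lemma rel_tX (b : int) : rel (tvar ^ b) (t0 ^ b).
Proof. exact: relXz rel_t. Qed.

Lemma rel_t1 (b : int) : b != 0 -> rel (tvar ^ b - 1)^-1 (t0 ^ b - 1)^-1.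
Proof. by move=> b0; apply: rel_inv; [rewrite subr_eq0 tCgen | apply: relB rel1; exact: rel_tX]. Qed.

Lemma rel_phi b : b != 0 -> rel (phi tvar b) (phi t0 b).
Proof.
move=> b0; rewrite /phi; apply: relM (rel_t1 b0); apply: relM (rel_tX _) _.
exact: relB rel_t rel1.
Qed.

Lemma rel_psi b : b != 0 -> rel (psi tvar b) (psi t0 b).
Proof.
move=> b0; rewrite /psi; case: ifP => _; first exact: rel0.
case: ifP => _; first exact: rel1.
rewrite -!exprVn; apply: relM; last exact: relX (rel_t1 b0).
apply: relM; [apply: relM rel_t _|]; apply: relB rel1; exact: rel_tX.
Qed.

(** The denominators of T_k on tableaux are powers of t^b - 1 with b a nonzero difference of
    contents, which do not vanish at the point. *)
Lemma relV_tv k v w : (k < n)%N -> relV v w -> relV (tvK k v) (tvC k w).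
Proof.
move=> kn vv; rewrite [v]tab_sum [w]tab_sum (linear_sum (tvK k)) (linear_sum (tvC k)).
move=> U; rewrite !sum_ffunE; apply: rel_sum => S _.
have b0 : cdiff S k != 0 := cdiff_neq0 htau tC0 tCgen S kn.
have -> : tvK k (v S *: tab K S) =
    v S *: (phi tvar (cdiff S k) *: tab K S + psi tvar (cdiff S k) *: tab K (stab S k)).
  by rewrite -(tv_tab htau tK0 tKgen S kn); exact: linearZ.
have -> : tvC k (w S *: tab C S) =
    w S *: (phi t0 (cdiff S k) *: tab C S + psi t0 (cdiff S k) *: tab C (stab S k)).
  by rewrite -(tv_tab htau tC0 tCgen S kn); exact: linearZ.
apply: relVZ => //; apply: relVD; apply: relVZ; try exact: relV_tab.
  exact: rel_phi.
exact: rel_psi.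
Qed.

Lemma relF_opP fK fC gK gC F A : (forall p x, relP p x -> relP (fK p) (fC x)) ->
  (forall S, relV (gK (tab K S)) (gC (tab C S))) -> relF F A ->
  relF (opP fK gK F) (opP fC gC A).
Proof.
move=> ff gg FF U; rewrite /opP !sum_ffunE; apply: relP_sum => S _.
by apply: relF_tens; [exact: ff | exact: gg].
Qed.

Lemma relF_hT k F A : (k < n)%N -> relF F A -> relF (hTK k F) (hTC k A).
Proof.
move=> kn FF; apply: relFD; last first.
  apply: relF_opP (FF) => [p x|S]; first exact: relP_msym.
  by apply: relV_tv kn _; exact: relV_tab.
apply: relF_opP (FF) => [p x pp|S]; last exact: relV_tab.
apply: relPZ; first exact: relB rel1 rel_t.
by apply: relPM; [exact: relPX | exact: relP_dd].
Qed.

Lemma relV_Tup d v w : (d <= n)%N -> relV v w -> relV (Tup n tvK d v) (Tup n tvC d w).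
Proof.
elim: d v w => // d IH v w dn vv; apply: IH (ltnW dn) _.
by apply: relV_tv => //; lia.
Qed.

Lemma relF_hW F A : relF F A -> relF (hWK F) (hWC A).
Proof.
apply: relF_opP => [p x|S].
  apply: relP_comp => i; rewrite !tnth_mktuple.
  by case: ifP => _; [apply: relPZ rel_q _|]; exact: relPX.
by apply: relV_Tup => //; exact: relV_tab.
Qed.

Lemma relF_hX k F A : relF F A -> relF (hX k F) (hX k A).
Proof.
apply: relF_opP => [p x pp|S]; last exact: relV_tab.
by apply: relPM => //; exact: relPX.
Qed.

Lemma relF_divX k F A : relF (hX k F) (hX k A) -> relF F A.
Proof. by move=> h S; have := h S; rewrite !hXE; exact: relP_divX. Qed.

Lemma relF_Tinv k F A : (k < n)%N -> relF F A ->
  relF (Tinv tvar hTK k F) (Tinv t0 hTC k A).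
Proof.
move=> kn FF; apply: relFZ; first exact: rel_inv tC0 rel_t.
by apply: relFD; [exact: relF_hT | apply: relFZ FF; exact: relB rel1 rel_t].
Qed.

Lemma relF_Tidn k F A : (k <= n)%N -> relF F A ->
  relF (Tidn tvar hTK k F) (Tidn t0 hTC k A).
Proof.
by elim: k F A => // k IH F A kn FF; apply: IH (ltnW kn) _; exact: relF_Tinv.
Qed.

Lemma relF_Tup d F A : (d <= n)%N -> relF F A -> relF (Tup n hTK d F) (Tup n hTC d A).
Proof.
by elim: d F A => // d IH F A dn FF; apply: IH (ltnW dn) _; apply: relF_hT => //; lia.
Qed.

Lemma relF_Tdn d F A : (d <= n)%N -> relF F A -> relF (Tdn n hTK d F) (Tdn n hTC d A).
Proof.
by elim: d => // d IH dn FF; apply: relF_hT; [lia | exact: IH (ltnW dn) FF].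
Qed.

Lemma relF_xi k F A : (k <= n)%N -> relF F A ->
  relF (xi n tvar hTK hWK k F) (xi n t0 hTC hWC k A).
Proof.
move=> kn FF; apply: relFZ (rel_tX _) _; apply: relF_Tdn; first exact: leq_subr.
by apply: relF_hW; exact: relF_Tidn.
Qed.

Lemma relF_dlast F A : relF F A -> relF (dlast qvar tvar F) (dlast q0 t0 A).
Proof.
move=> FF; apply: (@relF_divX n); rewrite (dlastE htau n0 qK0 tK0 tKgen) (dlastE htau n0 qC0 tC0 tCgen).
by apply: relFD (relFN _) => //; exact: relF_xi.
Qed.

Lemma relF_dunkl k F A : (k <= n)%N -> relF F A ->
  relF (dunkl qvar tvar (inord k) F) (dunkl q0 t0 (inord k) A).
Proof.
move=> kn FF.
rewrite (dunkl_dunkl_op qvar n0 tK0 F kn).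
rewrite (dunkl_dunkl_op q0 n0 tC0 A kn).
rewrite /dunkl_op.
apply: relFZ; first exact: rel_tX.
apply: relF_Tdn (leq_subr _ _) _.
apply: relF_dlast.
exact: relF_Tup (leq_subr _ _) FF.
Qed.

Lemma relF_specialize F : no_pole_at q0 t0 F -> relF F (specialize q0 t0 F).
Proof. by move=> rF S; rewrite ffunE; apply: relP_specialize => m; exact: rF. Qed.

End Operators.

End Specialize.

(** * Leading coefficients *)

Section LeadingCoefficient.
Variables (K : fieldType) (n : nat) (tau : seq nat) (q t : K).
Local Notation N := n.+1.
Hypothesis htau : is_partition N tau.
Hypotheses (n0 : (0 < n)%N) (q0 : q != 0) (t0 : t != 0)
  (tgen : forall b : int, b != 0 -> t ^ b != 1)
  (qtgen : forall (a : nat) (b : int), q ^+ a * t ^ b = 1 -> a = 0%N /\ b = 0).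
Local Notation V := (tabspace K N tau).
Local Notation P := (polytab K N tau).
Local Notation mp := {mpoly K[N]}.
Local Notation tab := (@tab K N tau).
Local Notation io := (@inord n).
Local Notation tv := (@tv K n tau t).
Local Notation tvl := (fun k => tv k : {linear V -> V}).
Local Notation hT := (@hT K n tau t).
Local Notation hW := (@hW K n tau q t).
Local Notation hX := (@hX K n tau).
Local Notation hTl := (fun k => hT k : {linear P -> P}).
Local Notation hWl := (hW : {linear P -> P}).
Local Notation hXl := (fun k => hX k : {linear P -> P}).
Local Notation sigma := (@sigma K n q).
Local Notation delta := (@delta K n tau t).
Local Notation vac := (@vac K n tau).
Local Notation macd := (macd n q t hTl hWl hXl (@ct n tau) vac).
Local Notation dns := (dns n q t hTl).
Implicit Types (v : V) (p : mp) (F : P) (S : rsyt N tau) (j : 'I_N).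

Let MM := tensor_model htau n0 q0 t0 tgen qtgen.

Definition lead d j F : V := [ffun S => (F S)@_(U_(j) *+ d)%MM].

Lemma leadD d j F G : lead d j (F + G) = lead d j F + lead d j G.
Proof. by apply/ffunP => S; rewrite !ffunE mcoeffD. Qed.

Lemma leadZ d j a F : lead d j (a *: F) = a *: lead d j F.
Proof. by apply/ffunP => S; rewrite !ffunE mcoeffZ. Qed.

Lemma mcoeffXM0 j p (m : 'X_{1..N}) : m j = 0%N -> ('X_j * p)@_m = 0.
Proof.
move=> mj; apply/eqP; rewrite mcoeff_eq0 mulrC (perm_mem (msuppMX p U_(j)%MM)).
apply/mapP => -[k _ mE]; move: mj; rewrite mE mnmDE mnm1E eqxx.
by [].
Qed.

Lemma lead_msym d j (i k : 'I_N) p :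
  (msym (tperm i k) p)@_(U_(j) *+ d)%MM = p@_(U_(tperm i k j) *+ d)%MM.
Proof.
rewrite mcoeff_sym; congr mcoeff; apply/mnmP => l; rewrite mnmE !mulmnE !mnm1E.
by rewrite -(inj_eq (@perm_inj _ (tperm i k)) j) tpermK.
Qed.

(** The divided-difference part of T_k is a multiple of x_(k+1), hence invisible in a power of any
    other variable; only the permutation part contributes. *)
Lemma lead_hT d k j F : j != io k.+1 ->
  lead d j (hT k F) = tv k (lead d (tperm (io k) (io k.+1) j) F).
Proof.
move=> jk; rewrite [X in tv k X]tab_sum linear_sum; apply/ffunP => U.
rewrite sum_ffunE ffunE /hT ffunE mcoeffD /opP !sum_ffunE !raddf_sum /=.
rewrite big1 ?add0r => [|S _]; last first.
  rewrite ffunE mcoeffZ /Ak /Aop mcoeffZ mcoeffXM0 ?mulr0 //.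
  by rewrite mulmnE mnm1E (negPf jk).
apply: eq_bigr => S _; rewrite ffunE mcoeffZ lead_msym.
have -> : tv k (lead d (tperm (io k) (io k.+1) j) F S *: tab S) =
  lead d (tperm (io k) (io k.+1) j) F S *: tv k (tab S) by exact: linearZ.
by rewrite !ffunE mulrC.
Qed.

Lemma lead_hX d F : lead d.+1 (io n) (hX n F) = lead d (io n) F.
Proof.
apply/ffunP => S; rewrite !ffunE hXE mulrC mulmS.
exact: mcoeffMX.
Qed.

Lemma lead_hX0 d j F : j != io n -> lead d j (hX n F) = 0.
Proof.
move=> jn; apply/ffunP => S; rewrite !ffunE hXE mcoeffXM0 //.
by rewrite mulmnE mnm1E (negPf jn).
Qed.

Lemma sigma_mono (m : 'X_{1..N}) :
  sigma 'X_[m] = q ^+ m (io 0) *: 'X_[[multinom m (ordS i) | i < N]].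
Proof.
rewrite /sigma comp_mpolyX.
under eq_bigr => i _ do rewrite tnth_mktuple.
rewrite [X in _ = _ *: X]mpolyXE_id.
rewrite [X in _ = _ *: X](reindex_inj (@ord_pred_inj N)) /=.
rewrite (bigD1 (io 0)) //= [X in _ = _ *: X](bigD1 (io 0)) //= inordK // eqxx exprZn -scalerAl.
congr (_ *: (_ * _)).
  by rewrite mnmE ord_predK.
apply: eq_bigr => i i0; rewrite mnmE ord_predK ifN //.
by apply: contraNneq i0 => i0; apply/eqP/val_inj; rewrite /= inordK.
Qed.

Lemma lead_sigma d p :
  (sigma p)@_(U_(io n) *+ d)%MM = q ^+ d * p@_(U_(io 0) *+ d)%MM.
Proof.
have pE k : p@_k = \sum_(m <- msupp p) p@_m * (m == k)%:R.
  by rewrite {1}[p]mpolyE raddf_sum; apply: eq_bigr => m _; rewrite /= mcoeffZ mcoeffX.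
rewrite (linear_lext sigma p) /lext raddf_sum [in RHS]pE mulr_sumr.
apply: eq_bigr => m _; rewrite /= sigma_mono !mcoeffZ !mcoeffX.
have -> : ([multinom m (ordS i) | i < N] == (U_(io n) *+ d)%MM) = (m == (U_(io 0) *+ d)%MM).
  have ioE : ordS (io n) = io 0.
    by apply: val_inj; rewrite /= !inordK // modnn.
  apply/eqP/eqP => [/mnmP mE|->]; apply/mnmP => i.
    have := mE (ord_pred i); rewrite mnmE ord_predK => ->.
    rewrite !mulmnE !mnm1E -ioE -(inj_eq (@ordS_inj N)) ord_predK.
    by [].
  by rewrite mnmE !mulmnE !mnm1E -ioE (inj_eq (@ordS_inj N)).
have [->|_] := eqVneq m _; last by rewrite !mulr0.
by rewrite !mulr1 mulmnE mnm1E eqxx mul1n mulrC.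
Qed.

Lemma lead_hW d F : lead d (io n) (hW F) = q ^+ d *: delta (lead d (io 0) F).
Proof.
have -> : delta (lead d (io 0) F) = \sum_S lead d (io 0) F S *: delta (tab S).
  rewrite {1}[lead _ _ _]tab_sum (linear_sum delta); apply: eq_bigr => S _; exact: linearZ.
rewrite scaler_sumr; apply/ffunP => U.
rewrite sum_ffunE ffunE /hW /opP sum_ffunE raddf_sum; apply: eq_bigr => S _.
rewrite /= !ffunE mcoeffZ lead_sigma.
by rewrite /GRing.scale /= mulrC -mulrA.
Qed.

(** The second half is the invariant that drives the induction: powers of variables before the
    current place are absent, so the scalar part of each intertwiner does not contribute to the next
    leading coefficient. *)
Lemma lead_dns m c e d F : (d <= n)%N ->
  (forall i, (i < n)%N -> lead e (io i) F = 0) ->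
  lead e (io (n - d)) (dns m c d F) = Tdn n tvl d (lead e (io n) F) /\
  forall i, (i < n - d)%N -> lead e (io i) (dns m c d F) = 0.
Proof.
move=> dn F0; elim: d dn => [|d IH] dn; first by rewrite subn0.
have [E1 E0] := IH (ltnW dn); set k := (n - d.+1)%N.
have kn : (k < n)%N by rewrite /k; lia.
have dE : (n - d = k.+1)%N by rewrite /k; lia.
rewrite dE in E1 E0.
set a := ac t (t ^ c k.+1) (q ^+ m * t ^ c 0%N).
have dnsS : dns m c d.+1 F = hT k (dns m c d F) + a *: dns m c d F by reflexivity.
have nk : io k != io k.+1 by apply: inord_neq; lia.
split=> [|i ik]; rewrite dnsS leadD leadZ.
  by rewrite E0 // scaler0 addr0 lead_hT // tpermL E1.
have i1 : io i != io k.+1 by apply: inord_neq; lia.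
have i2 : io i != io k by apply: inord_neq; lia.
rewrite E0; last by lia.
rewrite scaler0 addr0 lead_hT // tpermD 1?eq_sym // E0; last by lia.
exact: linear0.
Qed.

Lemma tdn_tens d v : Tdn n hTl d (tens 1 v) = tens 1 (Tdn n tvl d v).
Proof. by elim: d => //= d ->; exact: hT_const. Qed.

Lemma tens1_inj v v' : tens 1 v = tens 1 v' :> P -> v = v'.
Proof.
move=> /ffunP vv; apply/ffunP => S; have := vv S; rewrite !ffunE.
by move=> /(congr1 (mcoeff 0%MM)); rewrite !mcoeffZ mcoeff1 eqxx !mulr1.
Qed.

(** A Jucys-Murphy eigenvalue, read off from the action of xi_0 on 1 (x) S. *)
Lemma Tdn_delta S :
  Tdn n tvl n (delta (tab S)) = t ^ (n%:Z + ct S 0) *: tab S.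
Proof.
have := xi_vac htau n0 q0 t0 tgen S (leq0n n).
rewrite /xi subn0 /= {1}/vac hW_tens (rmorph1 sigma) tdn_tens /vac -!tensZr.
move=> /tens1_inj /(congr1 (fun v => t ^ (n%:Z) *: v)).
rewrite !scalerA -!expfzDr //.
have -> : n%:Z + (0%:Z - n%:Z) = 0 by lia.
by rewrite expr0z scale1r.
Qed.

(** A monomial in q and t is a unit at the special point, so passing to the prescribed normalization
    creates neither a pole nor a zero. *)
Lemma lead_macd m S :
  exists a b : int, lead m (io 0) (macd m S) = (q ^ a * t ^ b) *: tab S.
Proof.
elim: m => [|m [a [b IH]]].
  exists 0, 0; rewrite !expr0z mulr1 scale1r; apply/ffunP => U; rewrite !ffunE.
  by rewrite mulm0n mcoeffZ mcoeff1 eqxx mulr1.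
have [|E _] := @lead_dns m.+1 (ct S) m.+1 n (hX n (hW (macd m S))) (leqnn n).
  by move=> i ilt; apply: lead_hX0; apply: inord_neq; lia.
exists (m%:Z + a), (b + (n%:Z + ct S 0)).
rewrite subnn in E.
have -> : macd m.+1 S = dns m.+1 (ct S) n (hX n (hW (macd m S))) by reflexivity.
rewrite E lead_hX lead_hW IH.
have -> : delta ((q ^ a * t ^ b) *: tab S) = (q ^ a * t ^ b) *: delta (tab S).
  exact: linearZ.
rewrite scalerA.
have -> (a' : K) : Tdn n tvl n (a' *: delta (tab S)) = a' *: (t ^ (n%:Z + ct S 0) *: tab S).
  by rewrite -Tdn_delta; exact: linearZ.
rewrite scalerA.
have -> : q ^ (m%:Z + a) = q ^+ m * q ^ a by rewrite expfzDr.
have -> : t ^ (b + (n%:Z + ct S 0)) = t ^ b * t ^ (n%:Z + ct S 0) by rewrite [LHS]expfzDr.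
by rewrite !mulrA.
Qed.

End LeadingCoefficient.

Section OneRow.
Variables (n m : nat).
Local Notation N := n.+1.
Local Notation alpha := [multinom if i == ord0 then m else 0%N | i < N].

Lemma alphaE : alpha = (U_(ord0) *+ m)%MM.
Proof. by apply/mnmP => i; rewrite mulmnE mnm1E mnmE eq_sym; case: eqVneq => _; rewrite ?mul1n. Qed.

Lemma mdeg_alpha : mdeg alpha = m.
Proof. by rewrite alphaE mdegMn mdeg1 mul1n. Qed.

Lemma alpha_sorted : mnm_plus alpha = alpha.
Proof.
have srt : sorted geq alpha.
  apply: (path_sorted (x := m)); apply/(pathP 0%N) => i.
  rewrite size_tuple => iN.
  have nthE k : (k < N)%N -> nth 0%N alpha k = if k == 0%N then m else 0%N.
    by move=> kN; rewrite -[k]/(val (Ordinal kN)) -mnm_nth mnmE.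
  rewrite nthE //; case: i iN => [|i] iN /=; first exact: leqnn.
  by rewrite /geq /= leq0n.
have E : sort geq alpha = alpha :> seq nat.
  by apply: sorted_sort srt => a b c; rewrite /geq /= => ba cb; exact: leq_trans cb ba.
apply/mnmP => i; rewrite [LHS]mnmE (mnm_nth 0%N).
exact: (congr1 (fun s => nth 0%N s i) E).
Qed.

(** Equal entries are ranked by position, so the rank function of a nonincreasing composition is the
    identity. *)
Lemma rank_alpha i : rank_ord alpha i = i.
Proof.
apply: val_inj; rewrite /= /rank.
have -> : [set j : 'I_N | (i < j)%N && (alpha i < alpha j)%N] = finset.set0.
  apply/setP => j; rewrite !inE !mnmE; apply/negbTE/negP => /andP[ij].
  by have /negPf -> : j != ord0 by apply: contraTneq ij => ->.
rewrite cards0 addn0.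
have -> : [set j : 'I_N | (j <= i)%N && (alpha i <= alpha j)%N] = [set j : 'I_N | (j <= i)%N].
  apply/setP => j; rewrite !inE !mnmE; case: (eqVneq i ord0) => [->|i0]; last by rewrite andbT.
  by rewrite leqn0 -[j == 0%N :> nat]/(j == ord0); case: eqVneq => //= _; rewrite leqnn.
suff -> : #|[set j : 'I_N | (j <= i)%N]| = i.+1 by [].
have wI : injective (widen_ord (ltn_ord i)).
  by move=> a b /(congr1 val) /= /val_inj.
rewrite -[RHS](card_ord i.+1) -(card_imset _ wI).
apply: eq_card => j; rewrite inE; apply/idP/imsetP => [ji|[k _ ->]]; last first.
  by have := ltn_ord k; rewrite ltnS.
by exists (Ordinal (ji : j < i.+1)%N) => //; apply: val_inj.
Qed.

End OneRow.

Lemma exprz_root (F : unitRingType) (x : F) (d : nat) (e : int) :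
  x ^+ d = 1 -> (x ^ e) ^+ d = 1.
Proof. by move=> xd; rewrite exprnP exprz_exp mulrC -exprz_exp -exprnP xd exp1rz. Qed.

(** * The special point *)

Section RootsOfUnity.
Variable R : realType.
Implicit Types x y : R.

Lemma cexpiD x y : cexpi (x + y) = cexpi x * cexpi y.
Proof. by apply/eqP; rewrite eq_complex /= cosD sinD addrC [cos x * _ + _]addrC !eqxx. Qed.

Lemma cexpi0 : cexpi (0 : R) = 1.
Proof. by rewrite /cexpi cos0 sin0. Qed.

Lemma cexpiMn x d : cexpi (x *+ d) = cexpi x ^+ d.
Proof. by elim: d => [|d IH]; rewrite ?cexpi0 // mulrS cexpiD IH exprS. Qed.

Lemma cexpiN x : cexpi (- x) = (cexpi x)^-1.
Proof.
have U : cexpi x * cexpi (- x) = 1 by rewrite -cexpiD subrr cexpi0.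
have x0 : cexpi x != 0 by apply: contra_eq_neq U => ->; rewrite mul0r eq_sym oner_eq0.
by apply: (mulfI x0); rewrite U mulfV.
Qed.

Lemma cexpiMz x (d : int) : cexpi (x *~ d) = cexpi x ^ d.
Proof. by case: d => d; [exact: cexpiMn | rewrite NegzE mulrNz cexpiN cexpiMn exprnN]. Qed.

(** If the real part cos(2y) is 1 with y = pi r / m, then sin(y) = 0, which is impossible for 0 < y
    < pi. *)
Lemma cexpi_prim m r : (0 < r < m)%N -> cexpi (2 * pi / m%:R : R) ^+ r != 1.
Proof.
move=> /andP[r0 rm]; rewrite -cexpiMn; apply/eqP => /(congr1 (@complex.Re R)) /=.
set y : R := pi * r%:R / m%:R.
have m0 : (0 < m)%N by lia.
have mR : (0 : R) < m%:R by rewrite ltr0n.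
have -> : 2 * pi / m%:R *+ r = y *+ 2.
  by rewrite /y -[LHS]mulr_natr -[RHS]mulr_natr; field; rewrite gt_eqF.
have : 0 < sin y.
  apply: sin_gt0_pi; rewrite /y divr_gt0 ?mulr_gt0 ?pi_gt0 ?ltr0n //=.
  by rewrite ltr_pdivrMr // ltr_pM2l ?pi_gt0 // ltr_nat.
have := cos2Dsin2 y; rewrite cos_mulr2n => E s0 c1.
have : 0 < sin y ^+ 2 by rewrite exprn_gt0.
suff -> : sin y ^+ 2 = 0 by rewrite ltxx.
by move: E c1; rewrite mulr2n => E c1; lra.
Qed.

Lemma cexpi_root m : (0 < m)%N -> cexpi (2 * pi / m%:R : R) ^+ m = 1.
Proof.
move=> m0; rewrite -cexpiMn -[_ *+ m]mulr_natr divfK ?pnatr_eq0 -?lt0n //.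
by rewrite mulrC mulr_natr /cexpi cos2pi sin2pi.
Qed.

Lemma cexpi_eq1 m (d : int) : (0 < m)%N -> cexpi (2 * pi / m%:R : R) ^ d = 1 -> (m %| `|d|)%N.
Proof.
move=> m0 E; set w := cexpi _ in E.
have wm : w ^+ m = 1 by exact: cexpi_root.
have w0 : w != 0 by apply: contra_eq_neq wm => ->; rewrite expr0n gtn_eqF // eq_sym oner_eq0.
have mz : m%:Z != 0 by rewrite eqz_nat -lt0n.
have := divz_eq d m; have := modz_ge0 d mz; have := ltz_pmod d (m0 : 0 < m%:Z).
case: (d %% m)%Z => // r rm _ dE.
have : w ^+ r = 1.
  have Em : w ^ ((d %/ m)%Z * m%:Z) = 1 by rewrite mulrC -exprz_exp -exprnP wm exp1rz.
  by move: E; rewrite {1}dE expfzDr // Em mul1r.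
have [r0|r0] := posnP r => wr.
  have -> : d = (d %/ m)%Z * m%:Z by rewrite {1}dE r0; exact: addr0.
  by rewrite abszM dvdn_mull.
rewrite ltz_nat in rm.
by have := cexpi_prim (m := m) (r := r); rewrite -/w wr eqxx r0 rm => /(_ isT).
Qed.

End RootsOfUnity.

Section SpecialPoint.
Variables (C : fieldType) (u omega : C) (m : nat) (n k : int).
Hypotheses (m0 : (0 < m)%N) (n0 : n != 0) (u0 : u != 0)
  (ugen : forall j : nat, (0 < j)%N -> u ^+ j != 1)
  (omega_m : omega ^+ m = 1)
  (omega_prim : forall a : nat, omega ^+ a = 1 -> (m %| a * `|k|)%N).
Local Notation g := (gcdn m `|n|).
Hypothesis kg : coprime `|k| g.
Local Notation q0 := (omega * u ^ (- (n %/ g%:Z)%Z)).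
Local Notation t0 := (u ^ (m %/ g)%N%:Z).

Let g0 : (0 < g)%N.
Proof. by rewrite gcdn_gt0 m0. Qed.

Let nE : (n %/ g%:Z)%Z * g%:Z = n.
Proof. by apply: divzK; rewrite dvdzE /= dvdn_gcdr. Qed.

Let mE : (m %/ g * g = m)%N.
Proof. by rewrite divnK // dvdn_gcdl. Qed.

Let omega0 : omega != 0.
Proof. by apply: contra_eq_neq omega_m => ->; rewrite expr0n gtn_eqF // eq_sym oner_eq0. Qed.

Lemma gen_exprz (e : int) : u ^ e = 1 -> e = 0.
Proof.
case: e => [[|e]|e] //; first by move/eqP; rewrite (negPf (ugen _)).
by move/eqP; rewrite NegzE -exprnN invr_eq1 (negPf (ugen _)).
Qed.

Lemma special_q0 : q0 != 0.
Proof. by rewrite mulf_neq0 // expfz_neq0. Qed.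

Lemma special_t0 : t0 != 0.
Proof. by rewrite expfz_neq0. Qed.

Let mg0 : (0 < m %/ g)%N.
Proof. by rewrite divn_gt0 // dvdn_leq // dvdn_gcdl. Qed.

Lemma special_tgen (b : int) : b != 0 -> t0 ^ b != 1.
Proof.
move=> b0; apply/eqP; rewrite exprz_exp => /gen_exprz/eqP.
by rewrite mulf_eq0 (negPf b0) orbF; move: mg0; case: (m %/ g)%N.
Qed.

Let qtE (a : nat) (b : int) :
  q0 ^+ a * t0 ^ b = omega ^+ a * u ^ ((m %/ g)%N%:Z * b - (n %/ g%:Z)%Z * a%:Z).
Proof.
rewrite exprMn -mulrA; congr (_ * _).
by rewrite (exprnP _ a) !exprz_exp -expfzDr // mulNr addrC.
Qed.

(** The exponents of u cancel, as (m/g) n = (n/g) m. This is the equation that puts X at t^z. *)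
Lemma special_qm : q0 ^+ m * t0 ^ n = 1.
Proof.
have mz (A B G : int) : B * G = n -> A * G = m%:Z -> A * n - B * m%:Z = 0.
  by move=> <- <-; ring.
rewrite qtE omega_m mul1r (mz _ _ _ nE) ?expr0z //.
by rewrite -PoszM mE.
Qed.

(** The m-th power removes omega, so the exponent of u is 0: (m/g) b = (n/g) a. As m/g and n/g are
    coprime, a = a' (m/g), and omega^a = 1 then gives that g divides a' k. By coprimality of k and g
    it divides a', so m divides a, against 0 < a < m. *)
Lemma special_neq (a : nat) (b : int) : (0 < a < m)%N -> q0 ^+ a * t0 ^ b != 1.
Proof.
move=> /andP[a0 am]; rewrite qtE; set e := (_ - _ : int); apply/eqP => E.
have e0 : e = 0.
  have : (omega ^+ a * u ^ e) ^+ m = 1 by rewrite E expr1n.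
  rewrite exprMn -exprM mulnC exprM omega_m expr1n mul1r exprnP exprz_exp.
  move=> /gen_exprz/eqP; rewrite mulf_eq0 => /orP[/eqP //|].
  by move: m0; case: (m).
move: E; rewrite e0 expr0z mulr1 => /omega_prim mak.
have /(congr1 absz) : (m %/ g)%N%:Z * b = (n %/ g%:Z)%Z * a%:Z.
  by apply/eqP; rewrite -subr_eq0 -/e e0.
rewrite !abszM /= => E.
have nA : (`|n| = `|(n %/ g%:Z)%Z| * g)%N by rewrite -[in LHS]nE abszM.
have cop : coprime (m %/ g) `|(n %/ g%:Z)%Z|.
  rewrite /coprime -(eqn_pmul2r g0) mul1n muln_gcdl mE -nA; exact: eqxx.
have /dvdnP[a' aE] : (m %/ g %| a)%N by rewrite -(Gauss_dvdr _ cop) -E dvdn_mulr.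
have : (g %| a' * `|k|)%N.
  have : (m %/ g * g %| m %/ g * (a' * `|k|))%N by rewrite mE mulnA [(m %/ g * a')%N]mulnC -aE.
  by rewrite dvdn_pmul2l.
rewrite mulnC Gauss_dvdr 1?coprime_sym // => ga.
have : (m %/ g * g %| a' * (m %/ g))%N by rewrite [(_ * g)%N]mulnC dvdn_pmul2r.
by rewrite mE -aE; move/(dvdn_leq a0); rewrite leqNgt am.
Qed.

End SpecialPoint.

Section GenericPoint.
Variable C : fieldType.
Local Notation K := {fraction {mpoly C[2]}}.

Lemma tvar_neq0 : (tvar : K) != 0.
Proof.
rewrite /tvar tofrac_eq0; apply/eqP => /(congr1 (mcoeff U_(ord_max))).
by rewrite mcoeff0 mcoeffXU eqxx => /eqP; rewrite oner_eq0.
Qed.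

Lemma qvar_neq0 : (qvar : K) != 0.
Proof.
rewrite /qvar tofrac_eq0; apply/eqP => /(congr1 (mcoeff U_(ord0))).
by rewrite mcoeff0 mcoeffXU eqxx => /eqP; rewrite oner_eq0.
Qed.

Lemma mono_inj (a b c : nat) : (qvar : K) ^+ a * tvar ^+ b = tvar ^+ c -> a = 0%N /\ b = c.
Proof.
rewrite /qvar /tvar -!tofracXn -tofracM => /eqP; rewrite tofrac_eq => /eqP.
rewrite !mpolyXn -mpolyXD => /(congr1 (mcoeff (U_(ord_max) *+ c)%MM)) /eqP.
rewrite !mcoeffX eqxx.
have [/mnmP E _|_] := altP ((U_(ord0) *+ a + U_(ord_max) *+ b)%MM =P (U_(ord_max) *+ c)%MM);
  last by rewrite eq_sym oner_eq0.
have := E ord0; have := E ord_max; rewrite !mnmDE !mulmnE !mnm1E /=.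
by rewrite !mul0n !mul1n add0n addn0.
Qed.

Lemma generic_qt (a : nat) (b : int) : (qvar : K) ^+ a * tvar ^ b = 1 -> a = 0%N /\ b = 0.
Proof.
case: b => b.
  by move=> /(mono_inj (c := 0)) [-> ->].
rewrite NegzE -exprnN => /(canRL (mulfVK _)); rewrite mul1r => E.
have /mono_inj [] // : (qvar : K) ^+ a * tvar ^+ 0 = tvar ^+ b.+1.
by rewrite mulr1 E // expf_neq0 // tvar_neq0.
Qed.

Lemma generic_t (b : int) : b != 0 -> (tvar : K) ^ b != 1.
Proof.
by apply: contra_neq => E; have [] := @generic_qt 0 b; rewrite ?expr0 ?mul1r.
Qed.

End GenericPoint.

(** * Singularity *)

Section Uniqueness.
Variables (K : fieldType) (n : nat) (tau : seq nat) (q t : K).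
Local Notation N := n.+1.
Hypothesis htau : is_partition N tau.
Hypotheses (n0 : (0 < n)%N) (q0 : q != 0) (t0 : t != 0)
  (tgen : forall b : int, b != 0 -> t ^ b != 1)
  (qtgen : forall (a : nat) (b : int), q ^+ a * t ^ b = 1 -> a = 0%N /\ b = 0).
Local Notation P := (polytab K N tau).
Local Notation io := (@inord n).
Local Notation hTl := (fun k => @hT K n tau t k : {linear P -> P}).
Local Notation hWl := (@hW K n tau q t : {linear P -> P}).
Local Notation hXl := (fun k => @hX K n tau k : {linear P -> P}).
Local Notation macd := (macd n q t hTl hWl hXl (@ct n tau) (@vac K n tau)).
Local Notation dlast := (@dlast K n tau q t).
Implicit Types (F : P) (S : rsyt N tau).

Lemma triangle_irr (a : 'X_{1..N}) : triangle a a = false.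
Proof. by rewrite /triangle /dominates !eqxx. Qed.

(** The composition is already sorted, so the shortest word is empty and the leading vector is S
    itself. The spectral vector makes F a multiple of [macd m S], and both leading coefficients are
    monomials in q and t. *)
Lemma macdonald_macd m S F :
  is_macdonald q t [multinom if i == ord0 then m else 0%N | i < N] S F ->
  exists a b : int, F = (q ^ a * t ^ b) *: macd m S.
Proof.
set alpha := [multinom _ | _ < _]; move=> [[a [b [w [v [[_ wmin] FE]]]]] eF].
have w0 : w = [::].
  apply/nilP; rewrite /nilp -leqn0; apply: (wmin [::]).
  by rewrite /sorts /= alpha_sorted eqxx.
have vE : op_inv (tau_word t w) (tab K S) = tab K S.
  by rewrite w0 /op_inv; case: xgetP => [x _ //|/(_ (tab K S)) /= []].
rewrite vE in FE.
have dF : deg m F.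
  rewrite FE; apply: deg_lin.
    by apply: deg_tens; rewrite dhomogX /= mdeg_alpha.
  move=> U; rewrite sum_ffunE; apply: rpred_sum => beta /andP[/eqP mb _].
  by apply: deg_tens; rewrite dhomogX /= -mb mdeg_alpha.
have FS : (F S)@_alpha = q ^ a * t ^ b.
  rewrite FE !ffunE mcoeffD eqxx scale1r mcoeffZ mcoeffX eqxx mulr1 sum_ffunE raddf_sum.
  rewrite big1 ?addr0 // => beta tb; rewrite /= ffunE mcoeffZ mcoeffX.
  by case: eqP tb => [->|]; rewrite ?triangle_irr // mulr0.
have F0 : F != 0.
  apply: contra_eq_neq FS => ->; rewrite ffunE mcoeff0 eq_sym.
  by rewrite mulf_neq0 ?expfz_neq0.
have MM := tensor_model htau n0 q0 t0 tgen qtgen.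
have eigF : eig n t hTl hWl (spv q t m 0 (ct S)) F.
  move=> k kn; rewrite -(cherednik_xi htau n0 q0 t0 tgen F kn) eF /spectral rank_alpha.
  rewrite mnmE /spv ltn0 /ct -val_eqE /= inordK //.
  by case: k kn => [|k] kn //=; rewrite expr0 mul1r.
have [S' [cS [l lE]]] := eig_macd MM dF eigF F0.
have SS : S' = S.
  apply: (content_inj htau) => i; have iE : io i = i by apply: val_inj; rewrite /= inordK.
  by have := cS i (ltn_ord i); rewrite /ct iE => ->.
rewrite SS in lE; have [a' [b' lM]] := lead_macd htau n0 q0 t0 tgen m S.
exists (a - a'), (b - b').
suff -> : q ^ (a - a') * t ^ (b - b') = l by [].
have ab0 : q ^ a' * t ^ b' != 0 by rewrite mulf_neq0 ?expfz_neq0.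
apply: (mulIf ab0); rewrite mulrACA -!expfzDr // !subrK -FS lE ffunE mcoeffZ; congr (_ * _).
have /ffunP/(_ S) := lM; rewrite !ffunE eqxx => lS.
have aE : alpha = (U_(ord0) *+ m)%MM := alphaE n m.
have o0 : ord0 = io 0 by apply: val_inj; rewrite /= inordK.
by rewrite aE o0 lS; exact: mulr1.
Qed.

End Uniqueness.

Section Vanishing.
Variables (C : fieldType) (q0 t0 : C).
Local Notation K := {fraction {mpoly C[2]}}.
Local Notation rel := (rel q0 t0).
Implicit Types (x f : K) (e : int).

(** A lower bound for the order of vanishing along f, negative for poles. The regular factor may
    itself vanish at the point, so bounds add under products but need not be exact. *)
Definition zord f e x : Prop := exists2 y, x = f ^ e * y & exists c, rel y c.

Lemma zord_mul f e e' x x' : f != 0 -> zord f e x -> zord f e' x' -> zord f (e + e') (x * x').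
Proof.
move=> f0 [y -> [c yc]] [y' -> [c' yc']]; exists (y * y'); last by exists (c * c'); exact: relM.
by rewrite expfzDr // mulrACA.
Qed.

Lemma zord_prod (I : Type) (r : seq I) f (e : I -> int) (x : I -> K) : f != 0 ->
  (forall i, zord f (e i) (x i)) -> zord f (\sum_(i <- r) e i) (\prod_(i <- r) x i).
Proof.
move=> f0 xe; apply: (big_ind2 (zord f)) => [|e1 x1 e2 x2|i _].
- by exists 1; [rewrite expr0z mulr1 | exists 1; exact: rel1].
- exact: zord_mul.
exact: xe.
Qed.

Lemma zord1 f x : rel f 0 -> zord f 1 x -> rel x 0.
Proof. by move=> f0 [y -> [c yc]]; rewrite expr1z -(mul0r c); exact: relM. Qed.

Lemma zord0 f x c : rel x c -> zord f 0 x.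
Proof. by move=> xc; exists x; [rewrite expr0z mul1r | exists c]. Qed.

End Vanishing.

Section SingularMacdonald.
Variables (C : fieldType) (n m : nat) (tau : seq nat) (q0 t0 : C) (S : rsyt n.+1 tau) (z : int).
Local Notation N := n.+1.
Local Notation K := {fraction {mpoly C[2]}}.
Hypotheses (htau : is_partition N tau) (n0 : (0 < n)%N) (qC0 : q0 != 0) (tC0 : t0 != 0)
  (tCgen : forall b : int, b != 0 -> t0 ^ b != 1)
  (qm : q0 ^+ m.+1 * t0 ^ (content S ord0 - z) = 1)
  (qCneq : forall (a : nat) (b : int), (0 < a < m.+1)%N -> q0 ^+ a * t0 ^ b != 1)
  (zS : z \in hat_contents S ord0).
Local Notation tK0 := (tvar_neq0 C).
Local Notation qK0 := (qvar_neq0 C).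
Local Notation tKgen := (@generic_t C).
Local Notation PK := (polytab K N tau).
Local Notation PC := (polytab C N tau).
Local Notation q := (qvar : K).
Local Notation t := (tvar : K).
Local Notation io := (@inord n).
Local Notation rel := (rel q0 t0).
Local Notation relF := (@relF C q0 t0 n tau).
Local Notation hTl := (fun k => @hT K n tau t k : {linear PK -> PK}).
Local Notation hWl := (@hW K n tau q t : {linear PK -> PK}).
Local Notation hXl := (fun k => @hX K n tau k : {linear PK -> PK}).
Local Notation macd := (macd n q t hTl hWl hXl (@ct n tau) (@vac K n tau)).
Let MM := tensor_model htau n0 qK0 tK0 tKgen (@generic_qt C).

Let io0 : io 0 = ord0.
Proof. by apply: val_inj; rewrite /= inordK. Qed.

Let X : K := q ^+ m.+1 * t ^ ct S 0.

Let relX0 : rel X (t0 ^ z).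
Proof.
have -> : t0 ^ z = q0 ^+ m.+1 * t0 ^ ct S 0.
  have -> : t0 ^ ct S 0 = t0 ^ (content S ord0 - z) * t0 ^ z.
    by rewrite -expfzDr // subrK /ct io0.
  by rewrite mulrA qm mul1r.
by apply: relM; [apply: relX; exact: rel_q | exact: (rel_tX q0 tC0)].
Qed.

Let tz_neq (e : int) : e != z -> t0 ^ z - t0 ^ e != 0.
Proof.
move=> ez; rewrite subr_eq0; apply: contraNneq (@tCgen (e - z) _) => [E|].
  by rewrite expfzDr // -E -expfzDr // subrr.
by rewrite subr_eq0.
Qed.

Let rK (x : K) := exists c, rel x c.
Let rV (F : PK) := exists A, relF F A.

Let rK_mul a b : rK a -> rK b -> rK (a * b).
Proof. by move=> [c ac] [d bd]; exists (c * d); exact: relM. Qed.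
Let rK_sub a b : rK a -> rK b -> rK (a - b).
Proof. by move=> [c ac] [d bd]; exists (c - d); exact: relB. Qed.
Let rK1 : rK 1.
Proof. by exists 1; exact: rel1. Qed.
Let rKt (b : int) : rK (t ^ b).
Proof. by exists (t0 ^ b); exact: (rel_tX q0 tC0). Qed.
Let rV_add F G : rV F -> rV G -> rV (F + G).
Proof. by move=> [A FA] [B GB]; exists (A + B); exact: relFD. Qed.
Let rV_scale a F : rK a -> rV F -> rV (a *: F).
Proof. by move=> [c ac] [A FA]; exists (c *: A); exact: relFZ. Qed.
Let rV_T k F : (k < n)%N -> rV F -> rV (hTl k F).
Proof. by move=> kn [A FA]; exists (hT t0 k A); exact: (relF_hT htau tK0 tKgen tC0 tCgen kn FA). Qed.
Let rV_W F : rV F -> rV (hWl F).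
Proof. by move=> [A FA]; exists (hW q0 t0 A); exact: (relF_hW htau n0 tK0 qK0 tKgen tC0 qC0 tCgen FA). Qed.
Let rV_X F : rV F -> rV (hXl n F).
Proof. by move=> [A FA]; exists (hX n A); exact: relF_hX. Qed.
Let rV_vac U : rV (@vac K n tau U).
Proof. by exists (vac C U); apply: relF_tens; [exact: relP1 | exact: relV_tab]. Qed.

Let macd_reg : exists A, relF (macd m S) A.
Proof.
change (rV (macd m S)).
apply: (macd_regular MM rK_mul rK_sub rK1 rKt rV_add rV_scale rV_T rV_W rV_X rV_vac).
move=> m' a b /andP[m'0 m'm]; exists (q0 ^+ m' * t0 ^ a - t0 ^ b)^-1; apply: rel_inv.
  rewrite subr_eq0; apply: contraNneq (@qCneq m' (a - b) _) => [E|].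
    by rewrite expfzDr // mulrA E -expfzDr // subrr.
  by rewrite m'0 ltnS.
apply: relB; last exact: (rel_tX q0 tC0).
by apply: relM; [apply: relX; exact: rel_q | exact: (rel_tX q0 tC0)].
Qed.

Let macd_regS : exists A, relF (macd m.+1 S) A.
Proof.
change (rV (macd m.+1 S)).
pose l := [seq ct S' 1 | S' <- enum {: rsyt N tau} & ct S' 0 == ct S 0].
apply: (macd_regularS MM rK_sub rK1 rKt rV_add rV_scale rV_T rV_W rV_X macd_reg (l := l)).
  move=> e /mapP[S']; rewrite mem_filter => /andP[/eqP S'0 _] eE.
  exists (t0 ^ z - t0 ^ e)^-1; apply: rel_inv.
    apply: tz_neq; rewrite eE /ct.
    apply: (content1_neq htau (one := ord0) _ zS) => //; first by rewrite /= inordK.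
    by move: S'0; rewrite /ct io0.
  by apply: relB; [exact: relX0 | exact: (rel_tX q0 tC0)].
by move=> S' S'0; apply/mapP; exists S' => //; rewrite mem_filter S'0 eqxx mem_enum.
Qed.

Let f : K := X - t ^ z.

Let relf0 : rel f 0.
Proof. by rewrite -(subrr (t0 ^ z)); apply: relB; [exact: relX0 | exact: (rel_tX q0 tC0)]. Qed.

Let f0 : f != 0.
Proof.
rewrite subr_eq0; apply/eqP => E.
have [] // := @generic_qt C m.+1 (ct S 0 - z).
by rewrite expfzDr ?tvar_neq0 // mulrA -/X E -expfzDr ?tvar_neq0 // subrr.
Qed.

Let rel_Xt (e : int) : rel (X - t ^ e) (t0 ^ z - t0 ^ e).
Proof. by apply: relB; [exact: relX0 | exact: (rel_tX q0 tC0)]. Qed.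

(** With X = t^z at the point, the factor t X - t^e vanishes just for e = z + 1, the factor X -
    t^(e+1) just for e = z - 1, and the squared denominator just for e = z. *)
Let zord_kap k : zord q0 t0 f
  ((ct S k.+1 == z + 1)%:Z + (ct S k.+1 == z - 1)%:Z - ((ct S k.+1 == z)%:Z *+ 2))
  (kapc q t m.+1 (ct S) k).
Proof.
rewrite /kapc /kap -/X; move: (ct S k.+1) => e.
have tS (b : int) : t * t ^ b = t ^ (b + 1) by rewrite expfzDr ?tvar_neq0 // mulrC.
apply: zord_mul f0 _ _; first apply: zord_mul f0 _ _.
- case: eqVneq => [->|ez]; last first.
    apply: (@zord0 C q0 t0 _ _ (t0 * t0 ^ z - t0 ^ e)); apply: relB; last exact: (rel_tX q0 tC0).
    by apply: relM relX0; exact: rel_t.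
  exists t; last by exists t0; exact: rel_t.
  by rewrite expr1z -tS /f; ring.
- rewrite tS; case: eqVneq => [->|ez]; last by apply: zord0; exact: rel_Xt.
  by exists 1; [rewrite subrK expr1z mulr1 | exact: rK1].
case: eqVneq => [->|ez].
  by exists 1; [rewrite mulr1 -/f -exprnN | exact: rK1].
have -> : - (false%:Z *+ 2) = 0 by [].
apply: (@zord0 C q0 t0 _ _ ((t0 ^ z - t0 ^ e) ^+ 2)^-1).
by apply: rel_inv; [rewrite expf_neq0 ?tz_neq | apply: relX; exact: rel_Xt].
Qed.

Let zord_1X : zord q0 t0 f (z == 0)%:Z (1 - X).
Proof.
case: eqVneq => [z0|z0].
  exists (-1); last by exists (-1); apply: relN; exact: rel1.
  by rewrite expr1z /f z0 expr0z; ring.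
by apply: zord0; apply: relB; [exact: rel1 | exact: relX0].
Qed.

Let card_label (y : int) :
  #|[set i | (i != ord0) && (content S i == y)]| = (\sum_(k < n) (ct S k.+1 == y))%N.
Proof.
rewrite -sum1_card big_mkcond big_ord_recl /= inE eqxx /= add0n.
apply: eq_bigr => k _; rewrite inE /= /ct.
have -> : io k.+1 = lift ord0 k by apply: val_inj; rewrite /= inordK // ltnS.
by case: eqP.
Qed.

(* By [hat_count] the zeros outnumber the poles by exactly one. *)
Let scalar0 : rel ((\prod_(k < n) kapc q t m.+1 (ct S) k) * (1 - X)) 0.
Proof.
apply: (zord1 relf0).
have -> : (1 : int) = \sum_(k < n) ((ct S k.+1 == z + 1)%:Z + (ct S k.+1 == z - 1)%:Z
    - ((ct S k.+1 == z)%:Z *+ 2)) + (z == 0)%:Z.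
  rewrite sumrB big_split /= sumrMnl.
  have sE (y : int) : \sum_(k < n) (ct S k.+1 == y)%:Z =
      #|[set i | (i != ord0) && (content S i == y)]|%:Z.
    by rewrite card_label (big_morph Posz PoszD erefl).
  by rewrite !sE; have := hat_count htau (one := ord0) erefl zS; lia.
by apply: zord_mul f0 _ zord_1X; apply: zord_prod f0 _ => k; exact: zord_kap.
Qed.

Lemma singular_macdonald (F : PK) :
  is_macdonald q t [multinom if i == ord0 then m.+1 else 0%N | i < N] S F ->
  is_singular_at q0 t0 F.
Proof.
move=> /(macdonald_macd htau n0 qK0 tK0 tKgen (@generic_qt C)) [a [b FE]].
have rab : rel (q ^ a * t ^ b) (q0 ^ a * t0 ^ b).
  by apply: relM; [apply: relXz qC0 _; exact: rel_q | exact: (rel_tX q0 tC0)].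
case: macd_regS => A YA; case: macd_reg => B ZB.
have np : no_pole_at q0 t0 F.
  move=> U beta; have := relFZ rab YA U beta; rewrite -FE; exact: rel_regular.
split=> // i; have -> : i = io i by apply: val_inj; rewrite /= inordK.
have kn : (i <= n)%N by rewrite -ltnS.
have := relF_dunkl htau n0 tK0 qK0 tKgen tC0 qC0 tCgen kn (relF_specialize np).
have DE := @dlastE K n tau q t htau n0 qK0 tK0 tKgen.
(* [H] says that the generic Dunkl image of F takes at the point the value obtained by specializing
   F first. By uniqueness of values it remains to show that 0 is also its value. *)
rewrite (dunkl_dunkl_op q n0 tK0 F kn) {1}FE (dunkl_opZ MM DE) => H; apply: (relF_fun H) => {H}.
have r0 : relF 0 0 by move=> U; rewrite !ffunE; exact: relP0.
have [i0|i0] := posnP i; last first.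
  have -> : dunkl_op n t hTl (@dlast K n tau q t) i (macd m.+1 S) = 0.
    by apply: (dunkl_macd MM DE); rewrite i0.
  by rewrite scaler0.
rewrite i0.
have -> : dunkl_op n t hTl (@dlast K n tau q t) 0 (macd m.+1 S) = _ := dunkl_macd0 MM DE m S.
(* 0 is written as a vanishing scalar times a value of [macd m S]; that this lower polynomial is
   regular is needed here as well. *)
have -> : (0 : PC) = (q0 ^ a * t0 ^ b) *: ((0 * (q0 ^+ m * t0 ^ ct S 0)) *: B).
  by rewrite mul0r scale0r scaler0.
apply: relFZ rab _; apply: relFZ ZB; apply: relM scalar0 _.
by apply: relM; [apply: relX; exact: rel_q | exact: (rel_tX q0 tC0)].
Qed.

End SingularMacdonald.

Theorem theorem30 (R : realType) (N : nat) (hN : (2 <= N)%N)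
    (tau : seq nat) (htau : is_partition N tau) (S : rsyt N tau)
    (m : nat) (hm : (1 <= m)%N) (z : int) (u : R[i]) (k : int)
    (M : polytab {fraction {mpoly (R[i])[2]}} N tau) :
  let one : 'I_N := Ordinal (ltnW hN) in
  let alpha : 'X_{1..N} := [multinom if i == one then m else 0%N | i < N] in
  let n : int := content S one - z in
  let g : nat := gcdn m `|n| in
  let omega : R[i] := cexpi (2 * pi * k%:~R / m%:R) in
  z \in hat_contents S one ->
  n != 0 ->
  u != 0 ->
  (forall j : nat, (0 < j)%N -> u ^+ j != 1) ->
  coprimez k g%:Z ->
  is_generic_macdonald alpha S M ->
  is_singular_at (omega * u ^ (- (n %/ g%:Z)%Z)) (u ^ (m %/ g)%N%:Z) M.
Proof.
case: N hN htau S M => [//|N] hN htau S M one alpha n g omega.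
have one0 : one = ord0 by apply: val_inj.
rewrite /g /n /omega /alpha {g n omega alpha} one0; case: m hm => // m _ zS n0 u0 ugen kg.
set w := cexpi _.
have wE : w = cexpi (2 * pi / m.+1%:R) ^ k.
  by rewrite -cexpiMz /w -mulrzr; congr (cexpi _); ring.
have wm : w ^+ m.+1 = 1.
  by rewrite wE; apply: exprz_root; exact: cexpi_root.
have wp a : w ^+ a = 1 -> (m.+1 %| a * `|k|)%N.
  by rewrite wE exprnP exprz_exp (mulrC k) => /(cexpi_eq1 (ltn0Sn m)); rewrite abszM.
(* [hN] now reads 2 <= N + 1, which is convertible to the required 0 < N. *)
apply: (singular_macdonald (z := z) htau hN).
- exact: special_q0.
- exact: special_t0.
- exact: special_tgen.
- exact: special_qm.
- move=> a b; apply: (special_neq (k := k)) => //.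
  by move: kg; rewrite coprimezE.
Qed.
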